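(* Fix any pair $(a,b)\in\mathbb{Z}^2$ and put $I=\mathbb{Z}^2\setminus\{(a,b)\}$. For $(m,n)\in\mathbb{Z}^2$ let $f_{m,n}\in L^2(\mathbb{R})$ be the function $f_{m,n}(t)=e^{2\pi i n t}\, e^{-\pi (t-m)^2}$. Consider the Gabor system $\{f_{m,n}: (m,n)\in I\}$, which is complete and minimal in $L^2(\mathbb{R})$, and let $\{\gamma_{m,n,a,b}: (m,n)\in I\}$ be its unique biorthogonal family in $L^2(\mathbb{R})$. Then there exist positive constants $c_{m,n}$, $(m,n)\in I$, such that the weighted Gabor system $$\{c_{m,n}\, e^{2\pi i n t}\, e^{-\pi(t-m)^2}: (m,n)\in I\}$$ is a complete Riesz-Fischer sequence in $L^2(\mathbb{R})$ and a lower semi frame for $L^2(\mathbb{R})$. In particular, this holds for every choice of positive constants $c_{m,n}$, $(m,n)\in I$, satisfying $$\sum_{(m,n)\in I}\frac{\|\gamma_{m,n,a,b}\|_{L^2(\mathbb{R})}^2}{c_{m,n}^2}<\infty .$$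
   Context: Let $\{f_k\}_{k\in K}$ be a countable family in a separable Hilbert space $\mathcal{H}$ with inner product $\langle\cdot,\cdot\rangle$ and norm $\|\cdot\|$. The family is complete if its closed linear span is $\mathcal{H}$. It is minimal if each $f_k$ lies outside the closed linear span of the remaining elements. A biorthogonal family to $\{f_k\}$ is a family $\{g_k\}_{k\in K}$ in $\mathcal{H}$ with $\langle f_k,g_l\rangle=\delta_{k,l}$ for all $k,l\in K$; it exists if and only if $\{f_k\}$ is minimal, and it is unique if $\{f_k\}$ is complete and minimal. The family is a Riesz-Fischer sequence if for every $\{a_k\}\in\ell^2(K)$ there is $f\in\mathcal{H}$ with $\langle f,f_k\rangle=a_k$ for all $k\in K$. The family is a lower semi frame for $\mathcal{H}$ if there is a constant $C>0$ such that $C\|f\|^2\le\sum_{k}|\langle f,f_k\rangle|^2$ for all $f\in\mathcal{H}$ (the sum may equal $+\infty$). *)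

(* Defs.v *)
From mathcomp Require Import all_boot all_order all_algebra.
From mathcomp Require Import all_classical all_reals all_analysis.
From mathcomp Require Export complex.

Set Implicit Arguments.
Unset Strict Implicit.
Unset Printing Implicit Defensive.

Import Order.TTheory GRing.Theory Num.Theory.
Import ComplexField.Normc.

Local Open Scope classical_set_scope.
Local Open Scope complex_scope.
Local Open Scope ring_scope.

(* Elements of L^2(R) are represented by functions R -> C; two functions stand
   for the same element when they agree almost everywhere. *)
Section L2.
Context {R : realType}.
Implicit Types f g : R -> R[i].

Local Notation mu := (@lebesgue_measure R).

(* Extended-real valued: +oo on functions that are not square integrable. *)
Definition normL2 f : \bar R := Lnorm mu 2%:E (fun t => (normc (f t))%:E).

Definition inL2 f : Prop :=
  [/\ measurable_fun [set: R] (fun t => complex.Re (f t)),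
      measurable_fun [set: R] (fun t => complex.Im (f t)) &
      (normL2 f < +oo)%E].

Definition eqL2 f g : Prop := {ae mu, forall t, f t = g t}.

Definition cintegral f : R[i] :=
  (\int[mu]_t complex.Re (f t)) +i* (\int[mu]_t complex.Im (f t)).

(* Linear in the first argument. *)
Definition dotL2 f g : R[i] := cintegral (fun t => f t * (g t)^*).

End L2.

(* A family in L^2(R) is a function on an index type T, of which only the values
   at the indices in D : set T matter. *)
Section Families.
Context {R : realType} {T : choiceType}.
Implicit Types (D : set T) (F G : T -> R -> R[i]).

Definition closed_span D F : set (R -> R[i]) :=
  [set f : R -> R[i] | inL2 f /\
    forall e : R, 0 < e -> exists (s : seq T) (z : T -> R[i]),
      (forall k, k \in s -> D k) /\
      (normL2 (fun t => f t - \sum_(k <- s) z k * F k t)%R < e%:E)%E].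

Definition complete_family D F : Prop := forall f, inL2 f -> closed_span D F f.

Definition minimal_family D F : Prop :=
  forall k, D k -> ~ closed_span (D `\ k) F (F k).

Definition biorthogonal D F G : Prop :=
  (forall k, D k -> inL2 (G k)) /\
  (forall k l, D k -> D l -> dotL2 (F k) (G l) = (k == l)%:R).

Definition unique_biorthogonal D F G : Prop :=
  biorthogonal D F G /\
  (forall G', biorthogonal D F G' -> forall k, D k -> eqL2 (G' k) (G k)).

Definition riesz_fischer D F : Prop :=
  forall z : T -> R[i],
    (\esum_(k in D) (normc (z k) ^+ 2)%:E < +oo)%E ->
    exists2 f, inL2 f & forall k, D k -> dotL2 f (F k) = z k.

Definition lower_semi_frame D F : Prop :=
  exists2 C : R, 0 < C &
    forall f, inL2 f ->
      (C%:E * normL2 f ^+ 2 <=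
       \esum_(k in D) (normc (dotL2 f (F k)) ^+ 2)%:E)%E.

End Families.

Section Gabor.
Context {R : realType}.

Definition expi (x : R) : R[i] := cos x +i* sin x.

Definition gabor (k : int * int) (t : R) : R[i] :=
  expi (2 * pi * k.2%:~R * t) * (expR (- pi * (t - k.1%:~R) ^+ 2))%:C.

Definition weighted_gabor (c : int * int -> R) (k : int * int) (t : R) : R[i] :=
  (c k)%:C * gabor k t.

End Gabor.

(* Main.v *)
Require Import Defs.
From mathcomp Require Import all_boot all_order all_algebra.
From mathcomp Require Import all_classical all_reals all_analysis.
From mathcomp Require Import measurable_realfun ring lra.

(** The proof has an abstract half, valid for any complete family F with a
    biorthogonal family G, and a concrete half about the Gaussian.

    Abstract half. Suppose that the sum of |G k|^2 / c k^2 is at most B. For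
    square-summable coefficients z, Cauchy-Schwarz makes the series of the
    (z k / c k) G k absolutely convergent, and its sum f satisfies <f, c k F
    k> = z k (moment_solution): this is the Riesz-Fischer property. If z
    consists of the coefficients of some g, then f = g by completeness, so
    the norm of g is controlled by that of z: this is the lower semi frame
    bound (lower_semi_frame_weighted). Weights with a finite sum exist
    because the index set is countable (exists_weights). Minimality and
    uniqueness of G are formal consequences of biorthogonality and
    completeness.

    Concrete half, biorthogonality. Let W k be the tail, from k on, of the
    alternating series of the values e^(-pi (j + 1/2)^2). Bastiaans' dual
    window is e^(pi t^2) W |k|, where k is the integer nearest to t. Its
    time-frequency shifts by integers pair to 0 with all Gaussian atoms but
    one: cut into unit cells, such a pairing is a multiple of the sum over k
    of W |k| e^(2 pi d k), which vanishes for every nonzero integer d and is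
    a nonzero theta constant for d = 0 (dual_sum_cvg, dual_window_pairing).
    The dual window is bounded but keeps a fixed size near the
    half-integers, in neighbourhoods of length about 1/|k|; it just misses
    being square integrable. With alternating signs, the difference of two
    of its shifts decays like 1/|t| (dual_atom_diff). Subtracting the shift
    at the removed lattice point therefore gives a biorthogonal family in
    L^2 (biorthogonal_dual_family).

    Concrete half, completeness. Let h be orthogonal to all atoms but the
    one at (a, b). For each m, the product of h with the Gaussian centred at
    m then has at most one nonzero integral against the exponentials of
    integer frequency, and none unless m = a. So its integral against any
    bounded function of period 1 is known (multiplier_sfrac,
    orthogonal_pairing). Choosing for each m a suitable periodic function,
    and summing over m by the same series as above, isolates h on a small
    interval (cell_identity): almost everywhere, h is a multiple of the
    shift of the dual window to (a, b) (orthogonal_is_dual_atom). As this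
    shift is not square integrable (dual_window_sq_not_integrable), h is
    null (orthogonal_eq0). *)

Set Implicit Arguments.
Unset Strict Implicit.
Unset Printing Implicit Defensive.

Import Order.TTheory GRing.Theory Num.Theory.
Import numFieldNormedType.Exports.
Import ComplexField.Normc.

Local Open Scope classical_set_scope.
Local Open Scope complex_scope.
Local Open Scope ring_scope.

(** * Square-integrable functions *)

Local Notation RE := (@complex.Re _).
Local Notation IM := (@complex.Im _).

Section complex_parts.
Variable R : realType.
Implicit Types x y : R[i].

Lemma REE (a b : R) : RE (a +i* b) = a. Proof. by []. Qed.
Lemma IME (a b : R) : IM (a +i* b) = b. Proof. by []. Qed.
Lemma RED x y : RE (x + y) = RE x + RE y.
Proof. by case: x; case: y. Qed.
Lemma IMD x y : IM (x + y) = IM x + IM y.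
Proof. by case: x; case: y. Qed.
Lemma REN x : RE (- x) = - RE x.
Proof. by case: x. Qed.
Lemma IMN x : IM (- x) = - IM x.
Proof. by case: x. Qed.
Lemma REM x y : RE (x * y) = RE x * RE y - IM x * IM y.
Proof. by case: x; case: y. Qed.
Lemma IMM x y : IM (x * y) = RE x * IM y + IM x * RE y.
Proof. by case: x; case: y. Qed.
Lemma REC x : RE x^* = RE x.
Proof. by case: x. Qed.
Lemma IMC x : IM x^* = - IM x.
Proof. by case: x. Qed.
Lemma complexP x y : RE x = RE y -> IM x = IM y -> x = y.
Proof. by case: x => ? ?; case: y => ? ? /= -> ->. Qed.
Lemma normc_sqr x : normc x ^+ 2 = RE x ^+ 2 + IM x ^+ 2.
Proof. by case: x => a b; rewrite /normc sqr_sqrtr// addr_ge0// sqr_ge0. Qed.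
Lemma normc_nonneg x : 0 <= normc x.
Proof. by case: x => a b; exact: sqrtr_ge0. Qed.

End complex_parts.

Definition ReImE := (RED, IMD, REN, IMN, REM, IMM, REC, IMC).

Section L2basics.
Variable R : realType.
Local Notation mu := (@lebesgue_measure R).
Implicit Types f g h : R -> R[i].

Definition integ (u : R -> R) := mu.-integrable setT (EFin \o u).

Definition sqn f t : R := RE (f t) ^+ 2 + IM (f t) ^+ 2.
Definition cip f g t : R := RE (f t) * RE (g t) + IM (f t) * IM (g t).
Definition l2nsq f : R := \int[mu]_t sqn f t.
Definition l2n f : R := Num.sqrt (l2nsq f).
(** The real part of the inner product. It makes square-integrable functions a
    real inner product space, which is enough for Cauchy-Schwarz and for
    projections. *)
Definition ip f g : R := \int[mu]_t cip f g t.
Definition scl (z : R[i]) f : R -> R[i] := fun t => z * f t.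

Lemma sqn_ge0 f t : 0 <= sqn f t.
Proof. by rewrite addr_ge0// sqr_ge0. Qed.

Lemma normL2_sqn f : normL2 f = ((\int[mu]_t (sqn f t)%:E) `^ 2^-1)%E.
Proof.
rewrite /normL2 unlock; congr (_ `^ _)%E.
apply: eq_integral => t _.
rewrite abse_EFin poweR_EFin powR_mulrn ?normr_ge0// ger0_norm ?normc_sqr ?normc_nonneg//.
Qed.

Lemma measurable_sqn f : measurable_fun setT (RE \o f) ->
  measurable_fun setT (IM \o f) -> measurable_fun setT (sqn f).
Proof. by move=> ? ?; apply: measurable_funD; apply: measurable_funX. Qed.

(** The norm of the definition is a power of an extended integral; all proofs
    go through integrability of the squared modulus. *)
Lemma inL2P f : inL2 f <-> [/\ measurable_fun setT (RE \o f),
  measurable_fun setT (IM \o f) & integ (sqn f)].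
Proof.
split=> -[mR mI h]; split => //.
  apply/integrableP; split; first by apply/measurable_EFinP; apply: measurable_sqn.
  move: h; rewrite normL2_sqn => /(lty_poweRy _) h.
  under eq_integral do rewrite /= ger0_norm ?sqn_ge0//.
  by apply: h; rewrite invr_eq0.
rewrite normL2_sqn poweR_lty//.
move: h => /integrableP[_].
by under eq_integral do rewrite /= ger0_norm ?sqn_ge0//.
Qed.

Lemma inL2_mRE f : inL2 f -> measurable_fun setT (fun t => RE (f t)).
Proof. by case. Qed.
Lemma inL2_mIM f : inL2 f -> measurable_fun setT (fun t => IM (f t)).
Proof. by case. Qed.
Lemma inL2_integ f : inL2 f -> integ (sqn f).
Proof. by move=> /inL2P[]. Qed.

Lemma l2nsq_ge0 f : 0 <= l2nsq f.
Proof. by apply: Rintegral_ge0 => t _; exact: sqn_ge0. Qed.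
Lemma l2n_ge0 f : 0 <= l2n f. Proof. exact: sqrtr_ge0. Qed.
Lemma l2nE f : l2n f ^+ 2 = l2nsq f. Proof. by rewrite sqr_sqrtr// l2nsq_ge0. Qed.

Lemma normL2E f : inL2 f -> normL2 f = (l2n f)%:E.
Proof.
move=> /inL2_integ h; rewrite normL2_sqn.
have /fineK <- := integrable_fin_num measurableT h.
by rewrite poweR_EFin powR12_sqrt ?l2nsq_ge0.
Qed.

Lemma integ_le (u v : R -> R) : measurable_fun setT u -> integ v ->
  (forall t, `|u t| <= v t) -> integ u.
Proof.
move=> mu_ iv uv; apply: (le_integrable measurableT _ _ iv) => //.
  exact/measurable_EFinP.
by move=> t _; rewrite /= lee_fin (le_trans (uv t))// ler_norm.
Qed.

Lemma integ_mfun u : integ u -> measurable_fun setT u.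
Proof. by move=> /measurable_int /measurable_EFinP. Qed.

Lemma integD u v : integ u -> integ v -> integ (fun t => u t + v t).
Proof. by move=> hu hv; exact: (integrableD measurableT hu hv). Qed.
Lemma integB u v : integ u -> integ v -> integ (fun t => u t - v t).
Proof. by move=> hu hv; exact: (integrableB measurableT hu hv). Qed.
Lemma integZ k u : integ u -> integ (fun t => k * u t).
Proof. by move=> hu; exact: (integrableZl measurableT k hu). Qed.
Lemma integ0 : integ (fun=> 0).
Proof. exact: integrable0. Qed.
Lemma integ_abs u : integ u -> integ (fun t => `|u t|).
Proof. exact: integrable_norm. Qed.
Lemma eq_integ u v : u =1 v -> integ u -> integ v.
Proof. by move=> /funext ->. Qed.

Lemma integ_prod (u v : R -> R) : measurable_fun setT u -> measurable_fun setT v ->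
  integ (fun t => u t ^+ 2) -> integ (fun t => v t ^+ 2) -> integ (fun t => u t * v t).
Proof.
move=> mu_ mv iu iv; apply: (integ_le _ (integD iu iv)).
  exact: measurable_funM.
move=> t; rewrite normrM -[u t ^+ 2]real_normK ?num_real// -[v t ^+ 2]real_normK ?num_real//.
have := normr_ge0 (u t); have := normr_ge0 (v t).
set a := `|u t|; set b := `|v t| => b0 a0.
have : 0 <= (a - b) ^+ 2 by exact: sqr_ge0.
have : 0 <= a * b by exact: mulr_ge0.
by rewrite sqrrB; lra.
Qed.

Lemma inL2_sqRE f : inL2 f -> integ (fun t => RE (f t) ^+ 2).
Proof.
move=> hf; apply: (integ_le _ (inL2_integ hf)).
  by apply: measurable_funX; exact: inL2_mRE.
by move=> t; rewrite ger0_norm ?sqr_ge0// lerDl sqr_ge0.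
Qed.
Lemma inL2_sqIM f : inL2 f -> integ (fun t => IM (f t) ^+ 2).
Proof.
move=> hf; apply: (integ_le _ (inL2_integ hf)).
  by apply: measurable_funX; exact: inL2_mIM.
by move=> t; rewrite ger0_norm ?sqr_ge0// lerDr sqr_ge0.
Qed.

Lemma integ_cip f g : inL2 f -> inL2 g -> integ (cip f g).
Proof.
move=> hf hg; apply: integD; apply: integ_prod;
  by [exact: inL2_mRE|exact: inL2_mIM|exact: inL2_sqRE|exact: inL2_sqIM].
Qed.

Lemma inL2_0 : inL2 (0 : R -> R[i]).
Proof.
apply/inL2P; split; try exact: measurable_cst.
by apply: eq_integ integ0 => t; rewrite /sqn /= expr0n addr0.
Qed.

Lemma inL2_scl z f : inL2 f -> inL2 (scl z f).
Proof.
move=> hf; apply/inL2P; split.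
- rewrite (_ : _ \o _ = fun t => RE z * RE (f t) - IM z * IM (f t)).
    by apply: measurable_funB; apply: measurable_funM => //;
      [exact: inL2_mRE|exact: inL2_mIM].
  by apply/funext => t; rewrite /= /scl ReImE.
- rewrite (_ : _ \o _ = fun t => RE z * IM (f t) + IM z * RE (f t)).
    by apply: measurable_funD; apply: measurable_funM => //;
      [exact: inL2_mIM|exact: inL2_mRE].
  by apply/funext => t; rewrite /= /scl ReImE.
- apply: eq_integ (integZ (normc z ^+ 2) (inL2_integ hf)) => t.
  by rewrite /sqn /scl !ReImE normc_sqr; ring.
Qed.

Lemma inL2_add f g : inL2 f -> inL2 g -> inL2 (f + g).
Proof.
move=> hf hg; apply/inL2P; split.
- rewrite (_ : _ \o _ = fun t => RE (f t) + RE (g t)).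
    by apply: measurable_funD; exact: inL2_mRE.
  by apply/funext => t; rewrite /= ReImE.
- rewrite (_ : _ \o _ = fun t => IM (f t) + IM (g t)).
    by apply: measurable_funD; exact: inL2_mIM.
  by apply/funext => t; rewrite /= ReImE.
- apply: eq_integ (integD (integD (inL2_integ hf) (inL2_integ hg))
    (integZ 2 (integ_cip hf hg))) => t.
  by rewrite /sqn /cip /= !ReImE; ring.
Qed.

Lemma sclN1 f : scl (-1) f = - f.
Proof. by apply/funext => t; rewrite /scl mulN1r. Qed.

Lemma inL2_opp f : inL2 f -> inL2 (- f).
Proof. by rewrite -sclN1; exact: inL2_scl. Qed.
Lemma inL2_sub f g : inL2 f -> inL2 g -> inL2 (f - g).
Proof. by move=> hf hg; apply: inL2_add => //; exact: inL2_opp. Qed.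
Lemma inL2_sum (I : Type) (s : seq I) (P : pred I) (F : I -> R -> R[i]) :
  (forall i, P i -> inL2 (F i)) -> inL2 (\sum_(i <- s | P i) F i).
Proof. by move=> h; elim/big_ind : _ => //; [exact: inL2_0|exact: inL2_add]. Qed.

Lemma ipC f g : ip f g = ip g f.
Proof. by apply: eq_Rintegral => t _; rewrite /cip mulrC [X in _ + X]mulrC. Qed.

Lemma ipDl f g h : inL2 f -> inL2 g -> inL2 h -> ip (f + g) h = ip f h + ip g h.
Proof.
move=> hf hg hh; rewrite /ip -RintegralD//; try exact: integ_cip.
by apply: eq_Rintegral => t _; rewrite /cip /= !ReImE; ring.
Qed.

Lemma ipZl (r : R) f h : inL2 f -> inL2 h -> ip (scl r%:C f) h = r * ip f h.
Proof.
move=> hf hh; rewrite /ip -RintegralZl//; try exact: integ_cip.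
by apply: eq_Rintegral => t _; rewrite /cip /scl /= !ReImE/=; ring.
Qed.

Lemma ipDr f g h : inL2 f -> inL2 g -> inL2 h -> ip h (f + g) = ip h f + ip h g.
Proof. by move=> *; rewrite ipC ipDl// ipC [X in _ + X]ipC. Qed.
Lemma ipZr (r : R) f h : inL2 f -> inL2 h -> ip h (scl r%:C f) = r * ip h f.
Proof. by move=> *; rewrite ipC ipZl// ipC. Qed.

Lemma ipff f : ip f f = l2n f ^+ 2.
Proof. by rewrite l2nE; apply: eq_Rintegral => t _; rewrite /cip /sqn !expr2. Qed.

Lemma l2n_sqD f g : inL2 f -> inL2 g ->
  l2n (f + g) ^+ 2 = l2n f ^+ 2 + 2 * ip f g + l2n g ^+ 2.
Proof.
move=> hf hg; have hfg := inL2_add hf hg.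
by rewrite -ipff ipDl// !ipDr// !ipff (ipC g f); ring.
Qed.

Lemma l2n_scl z f : inL2 f -> l2n (scl z f) = normc z * l2n f.
Proof.
move=> hf; apply/eqP; rewrite -(@eqrXn2 _ 2)// ?l2n_ge0 ?mulr_ge0 ?l2n_ge0 ?normc_nonneg//.
rewrite exprMn !l2nE /l2nsq -RintegralZl//; last exact: inL2_integ.
apply/eqP; apply: eq_Rintegral => t _.
by rewrite /sqn /scl !ReImE normc_sqr; ring.
Qed.

Lemma l2nN f : inL2 f -> l2n (- f) = l2n f.
Proof. by move=> hf; rewrite -sclN1 l2n_scl// /normc /= oppr0 sqrrN expr0n addr0 expr1n sqrtr1 mul1r. Qed.

Lemma l2n0 : l2n (0 : R -> R[i]) = 0.
Proof. by rewrite (_ : 0 = scl 0 (0 : R -> R[i])) ?l2n_scl ?normc0 ?mul0r//; [exact: inL2_0|apply/funext => t; rewrite /scl mul0r]. Qed.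

Lemma cauchy_schwarz f g : inL2 f -> inL2 g -> `|ip f g| <= l2n f * l2n g.
Proof.
move=> hf hg.
(* the discriminant argument, in the variable r *)
have key r : 0 <= l2n f ^+ 2 + 2 * (r * ip f g) + r ^+ 2 * l2n g ^+ 2.
  have hr := inL2_scl r%:C hg.
  have := sqr_ge0 (l2n (f + scl r%:C g)).
  rewrite l2n_sqD// ipZr// l2n_scl// exprMn normc_sqr /=.
  by rewrite expr0n addr0.
rewrite -ler_sqr ?nnegrE ?mulr_ge0 ?l2n_ge0// real_normK ?num_real//.
have [g0|g0] := eqVneq (l2n g) 0.
  suff -> : ip f g = 0 by rewrite expr0n sqr_ge0.
  apply/eqP/negPn/negP => fg0.
  have := key (- (l2n f ^+ 2 + 1) / (2 * ip f g)).
  rewrite g0 expr0n mulr0 addr0.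
  rewrite (_ : 2 * _ = - (l2n f ^+ 2 + 1)); last by field.
  by lra.
have := key (- ip f g / l2n g ^+ 2).
rewrite (_ : _ + _ + _ = l2n f ^+ 2 - ip f g ^+ 2 / l2n g ^+ 2); last by field.
by rewrite subr_ge0 ler_pdivrMr ?exprn_even_gt0// exprMn.
Qed.

Lemma l2nD f g : inL2 f -> inL2 g -> l2n (f + g) <= l2n f + l2n g.
Proof.
move=> hf hg.
rewrite -ler_sqr ?nnegrE ?addr_ge0 ?l2n_ge0//.
rewrite l2n_sqD// sqrrD mulr2n.
have := le_trans (ler_norm _) (cauchy_schwarz hf hg); lra.
Qed.

Lemma l2nB f g : inL2 f -> inL2 g -> l2n (f - g) <= l2n f + l2n g.
Proof. by move=> hf hg; rewrite -(l2nN hg); apply: l2nD => //; exact: inL2_opp. Qed.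

Lemma l2n_sum (I : Type) (s : seq I) (P : pred I) (F : I -> R -> R[i]) :
  (forall i, P i -> inL2 (F i)) ->
  l2n (\sum_(i <- s | P i) F i) <= \sum_(i <- s | P i) l2n (F i).
Proof.
move=> h; elim: s => [|i s ih]; first by rewrite !big_nil l2n0.
rewrite !big_cons; case: ifPn => // Pi.
by rewrite (le_trans (l2nD _ _)) ?lerD2l//; [exact: h|exact: inL2_sum].
Qed.

(** Turning the second argument by i recovers the imaginary part. *)
Lemma dotL2E f g : dotL2 f g = ip f g +i* ip f (scl 'i g).
Proof.
rewrite /dotL2 /cintegral; congr (_ +i* _); apply: eq_Rintegral => t _;
  by rewrite /cip /scl !ReImE/=; ring.
Qed.

Lemma dotDl f g h : inL2 f -> inL2 g -> inL2 h -> dotL2 (f + g) h = dotL2 f h + dotL2 g h.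
Proof.
by move=> hf hg hh; rewrite !dotL2E !ipDl//; exact: inL2_scl.
Qed.

Lemma ip_scl z f g : inL2 f -> inL2 g ->
  ip (scl z f) g = RE z * ip f g - IM z * ip f (scl 'i g).
Proof.
move=> hf hg; have hig := inL2_scl 'i hg.
rewrite /ip -RintegralZl//; try exact: integ_cip.
rewrite -RintegralZl//; try exact: integ_cip.
rewrite -RintegralB//; try (apply: integZ; exact: integ_cip).
apply: eq_Rintegral => t _; by rewrite /cip /scl !ReImE/=; ring.
Qed.

Lemma scl_scl z w f : scl z (scl w f) = scl (z * w) f.
Proof. by apply/funext => t; rewrite /scl mulrA. Qed.

Lemma dotZl z f h : inL2 f -> inL2 h -> dotL2 (scl z f) h = z * dotL2 f h.
Proof.
move=> hf hh; rewrite !dotL2E !ip_scl//; last exact: inL2_scl.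
rewrite scl_scl (_ : 'i * 'i = (-1)%:C :> R[i]) ?ipZr//; last first.
  by rewrite -expr2 sqr_i; apply: complexP; rewrite /= ?oppr0.
by apply: complexP; rewrite !ReImE/=; ring.
Qed.

Lemma dotC f g : inL2 f -> inL2 g -> dotL2 g f = (dotL2 f g)^*.
Proof.
move=> hf hg; have hif := inL2_scl 'i hf.
rewrite !dotL2E; apply: complexP; rewrite !ReImE/=; first exact: ipC.
by rewrite ipC ip_scl//=; ring.
Qed.

Lemma dotZr z f h : inL2 f -> inL2 h -> dotL2 h (scl z f) = z^* * dotL2 h f.
Proof.
move=> hf hh; rewrite (@dotC (scl z f)) ?dotZl//; last exact: inL2_scl.
by rewrite (@dotC f)// rmorphM.
Qed.

Lemma dotNl f h : inL2 f -> inL2 h -> dotL2 (- f) h = - dotL2 f h.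
Proof. by move=> hf hh; rewrite -sclN1 dotZl// mulN1r. Qed.
Lemma dotBl f g h : inL2 f -> inL2 g -> inL2 h -> dotL2 (f - g) h = dotL2 f h - dotL2 g h.
Proof. by move=> hf hg hh; rewrite dotDl ?dotNl//; exact: inL2_opp. Qed.
Lemma dot0l h : inL2 h -> dotL2 0 h = 0.
Proof. by move=> hh; rewrite -[0](subrr h) dotBl// subrr. Qed.

Lemma dot_suml (I : Type) (s : seq I) (P : pred I) (F : I -> R -> R[i]) h :
  (forall i, P i -> inL2 (F i)) -> inL2 h ->
  dotL2 (\sum_(i <- s | P i) F i) h = \sum_(i <- s | P i) dotL2 (F i) h.
Proof.
move=> hF hh; elim: s => [|i s ih]; first by rewrite !big_nil dot0l.
rewrite !big_cons; case: ifPn => // Pi.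
by rewrite dotDl ?ih//; [exact: hF|exact: inL2_sum].
Qed.

Lemma normc_le (x : R[i]) : normc x <= `|RE x| + `|IM x|.
Proof.
rewrite -ler_sqr ?nnegrE ?addr_ge0 ?normc_nonneg// normc_sqr sqrrD !real_normK ?num_real//.
by rewrite lerD2r lerDl mulrn_wge0// mulr_ge0.
Qed.

(** The factor 2 comes from bounding the real and imaginary parts separately;
    only continuity of the inner product is at stake. *)
Lemma dot_bound f g : inL2 f -> inL2 g -> normc (dotL2 f g) <= 2 * (l2n f * l2n g).
Proof.
move=> hf hg; rewrite (le_trans (normc_le _))// dotL2E /= mulr_natl mulr2n.
apply: lerD; first exact: cauchy_schwarz.
rewrite (le_trans (cauchy_schwarz _ _))//; first exact: inL2_scl.
rewrite l2n_scl// (_ : normc 'i = 1) ?mul1r//.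
by rewrite /normc /= expr0n expr1n add0r sqrtr1.
Qed.

Lemma l2n_eq0 f : inL2 f -> l2n f = 0 -> eqL2 f 0.
Proof.
move=> hf f0.
have h0 : (\int[mu]_t `|(sqn f t)%:E| = 0)%E.
  have : l2n f ^+ 2 = 0 by rewrite f0 expr0n.
  rewrite l2nE /l2nsq /Rintegral => h.
  have /fineK := integrable_fin_num measurableT (inL2_integ hf).
  rewrite /= h => e; rewrite [RHS]e; apply: eq_integral => t _.
  by rewrite ger0_norm ?sqn_ge0.
have mf : measurable_fun setT (EFin \o sqn f).
  by apply/measurable_EFinP; apply: integ_mfun; exact: inL2_integ.
move/(ae_eq_integral_abs mu measurableT mf) : h0.
apply: filterS => t /(_ I) [/eqP].
rewrite paddr_eq0 ?sqr_ge0// !sqrf_eq0 => /andP[/eqP hR /eqP hI].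
exact: complexP.
Qed.

Lemma eqL2_l2n f g : eqL2 f g -> inL2 f -> inL2 g -> l2n (f - g) = 0.
Proof.
move=> fg hf hg; have hfg := inL2_sub hf hg.
apply/eqP; rewrite -sqrf_eq0 l2nE /l2nsq /Rintegral.
rewrite (_ : integral _ _ _ = 0%E)//.
rewrite -(integral0 mu setT); apply: ae_eq_integral => //.
  by apply/measurable_EFinP; apply: integ_mfun; exact: inL2_integ.
move: fg; rewrite /eqL2; apply: (@filterS _ _ (ae_filter_ringOfSetsType mu)) => t fg _.
have E : (f - g) t = 0 by rewrite -[LHS]/(f t - g t) fg subrr.
by rewrite /sqn /= E /= expr0n addr0.
Qed.

(** The majorant behind the integrability claims about Gaussians and dual
    atoms. *)
Lemma integ_oneDsqr : integ (fun t => (oneDsqr t)^-1).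
Proof.
apply/integrableP; split.
  by apply/measurable_EFinP; apply: continuous_measurable_fun => t; exact: continuous_oneDsqrV.
under eq_integral => t _ do rewrite gee0_abs ?lee_fin ?invr_ge0//.
rewrite ge0_symfun_integralT.
- by rewrite -set_itvcy integral0y_oneDsqr -EFinM ltry.
- by move=> t; rewrite invr_ge0.
- exact: continuous_oneDsqrV.
- by move=> t; rewrite /= /oneDsqr sqrrN.
Qed.

Lemma inL2_bound f (C : R) : measurable_fun setT (fun t => RE (f t)) ->
  measurable_fun setT (fun t => IM (f t)) ->
  (forall t, normc (f t) * (1 + `|t|) <= C) -> inL2 f.
Proof.
move=> mR mI hC; apply/inL2P; split=> //.
apply: (integ_le _ (integZ (C ^+ 2) integ_oneDsqr)); first exact: measurable_sqn.
move=> t; rewrite ger0_norm ?sqn_ge0// /sqn -normc_sqr.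
rewrite ler_pdivlMr ?(lt_le_trans _ (oneDsqr_ge1 t))//.
have C0 : 0 <= C by rewrite (le_trans _ (hC t))// mulr_ge0 ?normc_nonneg ?addr_ge0.
have : (normc (f t) * (1 + `|t|)) ^+ 2 <= C ^+ 2.
  by rewrite ler_sqr ?nnegrE// mulr_ge0 ?normc_nonneg ?addr_ge0.
apply: le_trans; rewrite exprMn ler_wpM2l ?sqr_ge0// /oneDsqr -[t ^+ 2]real_normK ?num_real//.
have := normr_ge0 t; set a := `|t|; rewrite sqrrD => a0.
by rewrite expr1n; lra.
Qed.

End L2basics.

(** * Convergence of absolutely summable series *)

Section L2complete.
Variable R : realType.
Local Notation mu := (@lebesgue_measure R).
Implicit Types f g h : R -> R[i].

Lemma dominated_cvg (u : nat -> R -> R) (v g : R -> R) :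
  (forall n, measurable_fun setT (u n)) ->
  (forall t, u ^~ t @ \oo --> v t) -> integ g ->
  (forall n t, `|u n t| <= g t) ->
  integ v /\ \int[mu]_t u n t @[n --> \oo] --> \int[mu]_t v t.
Proof.
move=> mu_ uv ig ug.
have mv : measurable_fun setT v.
  by apply: (measurable_fun_cvg (h := u)) => // t _; exact: uv.
have [|||||iv _ h] := @dominated_convergence _ _ _ mu setT measurableT
  (fun n => EFin \o u n) (EFin \o v) (EFin \o g).
- by move=> n; apply/measurable_EFinP; exact: mu_.
- exact/measurable_EFinP.
- by apply: aeW => t _; apply: cvg_EFin; [exact: nearW|exact: uv].
- exact: ig.
- by apply: aeW => t n _; rewrite lee_fin.
split=> //.
by apply: fine_cvg; rewrite fineK//; exact: integrable_fin_num.
Qed.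

(** A substitute for the modulus that dominates partial sums without square
    roots. *)
Definition abs_parts f t : R := `|RE (f t)| + `|IM (f t)|.

Lemma abs_parts_ge0 f t : 0 <= abs_parts f t. Proof. exact: addr_ge0. Qed.

Lemma sqn_le_abs_parts f t : sqn f t <= abs_parts f t ^+ 2.
Proof.
rewrite /sqn /abs_parts sqrrD !real_normK ?num_real// lerD2r lerDl.
by rewrite mulrn_wge0// mulr_ge0.
Qed.

Lemma inL2_abs_parts f : inL2 f -> inL2 (fun t => (abs_parts f t)%:C) /\
  l2n (fun t => (abs_parts f t)%:C) <= 2 * l2n f.
Proof.
move=> hf.
have m1 : measurable_fun setT (abs_parts f).
  by apply: measurable_funD; apply: measurableT_comp => //; [exact: inL2_mRE|exact: inL2_mIM].
have le1 t : abs_parts f t ^+ 2 <= 4 * sqn f t.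
  rewrite /abs_parts /sqn -[RE (f t) ^+ 2]real_normK ?num_real// -[IM (f t) ^+ 2]real_normK ?num_real//.
  set a := `|_|; set b := `|_|.
  have : 0 <= (a - b) ^+ 2 by exact: sqr_ge0.
  have := sqr_ge0 a; have := sqr_ge0 b; rewrite sqrrB sqrrD; lra.
have h1 : inL2 (fun t => (abs_parts f t)%:C).
  apply/inL2P; split => //; first exact: measurable_cst.
  apply: (integ_le _ (integZ 4 (inL2_integ hf))).
    by apply: measurable_sqn => //; exact: measurable_cst.
  by move=> t; rewrite ger0_norm ?sqn_ge0// {1}/sqn /= expr0n addr0.
split=> //.
rewrite -ler_sqr ?nnegrE ?mulr_ge0 ?l2n_ge0// exprMn !l2nE /l2nsq -RintegralZl//; last exact: inL2_integ.
apply: le_Rintegral => //; first exact: inL2_integ.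
  exact/integZ/inL2_integ.
by move=> t _; rewrite /sqn /= expr0n addr0 -natrX.
Qed.

Lemma sumfE (I : Type) (s : seq I) (P : pred I) (F : I -> R -> R[i]) t :
  (\sum_(i <- s | P i) F i) t = \sum_(i <- s | P i) F i t.
Proof. by elim/big_rec2: _ => //= i y1 y2 _ <-. Qed.

Lemma RE_sum (I : Type) (s : seq I) (P : pred I) (F : I -> R[i]) :
  RE (\sum_(i <- s | P i) F i) = \sum_(i <- s | P i) RE (F i).
Proof. by apply: (big_morph _ _ _); [exact: RED|]. Qed.
Lemma IM_sum (I : Type) (s : seq I) (P : pred I) (F : I -> R[i]) :
  IM (\sum_(i <- s | P i) F i) = \sum_(i <- s | P i) IM (F i).
Proof. by apply: (big_morph _ _ _); [exact: IMD|]. Qed.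

Lemma abs_sum_cvg (a : nat -> R) (B : R) (u : nat -> R) :
  (forall N, u N = \sum_(i < N) a i) ->
  (forall N, \sum_(i < N) `|a i| <= B) -> u @ \oo --> limn u.
Proof.
move=> /funext -> hB.
rewrite (_ : (fun N => _) = series a); last first.
  by apply/funext => N; rewrite /series/= big_mkord.
apply: normed_cvg; rewrite (_ : [normed series a] = series (fun i => `|a i|))//.
apply: nondecreasing_is_cvgn.
  by apply/nondecreasing_seqP => n; rewrite seriesSr lerDl.
by exists B => _ [N _ <-]; rewrite seriesEord; exact: hB.
Qed.

Section series.
Variables (s : nat -> R -> R[i]) (M : R).
Hypothesis hs : forall n, inL2 (s n).
Hypothesis hM : forall N, \sum_(i < N) l2n (s i) <= M.

Let S N := \sum_(i < N) s i.
Let A N t : R := \sum_(i < N) abs_parts (s i) t.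

Let mA N : measurable_fun setT (A N).
Proof.
rewrite /A; apply: measurable_sum => i.
by apply: measurable_funD; apply: measurableT_comp => //; [exact: inL2_mRE|exact: inL2_mIM].
Qed.

Let A_ge0 N t : 0 <= A N t.
Proof. by apply: sumr_ge0 => i _; exact: abs_parts_ge0. Qed.

Let A_nd t : nondecreasing_seq (A ^~ t).
Proof. by apply/nondecreasing_seqP => n; rewrite /A big_ord_recr/= lerDl abs_parts_ge0. Qed.

Let intA N : integ (fun t => A N t ^+ 2) /\ \int[mu]_t (A N t ^+ 2) <= (2 * M) ^+ 2.
Proof.
have hA : inL2 (fun t => (A N t)%:C) /\ l2n (fun t => (A N t)%:C) <= 2 * M.
  have e : (fun t => (A N t)%:C) = \sum_(i < N) (fun t => (abs_parts (s i) t)%:C).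
    by apply/funext => t; rewrite sumfE /A rmorph_sum.
  split; first by rewrite e; apply: inL2_sum => i _; have [] := inL2_abs_parts (hs i).
  rewrite e (le_trans (l2n_sum _ _))//.
    by move=> i _; have [] := inL2_abs_parts (hs i).
  have M0 : 0 <= M by rewrite (le_trans _ (hM 0))// big_ord0.
  rewrite (@le_trans _ _ (\sum_(i < N) 2 * l2n (s i)))//.
    by apply: ler_sum => i _; have [] := inL2_abs_parts (hs i).
  by rewrite -mulr_sumr ler_wpM2l.
case: hA => hA1 hA2.
have e t : sqn (fun t => (A N t)%:C) t = A N t ^+ 2 by rewrite /sqn /= expr0n addr0.
split; first by apply: eq_integ (inL2_integ hA1).
rewrite (_ : Rintegral _ _ _ = l2n (fun t => (A N t)%:C) ^+ 2).
  by rewrite ler_sqr ?nnegrE ?l2n_ge0// (le_trans (l2n_ge0 _) hA2).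
by rewrite l2nE; apply: eq_Rintegral => t _; rewrite e.
Qed.

Let E t : \bar R := limn (fun N => (A N t ^+ 2)%:E).

Let E_ub N t : ((A N t ^+ 2)%:E <= E t)%E.
Proof.
have nd : nondecreasing_seq (fun N => (A N t ^+ 2)%:E).
  by move=> n m le_nm; rewrite lee_fin ler_sqr ?nnegrE//; exact: A_nd.
have /cvg_lim := ereal_nondecreasing_cvgn nd; rewrite /E => ->//.
by apply: ereal_sup_ubound; exists N.
Qed.

Let intE : mu.-integrable setT E.
Proof.
apply/integrableP; split.
  apply: (@emeasurable_fun_cvg _ _ _ _ (fun N t => (A N t ^+ 2)%:E)) => //.
    by move=> n; apply/measurable_EFinP; apply: measurable_funX; exact: mA.
  move=> t _; apply: ereal_nondecreasing_is_cvgn.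
  by move=> n m le_nm; rewrite lee_fin ler_sqr ?nnegrE//; exact: A_nd.
under eq_integral => t _.
  rewrite gee0_abs; last by rewrite (le_trans _ (E_ub 0 t))// lee_fin sqr_ge0.
  over.
rewrite /E monotone_convergence//.
- apply: (@le_lt_trans _ _ ((2 * M) ^+ 2)%:E); last exact: ltry.
  apply: lime_le.
    apply: ereal_nondecreasing_is_cvgn => n m le_nm; apply: ge0_le_integral => //.
    + by move=> t _; rewrite lee_fin sqr_ge0.
    + by apply/measurable_EFinP; apply: measurable_funX; exact: mA.
    + by apply/measurable_EFinP; apply: measurable_funX; exact: mA.
    + by move=> t _; rewrite lee_fin ler_sqr ?nnegrE//; exact: A_nd.
  apply: nearW => n; have [h1 h2] := intA n.
  by rewrite -[X in (X <= _)%E]fineK ?lee_fin//; exact: (integrable_fin_num measurableT h1).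
- by move=> n; apply/measurable_EFinP; apply: measurable_funX; exact: mA.
- by move=> n t _; rewrite lee_fin sqr_ge0.
- by move=> t _ n m l2n; rewrite lee_fin ler_sqr ?nnegrE//; exact: A_nd.
Qed.

(** Completeness of L^2 for absolutely convergent series. The squared partial
    sums A N of the moduli increase to a function E, integrable by monotone
    convergence. Where E is finite the series converges pointwise; on the
    remaining null set the sum is replaced by 0. Dominated convergence, with
    majorant E, turns pointwise convergence into convergence in norm. *)
Lemma L2_series : exists F, [/\ inL2 F, l2n F <= M &
  l2n (F - \sum_(i < n) s i) @[n --> \oo] --> 0].
Proof.
pose G := [set t | E t \is a fin_num].
have mG : measurable G.
  rewrite -[G]setTI; apply: emeasurable_fin_num => //.
  exact: measurable_int intE.
have aeG : {ae mu, forall t, G t}.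
  by have := integrable_ae measurableT intE; apply: filterS => t /(_ I).
pose g t := fine (E t).
have ig : integ g.
  apply: (le_integrable measurableT _ _ intE).
    apply: measurableT_comp => //; apply: measurableT_comp => //.
    exact: measurable_int intE.
  by move=> t _ /=; rewrite /g; case: (E t) => [r| |] /=; rewrite ?lexx ?leey.
have bnd t N : G t -> A N t <= 1 + g t.
  move=> Gt; have := E_ub N t; rewrite -(fineK Gt) lee_fin -/(g t) => h.
  have := sqr_ge0 (A N t - 1); rewrite sqrrB; have := A_ge0 N t; lra.
(* the indicator of the good set makes the pointwise limits exist everywhere *)
pose r t : R := \1_G t.
have rG t : G t -> r t = 1 by move=> Gt; rewrite /r indicE mem_set.
have rNG t : ~ G t -> r t = 0 by move=> Gt; rewrite /r indicE memNset.
have mr : measurable_fun setT r by exact: measurable_indic.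
pose F t := limn (fun N => RE (S N t) * r t) +i* limn (fun N => IM (S N t) * r t).
have cR t : RE (S N t) * r t @[N --> \oo] --> RE (F t).
  have [Gt|Gt] := pselect (G t); last first.
    rewrite (_ : (fun N => _) = cst 0); last by apply/funext => N; rewrite rNG// mulr0.
    rewrite /F/= (_ : (fun N => _) = cst 0); last by apply/funext => N; rewrite rNG// mulr0.
    by rewrite lim_cst//; exact: cvg_cst.
  apply: (@abs_sum_cvg (fun i => RE (s i t) * r t) (1 + g t)).
  - by move=> N; rewrite /S sumfE RE_sum mulr_suml.
  move=> N; apply: le_trans (bnd t N Gt); apply: ler_sum => i _.
  by rewrite rG// mulr1 /abs_parts lerDl.
have cI t : IM (S N t) * r t @[N --> \oo] --> IM (F t).
  have [Gt|Gt] := pselect (G t); last first.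
    rewrite (_ : (fun N => _) = cst 0); last by apply/funext => N; rewrite rNG// mulr0.
    rewrite /F/= (_ : (fun N => _) = cst 0); last by apply/funext => N; rewrite rNG// mulr0.
    by rewrite lim_cst//; exact: cvg_cst.
  apply: (@abs_sum_cvg (fun i => IM (s i t) * r t) (1 + g t)).
  - by move=> N; rewrite /S sumfE IM_sum mulr_suml.
  move=> N; apply: le_trans (bnd t N Gt); apply: ler_sum => i _.
  by rewrite rG// mulr1 /abs_parts lerDr.
have hS N : inL2 (S N) by apply: inL2_sum.
have mFR : measurable_fun setT (fun t => RE (F t)).
  apply: (@measurable_fun_cvg _ _ _ _ (fun N t => RE (S N t) * r t)) => [N|t _]; last exact: cR.
  by apply: measurable_funM => //; exact: inL2_mRE.
have mFI : measurable_fun setT (fun t => IM (F t)).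
  apply: (@measurable_fun_cvg _ _ _ _ (fun N t => IM (S N t) * r t)) => [N|t _]; last exact: cI.
  by apply: measurable_funM => //; exact: inL2_mIM.
have cF t n : G t -> sqn (S N - S n) t @[N --> \oo] --> sqn (F - S n) t.
  move=> Gt; rewrite /sqn.
  have -> : RE ((F - S n) t) = RE (F t) - RE (S n t) by rewrite -[(F - S n) t]/(F t - S n t) !ReImE.
  have -> : IM ((F - S n) t) = IM (F t) - IM (S n t) by rewrite -[(F - S n) t]/(F t - S n t) !ReImE.
  rewrite (_ : (fun N => _) = fun N => (RE (S N t) * r t - RE (S n t)) ^+ 2 +
    (IM (S N t) * r t - IM (S n t)) ^+ 2); last first.
    apply/funext => N; rewrite rG// !mulr1 -[(S N - S n) t]/(S N t - S n t).
    by rewrite !ReImE.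
  by apply: cvgD; rewrite [in X in _ --> X]expr2; under eq_fun do rewrite expr2;
    apply: cvgM; apply: cvgB; [exact: cR|exact: cvg_cst|exact: cR|exact: cvg_cst
     |exact: cI|exact: cvg_cst|exact: cI|exact: cvg_cst].
have dom t n : G t -> sqn (F - S n) t <= g t.
  move=> Gt; apply: (cvgr_to_le (cF t n Gt)).
  near=> N; have nN : (n <= N)%N by near: N; exact: nbhs_infty_ge.
  rewrite (le_trans (sqn_le_abs_parts _ _))//.
  have := E_ub N t; rewrite -(fineK Gt) lee_fin -/(g t); apply: le_trans.
  rewrite ler_sqr ?nnegrE ?abs_parts_ge0//.
  have -> : S N - S n = \sum_(n <= i < N) s i.
    by apply/eqP; rewrite subr_eq addrC /S -!(big_mkord xpredT s) (big_cat_nat (leq0n n) nN).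
  rewrite /abs_parts sumfE RE_sum IM_sum.
  rewrite (@le_trans _ _ (\sum_(n <= i < N) abs_parts (s i) t))//.
    by rewrite /abs_parts big_split/= lerD// ler_norm_sum.
  by rewrite /A -(big_mkord xpredT (fun i => abs_parts (s i) t)) (big_cat_nat (leq0n n) nN)/= lerDr sumr_ge0// => i _; exact: abs_parts_ge0.
have S0 : S 0 = 0 by rewrite /S big_ord0.
have g0 t : 0 <= g t.
  by apply: fine_ge0; rewrite (le_trans _ (E_ub 0 t))// lee_fin sqr_ge0.
have hF : inL2 F.
  apply/inL2P; split=> //; apply: (integ_le _ ig); first exact: measurable_sqn.
  move=> t; rewrite ger0_norm ?sqn_ge0//.
  have [Gt|Gt] := pselect (G t); first by have := dom t 0 Gt; rewrite S0 subr0.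
  suff F0 : F t = 0 by rewrite /sqn F0 /= expr0n addr0.
  apply: complexP; rewrite /F /= (_ : (fun N => _) = cst 0) ?lim_cst//;
    by apply/funext => N; rewrite rNG// mulr0.
have [|t|n t|_ h] := dominated_cvg (u := fun n t => sqn (F - S n) t * r t) (v := cst 0) _ _ ig.
- move=> n; apply: measurable_funM => //; apply: integ_mfun; apply: inL2_integ.
  exact: inL2_sub.
- have [Gt|Gt] := pselect (G t); last first.
    rewrite (_ : (fun N => _) = cst 0); first exact: cvg_cst.
    by apply/funext => N; rewrite rNG// mulr0.
  rewrite (_ : (fun n => _) = fun N => (RE (F t) - RE (S N t) * r t) ^+ 2 +
    (IM (F t) - IM (S N t) * r t) ^+ 2); last first.
    apply/funext => N; rewrite rG// !mulr1 /sqn -[(F - S N) t]/(F t - S N t).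
    by rewrite !ReImE.
  rewrite (_ : cst 0 t = (RE (F t) - RE (F t)) * (RE (F t) - RE (F t)) +
    (IM (F t) - IM (F t)) * (IM (F t) - IM (F t))); last by rewrite !subrr mul0r addr0.
  by apply: cvgD; under eq_fun do rewrite expr2;
    apply: cvgM; apply: cvgB; [exact: cvg_cst|exact: cR|exact: cvg_cst|exact: cR
     |exact: cvg_cst|exact: cI|exact: cvg_cst|exact: cI].
- have [Gt|Gt] := pselect (G t); last by rewrite rNG// mulr0 normr0.
  by rewrite rG// mulr1 ger0_norm ?sqn_ge0// dom.
have hn : l2n (F - S n) @[n --> \oo] --> 0.
  rewrite (_ : (fun n => _) = fun n => Num.sqrt (\int[mu]_t (sqn (F - S n) t * r t))).
    rewrite -[X in _ --> X]sqrtr0; apply: continuous_cvg; first exact: sqrt_continuous.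
    by move: h; rewrite /Rintegral/= integral0.
  apply/funext => n; rewrite /l2n /l2nsq /Rintegral; congr (Num.sqrt (fine _)).
  apply: ae_eq_integral => //.
  - by apply/measurable_EFinP; apply: integ_mfun; apply: inL2_integ; exact: inL2_sub.
  - apply/measurable_EFinP; apply: measurable_funM => //; apply: integ_mfun; apply: inL2_integ.
    exact: inL2_sub.
  - by apply: (@filterS _ _ (ae_filter_ringOfSetsType mu)) aeG => t Gt _; rewrite rG// mulr1.
exists F; split => //.
have hnM : l2n (F - S n) + M @[n --> \oo] --> 0 + M by apply: cvgD => //; exact: cvg_cst.
rewrite -[leRHS]add0r; apply: (cvgr_to_ge hnM).
apply: nearW => n.
have := l2nD (inL2_sub hF (hS n)) (hS n); rewrite subrK => /le_trans; apply.
by rewrite lerD2l (le_trans (l2n_sum _ _)).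
Unshelve. all: by end_near.
Qed.

End series.

End L2complete.

(** * Completeness of a family and orthogonality *)

Section projection.
Variables (R : realType) (T : choiceType).
Implicit Types (D : set T) (F : T -> R -> R[i]) (f g h : R -> R[i]).

(** A linear combination is recorded as a list of pairs (index, coefficient),
    so that concatenation is addition. *)
Definition comb F (l : seq (T * R[i])) : R -> R[i] :=
  \sum_(p <- l) scl p.2 (F p.1).

Lemma comb_seq F l : exists z : T -> R[i],
  comb F l = fun t => \sum_(k <- undup (map fst l)) z k * F k t.
Proof.
exists (fun k => \sum_(p <- l | p.1 == k) p.2); apply/funext => t.
rewrite /comb sumfE.
under [RHS]eq_bigr => k _ do rewrite mulr_suml.
rewrite (exchange_big_dep xpredT)//=; apply: eq_big_seq => p pl.
rewrite (eq_bigl (pred1 p.1)) => [|k]; last by rewrite /= eq_sym.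
rewrite -big_filter filter_pred1_uniq ?undup_uniq ?mem_undup ?map_f//.
by rewrite big_seq1.
Qed.

Definition lspan D F : set (R -> R[i]) :=
  [set v | exists2 l, (forall p, p \in l -> D p.1) & v = comb F l].

Lemma lspan0 D F : lspan D F 0.
Proof. by exists [::]; rewrite // /comb big_nil. Qed.

Lemma lspanD D F v w : lspan D F v -> lspan D F w -> lspan D F (v + w).
Proof.
move=> [l1 h1 ->] [l2 h2 ->]; exists (l1 ++ l2); last by rewrite /comb big_cat.
by move=> p; rewrite mem_cat => /orP[/h1|/h2].
Qed.

Lemma scl_sum (I : Type) (s : seq I) z (G : I -> R -> R[i]) :
  scl z (\sum_(i <- s) G i) = \sum_(i <- s) scl z (G i).
Proof. by apply/funext => t; rewrite /scl !sumfE mulr_sumr. Qed.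

Lemma lspanZ D F z v : lspan D F v -> lspan D F (scl z v).
Proof.
move=> [l h ->]; exists [seq (p.1, z * p.2) | p <- l].
  by move=> _ /mapP[p pl ->]; exact: (h p).
by rewrite /comb big_map scl_sum; apply: eq_bigr => p _; rewrite scl_scl.
Qed.

Lemma lspanB D F v w : lspan D F v -> lspan D F w -> lspan D F (v - w).
Proof. by move=> hv hw; rewrite -sclN1; apply: lspanD => //; exact: lspanZ. Qed.

Lemma lspan_mem D F k : D k -> lspan D F (F k).
Proof.
move=> Dk; exists [:: (k, 1)]; first by move=> p; rewrite inE => /eqP ->.
by rewrite /comb big_seq1; apply/funext => t; rewrite /scl mul1r.
Qed.

Lemma lspan_inL2 D F v : (forall k, D k -> inL2 (F k)) -> lspan D F v -> inL2 v.
Proof.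
move=> hF [l h ->]; rewrite /comb big_seq; apply: inL2_sum => p pl.
by apply: inL2_scl; apply: hF; exact: h.
Qed.

Lemma parallelogram f g : inL2 f -> inL2 g ->
  l2n (f - g) ^+ 2 + l2n (f + g) ^+ 2 = 2 * l2n f ^+ 2 + 2 * l2n g ^+ 2.
Proof.
move=> hf hg; have hNg := inL2_opp hg.
rewrite (l2n_sqD hf hNg) (l2n_sqD hf hg) (l2nN hg).
have -> : - g = scl (-1)%:C g by rewrite rmorphN1 sclN1.
by rewrite ipZr//; ring.
Qed.

(** A minimizing sequence whose defect decreases like 4^-n has increments of
    size 2^-n by the parallelogram law, so the telescoping series converges.
    Minimality of the limit makes the error orthogonal to the span. *)
Lemma nearest_point D F f : (forall k, D k -> inL2 (F k)) -> inL2 f ->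
  exists P : R -> R[i], [/\ inL2 P,
    (forall e, 0 < e -> exists2 v, lspan D F v & l2n (P - v) < e) &
    (forall w, lspan D F w -> ip (f - P) w = 0)].
Proof.
move=> hF hf.
have hV := lspan_inL2 hF.
pose E := [set x : R | exists2 v, lspan D F v & x = l2n (f - v) ^+ 2].
have E0 : has_inf E.
  split; first by exists (l2n (f - 0) ^+ 2), 0 => //; exact: lspan0.
  by exists 0 => _ [v _ ->]; exact: sqr_ge0.
pose d := inf E.
have d0 : 0 <= d.
  apply: lb_le_inf; first by case: E0.
  by move=> _ [v _ ->]; exact: sqr_ge0.
have dE v : lspan D F v -> d <= l2n (f - v) ^+ 2.
  by move=> Vv; apply: ge_inf; [case: E0|exists v].
pose q : R := 2^-1.
have q0 : 0 < q by rewrite invr_gt0.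
have /choice[v hv] : forall n, exists v, lspan D F v /\ l2n (f - v) ^+ 2 < d + (q ^+ n) ^+ 2.
  move=> n; have := @inf_adherent _ E ((q ^+ n) ^+ 2).
  rewrite !exprn_gt0// => /(_ isT E0) [_ [v Vv ->] h].
  by exists v; split.
have Vv n : lspan D F (v n) by have [] := hv n.
have L2v n : inL2 (v n) by exact: hV.
have step n : l2n (v n.+1 - v n) <= 2 * q ^+ n.
  have qn : 0 < q ^+ n by rewrite exprn_gt0.
  rewrite -ler_sqr ?nnegrE ?l2n_ge0 ?mulr_ge0 ?(ltW qn)//.
  have := parallelogram (inL2_sub hf (L2v n)) (inL2_sub hf (L2v n.+1)).
  rewrite (_ : f - v n - (f - v n.+1) = v n.+1 - v n); last first.
    by apply/funext => t; rewrite !fctE; ring.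
  rewrite (_ : f - v n + (f - v n.+1) = scl 2%:C (f - scl (q%:C) (v n + v n.+1))); last first.
    apply/funext => t; rewrite /scl !fctE mulrBr mulrA -rmorphM/= divff// mul1r.
    by rewrite rmorph_nat; ring.
  have hw : lspan D F (scl q%:C (v n + v n.+1)) by apply/lspanZ/lspanD.
  rewrite l2n_scl; last by apply: inL2_sub => //; exact: hV.
  rewrite !exprMn normc_sqr/= expr0n addr0.
  have := dE _ hw; have [_ ] := hv n; have [_ ] := hv n.+1.
  rewrite [q ^+ n.+1]exprS exprMn (_ : q ^+ 2 = 4^-1); last by rewrite exprVn -natrX.
  move: (q ^+ n) qn => y _.
  have := sqr_ge0 y; lra.
(* telescoping series with partial sums v n *)
pose s n := if n is m.+1 then v m.+1 - v m else v 0%N.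
have Ss n : \sum_(i < n.+1) s i = v n.
  elim: n => [|n ih]; first by rewrite big_ord1.
  by rewrite big_ord_recr/= ih addrC subrK.
have bound N : \sum_(i < N) l2n (s i) <= l2n (v 0%N) + 4.
  suff : \sum_(i < N) l2n (s i) <= l2n (v 0%N) + 4 * (1 - q ^+ N.-1).
    move/le_trans; apply; rewrite lerD2l -[leRHS]mulr1 ler_wpM2l// gerBl.
    by rewrite exprn_ge0// ltW.
  case: N => [|N]; first by rewrite big_ord0 expr0 subrr mulr0 addr0 l2n_ge0.
  elim: N => [|N ih]; first by rewrite big_ord1 /= subrr mulr0 addr0.
  rewrite big_ord_recr/= (le_trans (lerD ih (step N)))//= exprS -addrA lerD2l /q.
  by rewrite /q; lra.
have hs n : inL2 (s n) by case: n => [|n] //=; exact: inL2_sub.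
have [P [hP _ cP]] := L2_series hs bound.
have cvP : l2n (P - v n) @[n --> \oo] --> 0.
  by move: cP; rewrite -cvg_shiftS/=; under eq_fun do rewrite Ss.
exists P; split=> //.
  move=> e e0; have /cvgrPdist_lt/(_ e e0) [n _ /(_ n (leqnn n))] := cvP.
  by rewrite sub0r normrN ger0_norm ?l2n_ge0// => h; exists (v n).
move=> w Vw; have hw := hV _ Vw.
have hh := inL2_sub hf hP.
have h1 : l2n (f - P) <= Num.sqrt d.
  have c : Num.sqrt d + q ^+ n + l2n (P - v n) @[n --> \oo] --> Num.sqrt d + 0 + 0.
    apply: cvgD => //; apply: cvgD; first exact: cvg_cst.
    by apply: cvg_expr; rewrite ger0_norm ?(ltW q0)// invf_lt1// ltr1n.
  rewrite -[leRHS]addr0 -[leRHS]addr0; apply: (cvgr_to_ge c); apply: nearW => n.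
  have -> : f - P = (f - v n) - (P - v n) by apply/funext => t; rewrite !fctE; ring.
  rewrite (le_trans (l2nB _ _))//; try exact: inL2_sub.
  rewrite lerD2r -ler_sqr ?nnegrE ?l2n_ge0 ?addr_ge0 ?sqrtr_ge0 ?exprn_ge0 ?(ltW q0)//.
  have [_ /ltW/le_trans] := hv n; apply.
  rewrite sqrrD sqr_sqrtr// -addrA lerD2l lerDr mulrn_wge0// mulr_ge0 ?sqrtr_ge0//.
  by rewrite exprn_ge0// ltW.
have h2 r : Num.sqrt d <= l2n (f - P + scl r%:C w).
  have hrw := inL2_scl r%:C hw.
  have c : l2n (f - P + scl r%:C w) + l2n (P - v n) @[n --> \oo] --> l2n (f - P + scl r%:C w) + 0.
    by apply: cvgD => //; exact: cvg_cst.
  rewrite -[leRHS]addr0; apply: (cvgr_to_ge c); apply: nearW => n.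
  rewrite (@le_trans _ _ (l2n (f - (v n - scl r%:C w))))//.
    rewrite -ler_sqr ?nnegrE ?l2n_ge0 ?sqrtr_ge0// sqr_sqrtr// dE//.
    by apply: lspanB => //; exact: lspanZ.
  rewrite (_ : f - (v n - scl r%:C w) = (f - P + scl r%:C w) + (P - v n)); last first.
    by apply/funext => t; rewrite !fctE; ring.
  by apply: l2nD; [exact: inL2_add|exact: inL2_sub].
(* minimality of P along the line through w *)
have h3 r : 0 <= 2 * r * ip (f - P) w + r ^+ 2 * l2n w ^+ 2.
  have := le_trans h1 (h2 r).
  rewrite -ler_sqr ?nnegrE ?l2n_ge0// (l2n_sqD hh (inL2_scl r%:C hw)).
  rewrite ipZr// l2n_scl// exprMn normc_sqr/= expr0n addr0; lra.
have m0 : 0 < l2n w ^+ 2 + 1 by rewrite ltr_wpDl// sqr_ge0.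
apply/eqP/negPn/negP => i0.
have := h3 (- ip (f - P) w / (l2n w ^+ 2 + 1)).
rewrite (_ : _ + _ = - (ip (f - P) w ^+ 2 * ((l2n w ^+ 2 + 2) / (l2n w ^+ 2 + 1) ^+ 2))); last first.
  by field; rewrite gt_eqF.
rewrite oppr_ge0 leNgt mulr_gt0//; first by rewrite exprn_even_gt0.
by rewrite divr_gt0 ?exprn_gt0// ltr_wpDl// sqr_ge0.
Qed.

(** The error of the best approximation of f is orthogonal to the family,
    hence null. *)
Lemma complete_of_orthogonal D F : (forall k, D k -> inL2 (F k)) ->
  (forall h, inL2 h -> (forall k, D k -> dotL2 h (F k) = 0) -> l2n h = 0) ->
  complete_family D F.
Proof.
move=> hF h0 f hf; split=> // e e0.
have [P [hP apx orth]] := nearest_point hF hf.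
have fP : l2n (f - P) = 0.
  apply: h0; first exact: inL2_sub.
  move=> k Dk; have V1 := lspan_mem F Dk.
  by rewrite dotL2E !orth//; exact: lspanZ.
have [v Vv ve] := apx e e0; have hv := lspan_inL2 hF Vv.
case: Vv => l lD vE; have [z zE] := comb_seq F l.
exists (undup (map fst l)), z; split.
  by move=> k; rewrite mem_undup => /mapP[p pl ->]; exact: (lD p).
rewrite (_ : (fun t => _) = f - v); last by apply/funext => t; rewrite vE zE.
rewrite normL2E; last exact: inL2_sub.
rewrite lte_fin; apply: le_lt_trans ve.
rewrite (_ : f - v = (f - P) + (P - v)); last by apply/funext => t; rewrite !fctE; ring.
rewrite (le_trans (l2nD _ _)) ?fP ?add0r//; exact: inL2_sub.
Qed.

(** An element v of the span is orthogonal to h, so it stays at distance at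
    least the norm of h from h. *)
Lemma orthogonal_of_complete D F h : (forall k, D k -> inL2 (F k)) ->
  complete_family D F -> inL2 h -> (forall k, D k -> dotL2 h (F k) = 0) -> l2n h = 0.
Proof.
move=> hF cF hh orth; apply/eqP/negPn/negP => n0.
have n1 : 0 < l2n h by rewrite lt_neqAle eq_sym n0 l2n_ge0.
have [_ /(_ _ n1)[s [z [sD]]]] := cF h hh.
rewrite (_ : (fun t => _) = h - \sum_(k <- s) scl (z k) (F k)); last first.
  by apply/funext => t; rewrite !fctE sumfE.
set v := \sum_(k <- s) _.
have hv : inL2 v.
  by rewrite /v big_seq; apply: inL2_sum => k ks; apply: inL2_scl; apply: hF; exact: sD.
have dv : dotL2 v h = 0.
  rewrite /v big_seq dot_suml//; last first.
    by move=> k ks; apply: inL2_scl; apply: hF; exact: sD.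
  rewrite big1// => k ks; have Fk : inL2 (F k) by apply: hF; exact: sD.
  by rewrite dotZl// dotC// orth ?mulr0 ?rmorph0 ?mulr0//; exact: sD.
have hhv := inL2_sub hh hv.
rewrite normL2E// lte_fin; apply/negP; rewrite -leNgt.
have ivh : ip v h = 0 by move: dv; rewrite dotL2E => -[].
have : ip (h - v) h = l2n h ^+ 2.
  rewrite ipDl//; last exact: inL2_opp.
  have -> : - v = scl (-1)%:C v by rewrite rmorphN1 sclN1.
  by rewrite ipZl// ivh mulr0 addr0 ipff.
have := le_trans (ler_norm _) (cauchy_schwarz hhv hh) => + e.
by rewrite e expr2 ler_pM2r.
Qed.

End projection.

(** * Weighted families with a biorthogonal family *)

Section biorthogonal_series.
Variables (R : realType) (T : countType).
Variables (D : set T) (F G : T -> R -> R[i]).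
Hypothesis hF : forall k, D k -> inL2 (F k).
Hypothesis FG : biorthogonal D F G.

Let hG k : D k -> inL2 (G k). Proof. by case: FG => h _; exact: h. Qed.
Let dFG k l : D k -> D l -> dotL2 (F k) (G l) = (k == l)%:R.
Proof. by case: FG => _; exact. Qed.

(** Pairing with G k is continuous, equals 1 at F k and 0 on the other
    members. *)
Lemma minimal_of_biorthogonal : minimal_family D F.
Proof.
move=> k Dk [_].
have e0 : 0 < (2 * l2n (G k) + 1)^-1 by rewrite invr_gt0 ltr_wpDl// mulr_ge0// l2n_ge0.
move=> /(_ _ e0)[s [z [sD]]].
rewrite (_ : (fun t => _) = F k - \sum_(j <- s) scl (z j) (F j)); last first.
  by apply/funext => t; rewrite !fctE sumfE.
set v := \sum_(j <- s) _.
have hz j : j \in s -> inL2 (scl (z j) (F j)).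
  by move=> js; apply: inL2_scl; apply: hF; have [] := sD j js.
have hv : inL2 v by rewrite /v big_seq; exact: inL2_sum.
have hk := hF Dk; have hkv := inL2_sub hk hv.
rewrite normL2E// lte_fin => h.
have dv : dotL2 v (G k) = 0.
  rewrite /v big_seq dot_suml//; last exact: hG.
  rewrite big1// => j js; have [Dj jk] := sD j js.
  rewrite dotZl//; [|exact: hF|exact: hG].
  by rewrite dFG//; case: eqP => [/jk//|_]; rewrite mulr0.
have := dot_bound hkv (hG Dk).
rewrite dotBl//; last exact: hG.
rewrite dv dFG// eqxx subr0 normc1.
move: h; rewrite -[ltRHS]mul1r ltr_pdivlMr ?ltr_wpDl ?mulr_ge0 ?l2n_ge0//.
have := l2n_ge0 (F k - v); have := l2n_ge0 (G k).
by set x := l2n (F k - v); set y := l2n (G k) => *; lra.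
Qed.

Lemma unique_of_complete : complete_family D F -> unique_biorthogonal D F G.
Proof.
move=> cF; split=> // G' [hG' dG'] k Dk.
have hk := hG Dk; have hk' := hG' _ Dk.
have h : l2n (G' k - G k) = 0.
  apply: (orthogonal_of_complete hF cF); first exact: inL2_sub.
  move=> j Dj; have hj := hF Dj.
  by rewrite dotBl// (dotC hj hk) (dotC hj hk') dFG// dG'// subrr.
have := l2n_eq0 (inL2_sub hk' hk) h; rewrite /eqL2.
apply: (@filterS _ _ (ae_filter_ringOfSetsType lebesgue_measure)) => t /eqP.
by rewrite subr_eq0 => /eqP.
Qed.

Lemma esum_ub (a : T -> R) (A : R) (l : seq T) : uniq l -> (forall k, k \in l -> D k) ->
  (\esum_(k in D) (a k)%:E <= A%:E)%E -> \sum_(k <- l) a k <= A.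
Proof.
move=> ul lD hA; rewrite -lee_fin; apply: le_trans hA; apply: esum_ge.
exists [set` l]; first by split; [exact: finite_seq|exact: lD].
by rewrite -fsbig_seq// sumEFin.
Qed.

Variables (c : T -> R) (B : R).
Hypothesis c0 : forall k, D k -> 0 < c k.
Hypothesis hB : (\esum_(k in D) (l2n (G k) ^+ 2 / c k ^+ 2)%:E <= B%:E)%E.

(** The solution is the series of the (z k / c k) G k. It converges absolutely
    because 2 |z k| |G k| / c k <= lam |z k|^2 + |G k|^2 / (lam c k^2). The
    parameter lam is left free: the lower semi frame bound comes from
    optimizing it. *)
Lemma moment_solution (z : T -> R[i]) (Z lam : R) :
  (\esum_(k in D) (normc (z k) ^+ 2)%:E <= Z%:E)%E -> 0 < lam ->
  exists f, [/\ inL2 f, l2n f <= (lam * Z + B / lam) / 2 &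
    forall k, D k -> dotL2 f (F k) = z k / (c k)%:C].
Proof.
move=> hZ l0.
(* an enumeration of D by the natural numbers, with gaps; h skips the codes
   outside D *)
pose h i := obind (fun k => if `[< D k >] then Some k else None) (@pickle_inv T i).
pose H k := scl (z k / (c k)%:C) (G k).
have hH k : D k -> inL2 (H k) by move=> Dk; apply: inL2_scl; exact: hG.
pose l N := pmap h (iota 0 N).
have hK : ocancel h pickle.
  move=> i; rewrite /h; have := @pickle_invK T i; case: pickle_inv => //= k e.
  by case: asboolP.
have ul N : uniq (l N) by apply: (pmap_uniq hK); exact: iota_uniq.
have lD N k : k \in l N -> D k.
  rewrite mem_pmap => /mapP[i _]; rewrite /h; case: pickle_inv => //= j.
  by case: asboolP => // Dj [->].
have Dl N k : D k -> (pickle k < N)%N -> k \in l N.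
  move=> Dk kN; rewrite mem_pmap; apply/mapP; exists (pickle k).
    by rewrite mem_iota add0n.
  by rewrite /h pickleK_inv/= asboolT.
pose s i := oapp H 0 (h i).
have sl N : \sum_(i < N) s i = \sum_(k <- l N) H k.
  by rewrite big_pmap -(big_mkord xpredT) /index_iota subn0.
have hs i : inL2 (s i).
  rewrite /s /h; case: pickle_inv => [k|] /=; last exact: inL2_0.
  by case: asboolP => /= [Dk|_]; [exact: hH|exact: inL2_0].
have bnd N : \sum_(i < N) l2n (s i) <= (lam * Z + B / lam) / 2.
  rewrite -(big_mkord xpredT (fun i => l2n (s i))) /index_iota subn0.
  rewrite (eq_bigr (fun i => oapp (fun k => l2n (H k)) 0 (h i))); last first.
    by move=> i _; rewrite /s; case: (h i) => //=; exact: l2n0.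
  rewrite -big_pmap -/(l N).
  have b1 := esum_ub (ul N) (lD N) hZ; have b2 := esum_ub (ul N) (lD N) hB.
  rewrite ler_pdivlMr// mulr_suml.
  apply: (@le_trans _ _ (lam * (\sum_(k <- l N) normc (z k) ^+ 2) +
     (\sum_(k <- l N) l2n (G k) ^+ 2 / c k ^+ 2) / lam)); last first.
    by apply: lerD; [rewrite ler_wpM2l// ltW|rewrite ler_wpM2r// invr_ge0 ltW].
  rewrite mulr_sumr mulr_suml -big_split/= big_seq [leRHS]big_seq; apply: ler_sum => k kl.
  have Dk := lD _ _ kl; have ck := c0 Dk.
  rewrite l2n_scl ?normcM; last exact: hG.
  have -> : normc ((c k)%:C)^-1 = (c k)^-1.
    rewrite normcV /normc/= expr0n addr0 sqrtr_sqr ger0_norm ?ltW//.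
  set a := normc _; set b := l2n _.
  rewrite (_ : lam * _ + _ = 2 * (a * (c k)^-1 * b) + (lam * a - b / c k) ^+ 2 / lam).
    by rewrite mulrC lerDl divr_ge0 ?sqr_ge0// ltW.
  by field; rewrite !gt_eqF.
have [f [hf fB cf]] := L2_series hs bnd.
exists f; split => // k Dk; have hk := hF Dk.
apply/eqP; rewrite -subr_eq0; apply/eqP; apply: eq0_normc.
apply/eqP; rewrite eq_le normc_nonneg andbT.
have c2 : 2 * (l2n (f - \sum_(i < n) s i) * l2n (F k)) @[n --> \oo] --> 2 * (0 * l2n (F k)).
  by apply: cvgM; [exact: cvg_cst|apply: cvgM => //; exact: cvg_cst].
rewrite -(mulr0 2) -(mul0r (l2n (F k))); apply: (cvgr_to_ge c2).
exists (pickle k).+1 => // N /= kN.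
have hS : inL2 (\sum_(i < N) s i) by exact: inL2_sum.
apply: le_trans (dot_bound (inL2_sub hf hS) hk).
rewrite dotBl// [X in normc (_ - X) <= _](_ : _ = dotL2 (\sum_(i < N) s i) (F k))//.
rewrite sl big_seq dot_suml//; last by move=> j jl; apply: hH; exact: lD jl.
rewrite -big_seq (bigD1_seq k)//=; last exact: Dl.
rewrite [X in _ + X]big_seq_cond big1 ?addr0 => [|j /andP[jl jk]].
  by rewrite dotZl ?(dotC hk (hG Dk)) ?dFG ?eqxx ?rmorph1 ?mulr1//; exact: hG.
have Dj := lD _ _ jl.
rewrite dotZl//; last exact: hG.
by rewrite (dotC hk (hG Dj)) dFG// eq_sym (negbTE jk) rmorph0 mulr0.
Qed.

Definition weighted k t : R[i] := (c k)%:C * F k t.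

Lemma inL2_weighted k : D k -> inL2 (weighted k).
Proof. by move=> Dk; apply: (inL2_scl _ (hF Dk)). Qed.

Lemma dot_weighted f k : D k -> inL2 f -> dotL2 f (weighted k) = (c k)%:C * dotL2 f (F k).
Proof.
move=> Dk hf; rewrite -[weighted k]/(scl (c k)%:C (F k)) dotZr//; last exact: hF.
by congr (_ * _); apply: complexP; rewrite !ReImE/= ?oppr0.
Qed.

Lemma complete_weighted : complete_family D F -> complete_family D weighted.
Proof.
move=> cF; apply: complete_of_orthogonal; first exact: inL2_weighted.
move=> h hh orth; apply: (orthogonal_of_complete hF cF hh) => k Dk.
have := orth k Dk; rewrite dot_weighted// => /eqP.
rewrite mulf_eq0 => /orP[/eqP[e]|/eqP//].
by have := c0 Dk; rewrite e ltxx.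
Qed.

Lemma riesz_fischer_weighted : riesz_fischer D weighted.
Proof.
move=> z hz.
have z0 : (0 <= \esum_(k in D) (normc (z k) ^+ 2)%:E)%E.
  by apply: esum_ge0 => k _; rewrite lee_fin sqr_ge0.
have [||f [hf _ fz]] := @moment_solution z (fine (\esum_(k in D) (normc (z k) ^+ 2)%:E)) 1.
- by rewrite fineK// ge0_fin_numE.
- exact: ltr01.
exists f => // k Dk; rewrite dot_weighted// fz// mulrC divfK//.
by apply/eqP => -[e]; have := c0 Dk; rewrite e ltxx.
Qed.

(** Solving the moment problem for the coefficients of f gives back f, by
    completeness. With E the sum of the squared coefficients this reads 2 |f|
    <= lam E + B / lam, and lam = (B + 1) / |f| gives |f|^2 <= (B + 1) E. *)
Lemma lower_semi_frame_weighted : complete_family D F -> lower_semi_frame D weighted.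
Proof.
move=> cF.
have B0 : 0 <= B.
  rewrite -lee_fin; apply: le_trans hB; apply: esum_ge0 => k _.
  by rewrite lee_fin divr_ge0 ?sqr_ge0.
have B1 : 0 < B + 1 by rewrite ltr_wpDl.
exists (B + 1)^-1; first by rewrite invr_gt0.
move=> f hf; rewrite normL2E//.
set E := (\esum_(k in D) _)%E.
have E0 : (0 <= E)%E by apply: esum_ge0 => k _; rewrite lee_fin sqr_ge0.
have [->|Ey] := eqVneq E +oo%E; first exact: leey.
have Efin : E \is a fin_num by rewrite ge0_fin_numE// ltey.
rewrite -(fineK Efin) -EFin_expe -EFinM lee_fin.
have [f0|f0] := eqVneq (l2n f) 0; first by rewrite f0 expr0n mulr0 fine_ge0.
have f1 : 0 < l2n f by rewrite lt_neqAle eq_sym f0 l2n_ge0.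
(* the value of lam that makes B / lam at most the norm of f *)
have [||h [hh hb hz]] := @moment_solution (fun k => dotL2 f (weighted k)) (fine E) ((B + 1) / l2n f).
- by rewrite fineK.
- by rewrite divr_gt0.
have fh : l2n (f - h) = 0.
  apply: (orthogonal_of_complete hF cF); first exact: inL2_sub.
  move=> k Dk; have hk := hF Dk; rewrite dotBl// hz// dot_weighted// mulrC mulKf ?subrr//.
  by apply/eqP => -[e]; have := c0 Dk; rewrite e ltxx.
have le : l2n f <= ((B + 1) / l2n f * fine E + B / ((B + 1) / l2n f)) / 2.
  apply: le_trans hb; have := l2nD (inL2_sub hf hh) hh.
  by rewrite subrK fh add0r.
rewrite mulrC ler_pdivrMr// mulrC.
move: le; rewrite ler_pdivlMr// => le.
have e1 : B / ((B + 1) / l2n f) <= l2n f.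
  rewrite (_ : _ / _ = l2n f * (B / (B + 1))); last by field; rewrite f0 gt_eqF.
  by rewrite ler_piMr ?(ltW f1)// ler_pdivrMr// mul1r lerDl.
have : l2n f <= (B + 1) / l2n f * fine E by lra.
by rewrite mulrAC ler_pdivlMr// -expr2 mulrC => h'; rewrite mulrC.
Qed.

End biorthogonal_series.

Lemma exists_weights (R : realType) (T : countType) (D : set T) (a : T -> R) :
  (forall k, 0 <= a k) -> exists c : T -> R, (forall k, 0 < c k) /\
  (\esum_(k in D) (a k ^+ 2 / c k ^+ 2)%:E < +oo)%E.
Proof.
(* geometric decay along the enumeration of T; adding 1 keeps the weights
   positive *)
move=> a0; exists (fun k => (a k + 1) * 2 ^+ (pickle k).+1); split.
  by move=> k; rewrite mulr_gt0 ?exprn_gt0// ltr_wpDl.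
apply: (@le_lt_trans _ _ (\esum_(k in D) (2 ^+ (pickle k).+1)^-1%:E)%E).
  apply: le_esum => k _; rewrite lee_fin.
  have a1 : 0 < a k + 1 by rewrite ltr_wpDl.
  have p1 : 1 <= 2 ^+ (pickle k).+1 :> R by rewrite exprn_ege1// ler1n.
  have p0 := lt_le_trans ltr01 p1.
  rewrite exprMn ler_pdivrMr ?mulr_gt0 ?exprn_gt0//.
  rewrite [X in _ <= _ * (_ * X)]expr2 mulrCA mulKf ?gt_eqF//.
  rewrite -[leLHS]mulr1 ler_pM ?sqr_ge0// ler_sqr ?nnegrE ?(ltW a1)// lerDl//.
rewrite -(esum_image D pickle (fun n => (2 ^+ n.+1)^-1%:E)); last first.
  by move=> x y _ _; exact: (pcan_inj pickleK).
rewrite esum_mkcond.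
apply: (@le_lt_trans _ _ (\esum_(i in [set: nat]) (2 ^+ i.+1)^-1%:E)%E).
  by apply: le_esum => i _; case: ifP => // _; rewrite lee_fin invr_ge0 exprn_ge0.
rewrite -nneseries_esumT; last by move=> n; rewrite lee_fin invr_ge0 exprn_ge0.
have := @cvg_geometric_eseries_half R 1 0.
rewrite (_ : (fun k => _) = fun i => (2 ^+ i.+1)^-1%:E); last first.
  by apply/funext => k; rewrite addn1 div1r natrX.
by move=> /cvg_lim; rewrite /eseries => ->//; rewrite ltry.
Qed.

(** * An alternating series of Gaussian values *)

Definition symsum (V : zmodType) (N : nat) (a : int -> V) : V :=
  a 0 + \sum_(k < N) (a k.+1%:Z + a (- k.+1%:Z)).

Lemma symsumS (V : zmodType) N (a : int -> V) :
  symsum N.+1 a = symsum N a + (a N.+1%:Z + a (- N.+1%:Z)).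
Proof. by rewrite /symsum big_ord_recr/= addrA. Qed.

Section theta.
Variable R : realType.
Local Notation pi := (@pi R).

Definition gauss (x : R) : R := expR (- pi * x ^+ 2).

Lemma gauss_gt0 x : 0 < gauss x. Proof. exact: expR_gt0. Qed.
Lemma gauss_ge0 x : 0 <= gauss x. Proof. exact: expR_ge0. Qed.
Lemma gaussN x : gauss (- x) = gauss x. Proof. by rewrite /gauss sqrrN. Qed.

Lemma gauss_le_exp x : gauss x <= expR (1 - x).
Proof.
rewrite ler_expR; have := pi_ge2 R; move: pi => c p2.
have h0 : 2 * x ^+ 2 <= c * x ^+ 2 by rewrite ler_wpM2r ?sqr_ge0.
have : 0 <= (x + 2^-1) ^+ 2 by exact: sqr_ge0.
have : 0 <= (x - 2^-1) ^+ 2 by exact: sqr_ge0.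
have := sqr_ge0 x; lra.
Qed.

Definition gauss_half (j : nat) : R := gauss (j%:R + 2^-1).

Lemma gauss_half_ge0 j : 0 <= gauss_half j. Proof. exact: gauss_ge0. Qed.
Lemma gauss_half_gt0 j : 0 < gauss_half j. Proof. exact: gauss_gt0. Qed.

Lemma gauss_halfS j : gauss_half j.+1 = gauss_half j * expR (- (2 * pi * j.+1%:R)).
Proof. by rewrite /gauss_half /gauss -expRD -natr1; congr expR; field. Qed.

Lemma gauss_half_weight j : (2 * j%:R + 1) * gauss_half j <= expR (- (2 * j%:R)).
Proof.
have h1 : 2 * j%:R + 1 <= expR (2 * j%:R) :> R by rewrite addrC expR_ge1Dx.
apply: (le_trans (ler_wpM2r (gauss_half_ge0 j) h1)).
rewrite -expRD ler_expR.
have jj : j%:R <= j%:R ^+ 2 :> R.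
  by rewrite -natrX ler_nat -mulnn; case: j {h1} => // j; rewrite leq_pmull.
have p2 := pi_ge2 R; have : 2 * (j%:R + 2^-1) ^+ 2 <= pi * (j%:R + 2^-1) ^+ 2 :> R.
  by rewrite ler_wpM2r ?sqr_ge0.
move=> h; move: h jj; set x := j%:R; lra.
Qed.

Lemma expR_half (j : nat) : expR (- (2 * j%:R)) <= 2^-1 ^+ j :> R.
Proof.
have h : expR (- 2) <= 2^-1 :> R.
  rewrite expRN lef_pV2 ?posrE ?expR_gt0// (le_trans _ (expR_ge1Dx _))//.
  by rewrite lerDr.
by rewrite -mulNr mulrC expRM_natl lerXn2r ?nnegrE ?expR_ge0 ?invr_ge0.
Qed.

Lemma sum_half_le N : \sum_(j < N) 2^-1 ^+ j <= 2 :> R.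
Proof.
suff -> : \sum_(j < N) 2^-1 ^+ j = 2 * (1 - 2^-1 ^+ N) :> R.
  by rewrite -[leRHS]mulr1 ler_wpM2l// gerBl exprn_ge0// invr_ge0.
elim: N => [|N ih]; first by rewrite big_ord0 expr0 subrr mulr0.
by rewrite big_ord_recr/= ih exprS; field.
Qed.

(** Peeling off the first term leaves minus the shifted alternating sum. *)
Lemma alternating_bounds (a : nat -> R) N : (forall j, 0 <= a j) ->
  (forall j, a j.+1 <= a j) -> 0 <= \sum_(j < N) (-1) ^+ j * a j <= a 0%N.
Proof.
elim: N a => [|N ih] a a0 ad; first by rewrite big_ord0 lexx a0.
rewrite big_ord_recl/= expr0 mul1r.
rewrite (eq_bigr (fun j : 'I_N => - ((-1) ^+ j * a j.+1))); last first.
  by move=> j _; rewrite /bump /= add1n exprS mulN1r mulNr.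
have /andP[h1 h2] := ih (fun j => a j.+1) (fun j => a0 _) (fun j => ad _).
rewrite sumrN subr_ge0 gerBl h1 andbT; exact: le_trans h2 (ad _).
Qed.

Lemma alternating_ge (a : nat -> R) N : (forall j, 0 <= a j) ->
  (forall j, a j.+1 <= a j) -> a 0%N - a 1%N <= \sum_(j < N.+1) (-1) ^+ j * a j.
Proof.
move=> a0 ad; rewrite big_ord_recl/= expr0 mul1r lerD2l.
rewrite (eq_bigr (fun j : 'I_N => - ((-1) ^+ j * a j.+1))); last first.
  by move=> j _; rewrite /bump /= add1n exprS mulN1r mulNr.
rewrite sumrN lerN2.
by have /andP[_] := @alternating_bounds (fun j => a j.+1) N (fun j => a0 _) (fun j => ad _).
Qed.

Lemma gauss_half_noninc j : gauss_half j.+1 <= gauss_half j.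
Proof.
by rewrite gauss_halfS ler_piMr ?gauss_half_ge0// expR_le1 oppr_le0 mulr_ge0// mulr_ge0// pi_ge0.
Qed.

Definition alt_sum : R := limn (fun N => \sum_(j < N) (-1) ^+ j * gauss_half j).
(** The tail of the alternating series from k on. It has the sign of (-1)^k
    and is comparable to its first term gauss_half k. *)
Definition alt_tail (k : nat) : R := alt_sum - \sum_(j < k) (-1) ^+ j * gauss_half j.

Lemma alt_sum_cvg : (fun N => \sum_(j < N) (-1) ^+ j * gauss_half j) @ \oo --> alt_sum.
Proof.
apply: (@abs_sum_cvg _ (fun j => (-1) ^+ j * gauss_half j) 2) => // N.
apply: le_trans (sum_half_le N); apply: ler_sum => j _.
rewrite normrM normrX normrN1 expr1n mul1r ger0_norm ?gauss_half_ge0//.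
apply: le_trans (expR_half _); apply: le_trans (gauss_half_weight _).
by rewrite ler_peMl ?gauss_half_ge0// lerDr mulr_ge0.
Qed.

Lemma alt_tailS k : alt_tail k.+1 = alt_tail k - (-1) ^+ k * gauss_half k.
Proof. by rewrite /alt_tail big_ord_recr/= opprD addrA. Qed.

Lemma alt_tail_cvg k : (fun N => \sum_(j < N) (-1) ^+ j * gauss_half (j + k)%N) @ \oo --> (-1) ^+ k * alt_tail k.
Proof.
have h : (fun N => (-1) ^+ k * (\sum_(j < N + k) (-1) ^+ j * gauss_half j - \sum_(j < k) (-1) ^+ j * gauss_half j))
    @ \oo --> (-1) ^+ k * alt_tail k.
  apply: cvgM; first exact: cvg_cst.
  by apply: cvgB; [have := alt_sum_cvg; rewrite -(cvg_shiftn k)|exact: cvg_cst].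
rewrite (_ : (fun N => _) = (fun N => (-1) ^+ k *
  (\sum_(j < N + k) (-1) ^+ j * gauss_half j - \sum_(j < k) (-1) ^+ j * gauss_half j)))//.
pose a j := (-1) ^+ j * gauss_half j.
have E n : \sum_(j < n) (-1) ^+ j * gauss_half j = \sum_(0 <= j < n) a j by rewrite big_mkord.
apply/funext => N; rewrite !E (big_cat_nat (leq0n k) (leq_addl N k))/= [X in X - _]addrC addrK /a.
rewrite -[X in \sum_(X <= _ < _) _]add0n big_addn addnK mulr_sumr big_mkord.
apply: eq_bigr => j _; rewrite mulrA -exprD addnCA exprD.
by rewrite addnn -mul2n exprM sqrrN !expr1n mulr1.
Qed.

Lemma alt_tail_bounds k : gauss_half k - gauss_half k.+1 <= (-1) ^+ k * alt_tail k <= gauss_half k.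
Proof.
have a0 j : 0 <= gauss_half (j + k) by exact: gauss_half_ge0.
have ad j : gauss_half (j.+1 + k) <= gauss_half (j + k) by exact: gauss_half_noninc.
apply/andP; split.
  apply: (cvgr_to_ge (alt_tail_cvg (k := k))); exists 1%N => // -[//|N] _ /=.
  exact: (@alternating_ge (fun j => gauss_half (j + k)) N a0 ad).
apply: (cvgr_to_le (alt_tail_cvg (k := k))); apply: nearW => N.
by have /andP[] := @alternating_bounds (fun j => gauss_half (j + k)) N a0 ad.
Qed.

Lemma norm_alt_tailE k : `|alt_tail k| = (-1) ^+ k * alt_tail k.
Proof.
have /andP[h _] := alt_tail_bounds k.
rewrite -[RHS]ger0_norm; first by rewrite normrM normrX normrN1 expr1n mul1r.
by apply: le_trans h; rewrite subr_ge0 gauss_half_noninc.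
Qed.

Lemma norm_alt_tail_le k : `|alt_tail k| <= gauss_half k.
Proof. by rewrite norm_alt_tailE; have /andP[] := alt_tail_bounds k. Qed.

Lemma norm_alt_tail_ge k : gauss_half k / 2 <= `|alt_tail k|.
Proof.
rewrite norm_alt_tailE; have /andP[+ _] := alt_tail_bounds k; apply: le_trans.
rewrite gauss_halfS -[X in X - _]mulr1 -mulrBr ler_wpM2l ?gauss_half_ge0//.
have : expR (- (2 * pi * k.+1%:R)) <= 2^-1 :> R.
  rewrite expRN lef_pV2 ?posrE ?expR_gt0// (le_trans _ (expR_ge1Dx _))//.
  have : 1 <= k.+1%:R :> R by rewrite ler1n.
  have := pi_ge2 R; set c := pi; set y := k.+1%:R => *; nra.
set y := expR _; lra.
Qed.

Definition odd_gauss (j : nat) : R := (2 * j%:R + 1) * gauss_half j.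
(** Half the derivative at 0 of the first Jacobi theta function with nome
    e^-pi. It is the value of every pairing that does not vanish, so it has to
    be nonzero. *)
Definition theta_cst : R := limn (fun N => \sum_(j < N) (-1) ^+ j * odd_gauss j).

Lemma odd_gauss_ge0 j : 0 <= odd_gauss j.
Proof. by rewrite mulr_ge0 ?gauss_half_ge0// addr_ge0// mulr_ge0. Qed.

Lemma theta_cst_cvg : (fun N => \sum_(j < N) (-1) ^+ j * odd_gauss j) @ \oo --> theta_cst.
Proof.
apply: (@abs_sum_cvg _ (fun j => (-1) ^+ j * odd_gauss j) 2) => // N.
apply: le_trans (sum_half_le N); apply: ler_sum => j _.
rewrite normrM normrX normrN1 expr1n mul1r ger0_norm ?odd_gauss_ge0//.
exact: le_trans (gauss_half_weight _) (expR_half _).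
Qed.

(** The ratio of consecutive terms is (2j + 3)/(2j + 1) times e^(-2 pi (j +
    1)), hence at most 3/6. *)
Lemma odd_gauss_halving j : odd_gauss j.+1 <= odd_gauss j / 2.
Proof.
have e5 : expR (- (2 * pi * j.+1%:R)) <= 6^-1 :> R.
  rewrite expRN lef_pV2 ?posrE ?expR_gt0//.
  rewrite (_ : 2 * pi * j.+1%:R = 3%:R * (2 * pi * j.+1%:R / 3)); last by field.
  rewrite expRM_natl (@le_trans _ _ (2 ^+ 3))//; first by rewrite -natrX ler_nat.
  rewrite lerXn2r ?nnegrE ?expR_ge0// (le_trans _ (expR_ge1Dx _))//.
  have : 1 <= j.+1%:R :> R by rewrite ler1n.
  have := pi_ge2 R; set c := pi; set y := j.+1%:R => *; nra.
rewrite /odd_gauss gauss_halfS; apply: (@le_trans _ _ ((2 * j.+1%:R + 1) * (gauss_half j * 6^-1))).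
  by rewrite ler_wpM2l ?addr_ge0 ?mulr_ge0// ler_wpM2l ?gauss_half_ge0.
rewrite -[j.+1%:R]natr1; have : 0 <= j%:R * gauss_half j by rewrite mulr_ge0 ?gauss_half_ge0.
by set x := j%:R; set y := gauss_half j; lra.
Qed.

Lemma theta_cst_gt0 : 0 < theta_cst.
Proof.
have ad j : odd_gauss j.+1 <= odd_gauss j.
  by apply: le_trans (odd_gauss_halving j) _; have := odd_gauss_ge0 j; lra.
apply: (@lt_le_trans _ _ (odd_gauss 0 / 2)).
  by rewrite divr_gt0// /odd_gauss mulr0 add0r mul1r gauss_half_gt0.
apply: (cvgr_to_ge theta_cst_cvg); exists 1%N => // -[//|N] _ /=.
apply: le_trans (alternating_ge N odd_gauss_ge0 ad).
by have := odd_gauss_halving 0; lra.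
Qed.

(** The Dirichlet kernel at an imaginary frequency. *)
Definition dirichlet_exp (d : R) (j : nat) : R := symsum j (fun k => expR (2 * pi * d * k%:~R)).

Definition dual_sum (d : R) (N : nat) : R :=
  symsum N (fun k => alt_tail `|k| * expR (2 * pi * d * k%:~R)).

Lemma dirichlet_expS d j : dirichlet_exp d j.+1 = dirichlet_exp d j +
  (expR (2 * pi * d * j.+1%:R) + expR (- (2 * pi * d * j.+1%:R))).
Proof. by rewrite /dirichlet_exp symsumS rmorphN/= mulrN. Qed.

(** Summation by parts, as alt_tail decreases by (-1)^j gauss_half j. *)
Lemma dual_sum_parts d N :
  dual_sum d N = \sum_(j < N) (-1) ^+ j * (gauss_half j * dirichlet_exp d j) + alt_tail N * dirichlet_exp d N.
Proof.
elim: N => [|N ih].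
  by rewrite big_ord0 add0r /dual_sum /dirichlet_exp /symsum !big_ord0 !addr0 absz0.
rewrite /dual_sum symsumS -/(dual_sum d N) ih abszN absz_nat rmorphN mulrN big_ord_recr/= dirichlet_expS alt_tailS.
by ring.
Qed.

Lemma dirichlet_exp0 j : dirichlet_exp 0 j = 2 * j%:R + 1.
Proof.
elim: j => [|j ih]; first by rewrite /dirichlet_exp /symsum big_ord0 addr0 !mulr0 expR0 add0r.
by rewrite dirichlet_expS ih !mulr0 !mul0r oppr0 expR0 -[j.+1%:R]natr1; ring.
Qed.

Lemma dual_sum0_cvg : dual_sum 0 @ \oo --> theta_cst.
Proof.
have h : (fun N => \sum_(j < N) (-1) ^+ j * odd_gauss j + alt_tail N * dirichlet_exp 0 N) @ \oo --> theta_cst + 0.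
  apply: cvgD; first exact: theta_cst_cvg.
  apply/norm_cvg0P.
  apply: (@squeeze_cvgr _ _ _ _ (cst 0) (fun N => 2^-1 ^+ N : R)).
  - apply: nearW => N; rewrite normr_ge0/= dirichlet_exp0 normrM mulrC.
    apply: le_trans (expR_half N); apply: le_trans (gauss_half_weight N).
    by rewrite ger0_norm ?addr_ge0 ?mulr_ge0// ler_wpM2l ?addr_ge0 ?mulr_ge0// norm_alt_tail_le.
  - exact: cvg_cst.
  - by apply: cvg_expr; rewrite ger0_norm ?invr_ge0// invf_lt1// ltr1n.
rewrite addr0 in h; rewrite (_ : dual_sum 0 = fun N => \sum_(j < N) (-1) ^+ j * odd_gauss j + alt_tail N * dirichlet_exp 0 N)//.
apply/funext => N; rewrite dual_sum_parts; congr (_ + _); apply: eq_bigr => j _.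
by rewrite dirichlet_exp0 /odd_gauss (mulrC (gauss_half j)).
Qed.

Section positive_frequency.
Variable d : nat.
Hypothesis d0 : (0 < d)%N.
Let rho : R := expR (pi * d%:R) - expR (- (pi * d%:R)).
Let rho0 : 0 < rho.
Proof.
by rewrite subr_gt0 ltr_expR gtrN// mulr_gt0 ?pi_gt0// ltr0n.
Qed.

Let rho_dirichlet j : rho * dirichlet_exp d%:R j =
  expR (2 * pi * d%:R * (j%:R + 2^-1)) - expR (- (2 * pi * d%:R * (j%:R + 2^-1))).
Proof.
elim: j => [|j ih].
  rewrite /dirichlet_exp /symsum big_ord0 addr0 mulr0 expR0 mulr1 /rho.
  by congr (expR _ - expR _); field.
rewrite dirichlet_expS mulrDr ih /rho -[j.+1%:R]natr1.
rewrite (_ : 2 * pi * d%:R * (j%:R + 2^-1) = 2 * pi * d%:R * (j%:R + 1) + - (pi * d%:R)); last by field.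
rewrite (_ : 2 * pi * d%:R * (j%:R + 1 + 2^-1) = 2 * pi * d%:R * (j%:R + 1) + pi * d%:R); last by field.
by rewrite !opprD !opprK !expRD; ring.
Qed.

Let b (i : nat) : R := (-1) ^+ i * gauss (i%:R + 2^-1 - d%:R).

Let gauss_half_dirichlet j : gauss_half j * (rho * dirichlet_exp d%:R j) =
  expR (pi * d%:R ^+ 2) * (gauss (j%:R + 2^-1 - d%:R) - gauss (j%:R + 2^-1 + d%:R)).
Proof.
rewrite rho_dirichlet /gauss_half /gauss !mulrBr -!expRD; congr (expR _ - expR _); ring.
Qed.

Let b_sum0 : \sum_(i < d.*2) b i = 0.
Proof.
have h : \sum_(i < d.*2) b i = - \sum_(i < d.*2) b i.
  rewrite {1}(reindex_inj rev_ord_inj)/= -sumrN; apply: eq_bigr => i _.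
  have id : (i < d.*2)%N by [].
  rewrite /b -signr_odd oddB//= odd_double/= -mulNr; congr (_ * _).
    by rewrite -[in RHS]signr_odd; case: (odd i); rewrite /= ?expr0 ?expr1 ?opprK.
  have e : (d.*2)%:R = d%:R * 2 :> R by rewrite -muln2 natrM.
  by rewrite -gaussN natrB// e -[i.+1%:R]natr1; congr gauss; field.
by move/eqP : h; rewrite -subr_eq0 opprK -mulr2n mulrn_eq0/= => /eqP.
Qed.

Let b_tail N i : `|b (N + i)| <= expR (1 + d%:R) * expR (- N%:R).
Proof.
rewrite normrM normrX normrN1 expr1n mul1r ger0_norm ?gauss_ge0//.
apply: (le_trans (gauss_le_exp _)); rewrite -expRD ler_expR natrD.
have : 0 <= i%:R :> R by []. lra.
Qed.

(** Multiplied by rho, the kernel becomes a difference of two exponentials,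
    and completing the square turns gauss_half j times it into a difference of
    two Gaussian values shifted by -d and +d. The alternating sums of the two
    differ by a block of 2d terms near 0, whose sum is 0 by antisymmetry, and
    by a block of 2d terms near N, which is exponentially small. *)
Lemma dual_sum_pos_cvg : dual_sum d%:R @ \oo --> (0 : R).
Proof.
(* K collects the 2d terms of the block near N and the boundary term of the
   summation by parts *)
pose K : R := expR (pi * d%:R ^+ 2) * (expR (1 + d%:R) * (d.*2%:R + 1)) / rho.
have bnd N : `|dual_sum d%:R N| <= K * expR (- N%:R).
  have e1 : rho * dual_sum d%:R N = expR (pi * d%:R ^+ 2) *
      (\sum_(j < N) (-1) ^+ j * (gauss (j%:R + 2^-1 - d%:R) - gauss (j%:R + 2^-1 + d%:R))) +
      rho * (alt_tail N * dirichlet_exp d%:R N).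
    rewrite dual_sum_parts mulrDr; congr (_ + _); rewrite !mulr_sumr; apply: eq_bigr => j _.
    by rewrite mulrCA (mulrCA rho) gauss_half_dirichlet mulrCA.
  have e2 : \sum_(j < N) (-1) ^+ j * (gauss (j%:R + 2^-1 - d%:R) - gauss (j%:R + 2^-1 + d%:R)) =
      - \sum_(i < d.*2) b (N + i).
    under eq_bigr do rewrite mulrBr.
    rewrite sumrB.
    have E n : \sum_(j < n) b j = \sum_(0 <= j < n) b j by rewrite big_mkord.
    have h1 : \sum_(j < N) b j + \sum_(i < d.*2) b (N + i) =
       \sum_(i < d.*2) b i + \sum_(j < N) b (d.*2 + j).
      transitivity (\sum_(0 <= j < N + d.*2) b j).
        rewrite (big_cat_nat (leq0n N) (leq_addr _ N))/= E; congr (_ + _).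
        by rewrite -[X in \sum_(X <= _ < _) _]add0n big_addn addKn big_mkord; apply: eq_bigr => i _; rewrite addnC.
      rewrite (big_cat_nat (leq0n d.*2) (leq_addl N d.*2))/= E; congr (_ + _).
      by rewrite -[X in \sum_(X <= _ < _) _]add0n big_addn addnK big_mkord; apply: eq_bigr => i _; rewrite addnC.
    move: h1; rewrite b_sum0 add0r => h1.
    have -> : \sum_(j < N) (-1) ^+ j * gauss (j%:R + 2^-1 + d%:R) = \sum_(j < N) b (d.*2 + j).
      apply: eq_bigr => j _; rewrite /b exprD -mul2n exprM sqrrN !expr1n mul1r.
      by congr (_ * gauss _); rewrite natrD natrM; field.
    by rewrite -h1 opprD addrA subrr add0r.
  have e3 : `|rho * (alt_tail N * dirichlet_exp d%:R N)| <= expR (pi * d%:R ^+ 2) * (expR (1 + d%:R) * expR (- N%:R)).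
    have dk_ge0 : 0 <= dirichlet_exp d%:R N.
      by rewrite addr_ge0 ?expR_ge0 ?sumr_ge0// => k _; rewrite addr_ge0 ?expR_ge0.
    rewrite mulrCA normrM [`|rho * _|]ger0_norm; last by rewrite mulr_ge0 ?(ltW rho0).
    apply: (@le_trans _ _ (gauss_half N * (rho * dirichlet_exp d%:R N))).
      by rewrite ler_wpM2r ?norm_alt_tail_le// mulr_ge0 ?(ltW rho0).
    rewrite gauss_half_dirichlet ler_wpM2l ?expR_ge0//.
    apply: (@le_trans _ _ (gauss (N%:R + 2^-1 - d%:R))); first by rewrite gerBl gauss_ge0.
    by apply: (le_trans (gauss_le_exp _)); rewrite -expRD ler_expR; lra.
  rewrite /K mulrAC ler_pdivlMr// mulrC -[X in X * _]ger0_norm ?(ltW rho0)// -normrM.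
  rewrite e1 e2 (le_trans (ler_normD _ _))//.
  rewrite (_ : _ * expR (- N%:R) = expR (pi * d%:R ^+ 2) * (d.*2%:R * (expR (1 + d%:R) * expR (- N%:R))) +
    expR (pi * d%:R ^+ 2) * (expR (1 + d%:R) * expR (- N%:R))); last by ring.
  apply: lerD => //.
  rewrite normrM ger0_norm ?expR_ge0// ler_wpM2l ?expR_ge0// normrN.
  apply: (le_trans (ler_norm_sum _ _ _)).
  rewrite (@le_trans _ _ (\sum_(i < d.*2) expR (1 + d%:R) * expR (- N%:R)))//.
    by apply: ler_sum => i _; exact: b_tail.
  by rewrite sumr_const card_ord mulr_natl.
apply/norm_cvg0P.
apply: (@squeeze_cvgr _ _ _ _ (cst 0) (fun N => K * expR (- N%:R))).
- by apply: nearW => N; rewrite normr_ge0/= bnd.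
- exact: cvg_cst.
- by rewrite -(mulr0 K); apply: cvgM; [exact: cvg_cst|exact: cvgn_expR].
Qed.

End positive_frequency.

Lemma dual_sumN d : dual_sum (- d) = dual_sum d.
Proof.
apply/funext => N; elim: N => [|N ih]; first by rewrite /dual_sum /symsum !big_ord0 !mulr0.
rewrite /dual_sum !symsumS -/(dual_sum (- d) N) -/(dual_sum d N) ih; congr (_ + _).
by rewrite abszN addrC rmorphN/= !mulrN !mulNr opprK.
Qed.

(** This series decides every pairing of a dual atom with a Gaussian atom, d
    being the difference of their positions. *)
Lemma dual_sum_cvg (d : int) : dual_sum d%:~R @ \oo --> theta_cst * (d == 0)%:R.
Proof.
have pos (n : nat) : dual_sum n%:R @ \oo --> theta_cst * (n == 0%N)%:R.
  case: n => [|n]; first by rewrite mulr1; exact: dual_sum0_cvg.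
  by rewrite mulr0; exact: dual_sum_pos_cvg.
case: (intP d) => [|n|n].
- by have := pos 0%N.
- by have := pos n.+1.
- by have := pos n.+1; rewrite -dual_sumN rmorphN.
Qed.

End theta.

(** * The window dual to the Gaussian *)

Section trig.
Variable R : realType.
Local Notation pi := (@pi R).

Lemma trig_nat (n : nat) (x : R) :
  cos (x + 2 * pi * n%:R) = cos x /\ sin (x + 2 * pi * n%:R) = sin x.
Proof.
have -> : 2 * pi * n%:R = (pi *+ 2) *+ n by rewrite -[RHS]mulr_natr -[pi *+ 2]mulr_natr; ring.
split; [exact: (periodicn (@cosD2pi R))|exact: (periodicn (@sinD2pi R))].
Qed.

Lemma cos_int (z : int) (x : R) : cos (x + 2 * pi * z%:~R) = cos x.
Proof.
case: (intP z) => [|n|n].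
- by rewrite mulr0 addr0.
- by have [] := trig_nat n.+1 x.
- by have := (trig_nat n.+1 (x - 2 * pi * n.+1%:R)).1; rewrite subrK rmorphN mulrN => ->.
Qed.

Lemma sin_int (z : int) (x : R) : sin (x + 2 * pi * z%:~R) = sin x.
Proof.
case: (intP z) => [|n|n].
- by rewrite mulr0 addr0.
- by have [] := trig_nat n.+1 x.
- by have := (trig_nat n.+1 (x - 2 * pi * n.+1%:R)).2; rewrite subrK rmorphN mulrN => ->.
Qed.

Lemma sin_le (y : R) : `|sin y| <= `|y|.
Proof.
wlog y0 : y / 0 <= y.
  move=> h; have [/h//|/ltW y0] := leP 0 y.
  by rewrite -(normrN y) -(normrN (sin y)) -sinN; apply: h; rewrite oppr_ge0.
have [c _] := @MVT_segment R sin cos 0 y y0 (fun x _ => is_derive_sin x)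
  (continuous_subspaceT (@continuous_sin R)).
rewrite sin0 !subr0 => ->; rewrite normrM ler_piMl//; exact: cos_max.
Qed.

Lemma one_sub_cos (y : R) : 2 - 2 * cos y <= y ^+ 2.
Proof.
have -> : 2 - 2 * cos y = (2 * sin (y / 2)) ^+ 2.
  rewrite [in LHS](_ : y = (y / 2) *+ 2); last by rewrite -mulr_natr divfK.
  by rewrite cos_mulr2n exprMn sin2cos2 -mulr_natl; ring.
rewrite -real_normK ?num_real// -[y ^+ 2]real_normK ?num_real// ler_sqr ?nnegrE//.
rewrite normrM ger0_norm// mulrC -ler_pdivlMr//.
by apply: le_trans (sin_le _) _; rewrite normrM [`|2^-1|]ger0_norm ?invr_ge0.
Qed.

Lemma expiD (x y : R) : expi (x + y) = expi x * expi y.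
Proof. by apply: complexP; rewrite ReImE /= ?cosD ?sinD; ring. Qed.

Lemma normc_expi (x : R) : normc (expi x) = 1.
Proof. by rewrite /normc /= cos2Dsin2 sqrtr1. Qed.

End trig.

Section dual_window_decay.
Variable R : realType.
Local Notation pi := (@pi R).
Local Notation alt_tail := (@alt_tail R).
Local Notation gauss_half := (@gauss_half R).

(** The integer nearest to t; a half-integer goes to the integer below it. *)
Definition nint (t : R) : int := Num.ceil (t - 2^-1).
Definition sfrac (t : R) : R := t - (nint t)%:~R.

Lemma sfrac_nint t : t = sfrac t + (nint t)%:~R. Proof. by rewrite /sfrac subrK. Qed.

Lemma sfrac_itv t : - 2^-1 < sfrac t <= 2^-1.
Proof.
have := ceil_itv (t - 2^-1); rewrite -/(nint t) rmorphB/= /sfrac => /andP[h1 h2].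
by apply/andP; split; lra.
Qed.

Lemma sfrac_norm t : `|sfrac t| <= 2^-1.
Proof. by have /andP[h1 h2] := sfrac_itv t; rewrite ler_norml (ltW h1) h2. Qed.

Lemma nintE t (n : int) : (nint t == n) = (n%:~R - 2^-1 < t <= n%:~R + 2^-1).
Proof.
rewrite /nint ceil_eq rmorphB/=; congr (_ && _); last by rewrite lerBlDr.
by apply/idP/idP; lra.
Qed.

Lemma nintD t (n : int) : nint (t + n%:~R) = nint t + n.
Proof. by rewrite /nint addrAC ceilDrz ?intr_int// intrKceil. Qed.

Lemma sfracD t (n : int) : sfrac (t + n%:~R) = sfrac t.
Proof. by rewrite /sfrac nintD rmorphD/=; ring. Qed.

Lemma nintB t (n : int) : nint (t - n%:~R) = nint t - n.
Proof. by rewrite -rmorphN nintD. Qed.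
Lemma sfracB t (n : int) : sfrac (t - n%:~R) = sfrac t.
Proof. by rewrite -rmorphN sfracD. Qed.

(** The dual window at the point x + k, for x in the unit cell around 0. *)
Definition cell_dual (x : R) (k : int) : R := expR (pi * (x + k%:~R) ^+ 2) * alt_tail `|k|.

(** Bastiaans' dual window of the Gaussian: e^(pi t^2) times a step function. *)
Definition dual_window (t : R) : R := expR (pi * t ^+ 2) * alt_tail `|nint t|.

Lemma dual_windowE t : dual_window t = cell_dual (sfrac t) (nint t).
Proof. by rewrite /cell_dual -sfrac_nint. Qed.

Lemma cell_dualN x k : cell_dual (- x) (- k) = cell_dual x k.
Proof. by rewrite /cell_dual abszN rmorphN/= -opprD sqrrN. Qed.

Lemma normr_absz (k : int) : `|k%:~R : R| = `|k|%N%:R.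
Proof. by rewrite -intr_norm -abszE. Qed.

(** The tail is at most gauss_half |k|, and (|x| + |k|)^2 - (|k| + 1/2)^2 <= -
    2 (1/2 - |x|) |k|: the decay disappears only at the boundary of the cell. *)
Lemma cell_dual_decay x k : `|x| <= 2^-1 ->
  `|cell_dual x k| <= expR (- (2 * pi * (2^-1 - `|x|) * `|k|%N%:R)).
Proof.
move=> x2; rewrite /cell_dual normrM ger0_norm ?expR_ge0//.
apply: (@le_trans _ _ (expR (pi * (x + k%:~R) ^+ 2) * gauss_half `|k|)).
  by rewrite ler_wpM2l ?expR_ge0// norm_alt_tail_le.
rewrite /gauss_half /gauss -expRD ler_expR.
have h1 : (x + k%:~R) ^+ 2 <= (`|x| + `|k|%N%:R) ^+ 2.
  rewrite -real_normK ?num_real// ler_sqr ?nnegrE ?addr_ge0//.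
  by rewrite -normr_absz; exact: ler_normD.
have p0 := pi_ge0 R.
have h2 : (`|x| + `|k|%N%:R) ^+ 2 - (`|k|%N%:R + 2^-1) ^+ 2 <= - (2 * (2^-1 - `|x|) * `|k|%N%:R).
  have := normr_ge0 x; move: x2; set y := `|x|; set n := _%:R => y2 y0; nra.
have : pi * ((x + k%:~R) ^+ 2 - (`|k|%N%:R + 2^-1) ^+ 2) <= pi * (- (2 * (2^-1 - `|x|) * `|k|%N%:R)).
  by rewrite ler_wpM2l//; lra.
by rewrite mulrBr; lra.
Qed.

Lemma cell_dual_le1 x k : `|x| <= 2^-1 -> `|cell_dual x k| <= 1.
Proof.
move=> x2; apply: le_trans (cell_dual_decay k x2) _; rewrite expR_le1 oppr_le0.
by rewrite !mulr_ge0 ?pi_ge0// subr_ge0.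
Qed.

Lemma dual_window_le1 t : `|dual_window t| <= 1.
Proof. by rewrite dual_windowE cell_dual_le1// sfrac_norm. Qed.

(** Uniform in y near 0, where the exponential itself gives no decay; the
    factor y makes up for it. *)
Lemma exp_peak (y n : R) : 0 <= y -> 0 <= n ->
  y * expR (- (y * n)) * (1 + n) <= y + 1.
Proof.
move=> y0 n0; rewrite mulrDr mulr1; apply: lerD.
  by rewrite ler_piMr// expR_le1 oppr_le0 mulr_ge0.
rewrite mulrAC expRN ler_pdivrMr ?expR_gt0// mul1r.
by apply: le_trans (expR_ge1Dx _); rewrite lerDr.
Qed.

Lemma shift_bound (t m : R) : 1 + `|t| <= (1 + `|t - m|) * (1 + `|m|).
Proof.
have := ler_normD (t - m) m; rewrite subrK.
have := normr_ge0 (t - m); have := normr_ge0 m.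
by set a := `|t - m|; set b := `|m|; set c := `|t| => b0 a0 h; nra.
Qed.

Lemma nint_bound t : 1 + `|t| <= 2 * (1 + `|nint t|%N%:R).
Proof.
rewrite -normr_absz; have := sfrac_norm t.
have := ler_normD (sfrac t) (nint t)%:~R; rewrite -sfrac_nint.
have := normr_ge0 ((nint t)%:~R : R).
by set a := `|(nint t)%:~R|; set b := `|sfrac t|; set c := `|t| => *; lra.
Qed.

(** The factor 1 + e^(2 pi i t) vanishes exactly at the half-integers, where
    the dual window does not decay; it is at most y, 2 pi times the distance
    to the nearest half-integer. *)
Lemma modulation_step t m :
  normc ((1 + expi (2 * pi * t)) * (dual_window (t - m%:~R))%:C) * (1 + `|t|) <=
  2 * (pi + 1) * (1 + `|m%:~R|).
Proof.
have x2 := sfrac_norm t; have k2 := nint_bound (t - m%:~R); have sb := shift_bound t m%:~R.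
set y := 2 * pi * (2^-1 - `|sfrac t|).
have y0 : 0 <= y by rewrite !mulr_ge0 ?pi_ge0// subr_ge0.
have yp : y <= pi.
  by rewrite /y; have := normr_ge0 (sfrac t); have := pi_ge0 R; set c := pi; set z := `|_| => *; nra.
have h1 : normc (1 + expi (2 * pi * t)) <= y.
  rewrite -ler_sqr ?nnegrE ?normc_nonneg// normc_sqr !ReImE /= add0r.
  (* reduction to sfrac t, where cos (2 pi sfrac t) = - cos y *)
  rewrite {1 2}(sfrac_nint t) mulrDr cos_int sin_int.
  have -> : cos (2 * pi * sfrac t) = - cos y.
    rewrite -cos_norm normrM [`|2 * pi|]ger0_norm; last by rewrite mulr_ge0// pi_ge0.
    rewrite (_ : 2 * pi * `|sfrac t| = - y + pi); last by rewrite /y; field.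
    by rewrite cosDpi cosN.
  have -> : sin (2 * pi * sfrac t) ^+ 2 = 1 - cos y ^+ 2.
    rewrite sin2cos2; congr (1 - _).
    rewrite -[in LHS]cos_norm normrM [`|2 * pi|]ger0_norm; last by rewrite mulr_ge0// pi_ge0.
    rewrite (_ : 2 * pi * `|sfrac t| = - y + pi); last by rewrite /y; field.
    by rewrite cosDpi cosN sqrrN.
  by have := one_sub_cos y; lra.
have h2 : `|dual_window (t - m%:~R)| <= expR (- (y * `|nint (t - m%:~R)|%N%:R)).
  by rewrite dual_windowE (le_trans (cell_dual_decay _ _)) ?sfrac_norm// sfracB.
rewrite normcM; have -> : normc (dual_window (t - m%:~R))%:C = `|dual_window (t - m%:~R)|.
  by rewrite /normc /= expr0n addr0 sqrtr_sqr.
set n := `|nint _|%N%:R in h2 k2.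
have h3 := exp_peak y0 (ler0n _ _ : 0 <= n).
have h4 : normc (1 + expi (2 * pi * t)) * `|dual_window (t - m%:~R)| <= y * expR (- (y * n)).
  by apply: ler_pM; rewrite ?normc_nonneg.
apply: (@le_trans _ _ (y * expR (- (y * n)) * (2 * (1 + n) * (1 + `|m%:~R|)))).
  apply: ler_pM; rewrite ?mulr_ge0 ?normc_nonneg ?addr_ge0//.
  by apply: (le_trans sb); rewrite ler_wpM2r// addr_ge0.
rewrite mulrA ler_wpM2r ?addr_ge0// mulrCA -mulrA ler_wpM2l//; first by rewrite mulrA; lra.
Qed.

End dual_window_decay.

Section dual_atoms.
Variable R : realType.
Local Notation pi := (@pi R).
Local Notation alt_tail := (@alt_tail R).
Local Notation gauss_half := (@gauss_half R).
Local Notation dual_window := (@dual_window R).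

Lemma int_chain (P : int -> Prop) (a : int) : P a ->
  (forall z, P z -> P (z + 1)) -> (forall z, P z -> P (z - 1)) -> forall z, P z.
Proof.
move=> Pa Pp Pm z; rewrite -(subrK a z).
elim/int_rect: (z - a) => [|n ih|n ih]; first by rewrite add0r.
- by rewrite -addn1 PoszD addrAC; exact: Pp.
- by rewrite -addn1 PoszD opprD addrAC; exact: Pm.
Qed.

(** Next to the common boundary x = 1/2 the leading terms of two neighbouring
    cells are nearly opposite: their sum is B (1 - e^-y) up to sign, where B
    <= e^(- y n). *)
Lemma cell_dual_succ (x : R) (n : nat) : `|x| <= 2^-1 ->
  `|cell_dual x n.+1 + cell_dual x n| * (1 + n%:R) <= 2 * pi + 3.
Proof.
move=> x2; have p2 := pi_ge2 R; have p0 := pi_ge0 R.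
have [xl xr] : x <= 2^-1 /\ - 2^-1 <= x by move: x2; rewrite ler_norml => /andP[].
pose e (k : nat) := expR (pi * (x + k%:R) ^+ 2).
pose s := 2^-1 - x; pose y := 2 * pi * s.
have s0 : 0 <= s by rewrite subr_ge0.
have s1 : s <= 1 by rewrite /s; lra.
have y0 : 0 <= y by rewrite !mulr_ge0.
have yp : y <= 2 * pi by rewrite ler_piMr// mulr_ge0.
pose B := e n * gauss_half n.
have B0 : 0 <= B by rewrite mulr_ge0 ?expR_ge0 ?gauss_half_ge0.
have A1 : e n.+1 * gauss_half n.+1 = B * expR (- y).
  by rewrite /B /e /gauss_half /gauss -!expRD; congr expR; rewrite -[n.+1%:R]natr1 /y /s; field.
have B1 : B <= expR (- (y * n%:R)).
  rewrite /B /e /gauss_half /gauss -!expRD ler_expR.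
  have -> : pi * (x + n%:R) ^+ 2 + - pi * (n%:R + 2^-1) ^+ 2 = - (y * n%:R) - pi * (s * (1 - s)).
    by rewrite /y /s; field.
  by rewrite gerBl !mulr_ge0// subr_ge0.
have BA : `|B - B * expR (- y)| <= y * expR (- (y * n%:R)).
  have e1 : expR (- y) <= 1 by rewrite expR_le1 oppr_le0.
  rewrite -[X in X - _]mulr1 -mulrBr normrM ger0_norm// [`|_ - _|]ger0_norm ?subr_ge0// mulrC.
  rewrite ler_pM ?subr_ge0// lerBlDr.
  by have := expR_ge1Dx (- y); lra.
have small (j : nat) : (n < j)%N -> expR (- (2 * pi * j%:R)) * (1 + n%:R) <= 1.
  move=> nj; rewrite expRN mulrC ler_pdivrMr ?expR_gt0// mul1r.
  apply: le_trans (expR_ge1Dx _); rewrite lerD2l.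
  apply: (@le_trans _ _ j%:R); first by rewrite ler_nat ltnW.
  by rewrite ler_peMl//; lra.
have Bn1 : B <= 1 by apply: (le_trans B1); rewrite expR_le1 oppr_le0 mulr_ge0.
have T2 : `|e n.+1 * alt_tail n.+2| * (1 + n%:R) <= 1.
  apply: le_trans (small n.+2 _) => //; rewrite ler_wpM2r ?addr_ge0//.
  rewrite normrM ger0_norm ?expR_ge0//.
  apply: (le_trans (ler_wpM2l (expR_ge0 _) (norm_alt_tail_le _ _))).
  rewrite gauss_halfS mulrA ler_piMl ?expR_ge0// A1 mulr_ile1// ?expR_ge0//.
  by rewrite expR_le1 oppr_le0.
have T3 : `|e n * alt_tail n.+1| * (1 + n%:R) <= 1.
  apply: le_trans (small n.+1 _) => //; rewrite ler_wpM2r ?addr_ge0//.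
  rewrite normrM ger0_norm ?expR_ge0//.
  apply: (le_trans (ler_wpM2l (expR_ge0 _) (norm_alt_tail_le _ _))).
  by rewrite gauss_halfS mulrA ler_piMl ?expR_ge0.
have T1 : `|B - B * expR (- y)| * (1 + n%:R) <= 2 * pi + 1.
  apply: (le_trans (ler_wpM2r _ BA)); first by rewrite addr_ge0.
  by apply: (le_trans (exp_peak y0 _)) => //; rewrite lerD2r.
have -> : cell_dual x n.+1 + cell_dual x n = (-1) ^+ n * (B - B * expR (- y)) + e n.+1 * alt_tail n.+2 + e n * alt_tail n.+1.
  rewrite -A1 /cell_dual !absz_nat -!pmulrn -/(e n.+1) -/(e n) /B.
  rewrite (_ : alt_tail n = alt_tail n.+1 + (-1) ^+ n * gauss_half n); last by rewrite alt_tailS subrK.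
  rewrite {1}(_ : alt_tail n.+1 = alt_tail n.+2 + (-1) ^+ n.+1 * gauss_half n.+1); last by rewrite [alt_tail n.+2]alt_tailS subrK.
  by rewrite exprS; ring.
rewrite (le_trans (ler_wpM2r _ (ler_normD _ _))) ?addr_ge0//.
rewrite mulrDl (_ : 2 * pi + 3 = 2 * pi + 1 + 1 + 1); last by ring.
apply: lerD => //.
rewrite (le_trans (ler_wpM2r _ (ler_normD _ _))) ?addr_ge0// mulrDl.
by apply: lerD => //; rewrite normrM normrX normrN1 expr1n mul1r.
Qed.

Lemma cell_dual_pred (x : R) (k : int) : `|x| <= 2^-1 ->
  `|cell_dual x k + cell_dual x (k - 1)| * (1 + `|k|%N%:R) <= 2 * (2 * pi + 3).
Proof.
move=> x2; have p0 := pi_ge0 R.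
case: k => n.
  case: n => [|n].
    have := @cell_dual_succ (- x) 0; rewrite normrN => /(_ x2).
    rewrite -(cell_dualN x) -(cell_dualN x (0 - 1)) !sub0r opprK oppr0 [X in `|X|]addrC.
    have := normr_ge0 (cell_dual (- x) 1 + cell_dual (- x) 0); rewrite absz0; lra.
  have := cell_dual_succ n x2; rewrite absz_nat (_ : n.+1%:Z - 1 = n) //; last by rewrite -addn1 PoszD addrK.
  set z := `|_|; have z0 : 0 <= z by exact: normr_ge0.
  have : 0 <= n%:R * z by rewrite mulr_ge0.
  rewrite -[n.+1%:R]natr1; lra.
have := @cell_dual_succ (- x) n.+1; rewrite normrN => /(_ x2).
rewrite -(cell_dualN x) -(cell_dualN x (_ - 1)) NegzE opprB !opprK abszN absz_nat (_ : 1 + n.+1%:Z = n.+2) //.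
rewrite addrC; set z := `|_|; have z0 : 0 <= z by exact: normr_ge0.
lra.
Qed.

Lemma translation_step t (m : int) :
  `|dual_window (t - m%:~R) + dual_window (t - (m + 1)%:~R)| * (1 + `|t|) <=
  4 * (2 * pi + 3) * (1 + `|m%:~R|).
Proof.
have k2 := nint_bound (t - m%:~R); have sb := shift_bound t m%:~R.
have p0 := pi_ge0 R.
have h := cell_dual_pred (nint (t - m%:~R)) (sfrac_norm (t - m%:~R)).
rewrite -dual_windowE (_ : sfrac (t - m%:~R) = sfrac (t - (m + 1)%:~R)) in h; last by rewrite !sfracB.
rewrite (_ : nint (t - m%:~R) - 1 = nint (t - (m + 1)%:~R)) in h; last by rewrite !nintB; ring.
rewrite -dual_windowE in h.
set z := `|_ + _| in h *; have z0 : 0 <= z by exact: normr_ge0.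
apply: (le_trans (ler_wpM2l z0 sb)); rewrite mulrA ler_wpM2r ?addr_ge0//.
apply: (le_trans (ler_wpM2l z0 k2)); rewrite mulrCA; lra.
Qed.

(** Signs that make neighbouring atoms cancel at the half-integers. *)
Definition psign (z : int) : R := (-1) ^+ `|z|%N.

Lemma psignS z : psign (z + 1) = - psign z.
Proof.
rewrite /psign; case: z => [n|n]; first by rewrite -PoszD addn1 exprS mulN1r.
rewrite NegzE abszN absz_nat exprS mulN1r opprK -addn1 PoszD opprD addrK.
by rewrite abszN.
Qed.

Lemma psign_norm z : `|psign z| = 1. Proof. by rewrite normrX normrN1 expr1n. Qed.
Lemma psign_sq z : psign z * psign z = 1. Proof. by rewrite -expr2 sqrr_sign. Qed.

Definition phase (n : int) (t : R) : R[i] := expi (2 * pi * n%:~R * t).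

Definition dual_atom (k : int * int) (t : R) : R[i] :=
  (psign (k.1 + k.2) * dual_window (t - k.1%:~R))%:C * phase k.2 t.

Lemma dual_atomE m n t : dual_atom (m, n) t = (psign (m + n) * dual_window (t - m%:~R))%:C * phase n t.
Proof. by []. Qed.

Lemma normc_real (x : R) : normc x%:C = `|x|.
Proof. by rewrite /normc /= expr0n addr0 sqrtr_sqr. Qed.

Lemma phaseS n t : phase (n + 1) t = phase n t * expi (2 * pi * t).
Proof. by rewrite /phase -expiD rmorphD/=; congr expi; ring. Qed.

Lemma dual_atom_translate m n t : normc (dual_atom (m + 1, n) t - dual_atom (m, n) t) * (1 + `|t|) <=
  4 * (2 * pi + 3) * (1 + `|m%:~R|).
Proof.
rewrite !dual_atomE -mulrBl normcM normc_expi mulr1 -rmorphB normc_real.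
rewrite addrAC psignS mulNr -opprD normrN -mulrDr normrM psign_norm mul1r addrC.
exact: translation_step.
Qed.

Lemma dual_atom_modulate m n t : normc (dual_atom (m, n + 1) t - dual_atom (m, n) t) * (1 + `|t|) <=
  2 * (pi + 1) * (1 + `|m%:~R|).
Proof.
rewrite !dual_atomE addrA psignS phaseS.
have -> : (- psign (m + n) * dual_window (t - m%:~R))%:C * (phase n t * expi (2 * pi * t)) -
   (psign (m + n) * dual_window (t - m%:~R))%:C * phase n t =
   - ((psign (m + n))%:C * phase n t * ((1 + expi (2 * pi * t)) * (dual_window (t - m%:~R))%:C)).
  by rewrite !rmorphM rmorphN/=; ring.
rewrite normcN normcM normcM normc_real psign_norm normc_expi !mul1r.
exact: modulation_step.
Qed.

(** A chain of unit translations and modulations leads from l to k, and each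
    step costs O(1/(1 + |t|)). *)
Lemma dual_atom_diff (k l : int * int) : exists C, forall t,
  normc (dual_atom k t - dual_atom l t) * (1 + `|t|) <= C.
Proof.
pose P m n := exists C, forall t, normc (dual_atom (m, n) t - dual_atom l t) * (1 + `|t|) <= C.
have tri m n m' n' : P m n -> (exists C, forall t,
    normc (dual_atom (m', n') t - dual_atom (m, n) t) * (1 + `|t|) <= C) -> P m' n'.
  move=> [C1 h1] [C2 h2]; exists (C2 + C1) => t.
  apply: le_trans (lerD (h2 t) (h1 t)); rewrite -mulrDl ler_wpM2r ?addr_ge0//.
  by apply: le_trans (le_normcD _ _); rewrite addrA subrK.
have up m n : P m n -> P (m + 1) n.
  move=> h; apply: (tri _ _ _ _ h); eexists => t; exact: dual_atom_translate.
have un m n : P m n -> P m (n + 1).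
  move=> h; apply: (tri _ _ _ _ h); eexists => t; exact: dual_atom_modulate.
have flip m n m' n' : (exists C, forall t, normc (dual_atom (m', n') t - dual_atom (m, n) t) * (1 + `|t|) <= C) ->
    exists C, forall t, normc (dual_atom (m, n) t - dual_atom (m', n') t) * (1 + `|t|) <= C.
  by move=> [C h]; exists C => t; rewrite -normcN opprB.
have dn m n : P m n -> P (m - 1) n.
  move=> h; apply: (tri _ _ _ _ h); apply: flip; rewrite -{1}(subrK 1 m).
  eexists => t; exact: dual_atom_translate.
have dm m n : P m n -> P m (n - 1).
  move=> h; apply: (tri _ _ _ _ h); apply: flip; rewrite -{1}(subrK 1 n).
  eexists => t; exact: dual_atom_modulate.
have P0 : P l.1 l.2.
  by exists 0 => t; rewrite -surjective_pairing subrr normc0 mul0r.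
case: k => m n; apply: (int_chain (a := l.2) (P := fun z => P m z)).
- by apply: (int_chain (a := l.1) (P := fun z => P z l.2)) => // z; [exact: up|exact: dn].
- by move=> z; exact: un.
- by move=> z; exact: dm.
Qed.

Lemma measurable_nint (phi : int -> R) : measurable_fun setT (fun t : R => phi (nint t)).
Proof.
move=> _ A mA; rewrite setTI.
rewrite (_ : _ @^-1` A = \bigcup_n
  (if phi n \in A then `](n%:~R - 2^-1), (n%:~R + 2^-1)]%classic else set0)).
  apply: countable_bigcupT_measurable; first exact: countableP.
  by move=> n; case: ifP => _; [exact: measurable_itv|exact: measurable0].
apply/seteqP; split => [t /= At|t /= [n _]].
  by exists (nint t) => //=; rewrite mem_set//= in_itv/= -nintE.
by case: ifP => // /set_mem An; rewrite /= in_itv/= -nintE => /eqP ->.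
Qed.

Lemma measurable_dual_window m : measurable_fun setT (fun t : R => dual_window (t - m)).
Proof.
rewrite (_ : (fun t => _) = (dual_window \o (fun t => t - m)))//.
apply: measurableT_comp; last by apply: measurable_funB.
apply: measurable_funM; last exact: (measurable_nint (fun k => alt_tail `|k|)).
apply: measurableT_comp; first exact: measurable_expR.
by apply: measurable_funM; [exact: measurable_cst|exact: exprn_measurable].
Qed.

Lemma measurable_cosZ (r : R) : measurable_fun setT (fun t : R => cos (r * t)).
Proof.
apply: measurableT_comp => //; apply: continuous_measurable_fun.
exact: continuous_cos.
Qed.

Lemma measurable_sinZ (r : R) : measurable_fun setT (fun t : R => sin (r * t)).
Proof.
apply: measurableT_comp => //; apply: continuous_measurable_fun.
exact: continuous_sin.
Qed.

Lemma measurable_gauss m : measurable_fun setT (fun t : R => gauss (t - m)).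
Proof.
rewrite (_ : (fun t => _) = (@gauss R \o (fun t => t - m)))//.
apply: measurableT_comp; last by apply: measurable_funB.
apply: measurableT_comp; first exact: measurable_expR.
by apply: measurable_funM; [exact: measurable_cst|exact: exprn_measurable].
Qed.

Lemma measurable_dual_atom k : measurable_fun setT (fun t => RE (dual_atom k t)) /\
  measurable_fun setT (fun t => IM (dual_atom k t)).
Proof.
split.
  rewrite (_ : (fun t => _) = fun t => psign (k.1 + k.2) * dual_window (t - k.1%:~R) * cos (2 * pi * k.2%:~R * t)).
    apply: measurable_funM; last exact: measurable_cosZ.
    by apply: measurable_funM; [exact: measurable_cst|exact: measurable_dual_window].
  by apply/funext => t; rewrite /dual_atom ReImE /= mul0r subr0.
rewrite (_ : (fun t => _) = fun t => psign (k.1 + k.2) * dual_window (t - k.1%:~R) * sin (2 * pi * k.2%:~R * t)).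
  apply: measurable_funM; last exact: measurable_sinZ.
  by apply: measurable_funM; [exact: measurable_cst|exact: measurable_dual_window].
by apply/funext => t; rewrite /dual_atom ReImE /= mul0r addr0.
Qed.

Lemma gauss_bound (t : R) (m : int) : gauss (t - m%:~R) * (1 + `|t|) <= 2 * (1 + `|m%:~R|).
Proof.
apply: (le_trans (ler_wpM2l (gauss_ge0 _) (shift_bound t m%:~R))).
rewrite mulrA ler_wpM2r ?addr_ge0//.
set u := t - m%:~R.
have -> : gauss u = gauss `|u| by rewrite /gauss real_normK ?num_real.
have u0 : 0 <= `|u| by [].
move: (`|u|) u0 => z z0.
rewrite /gauss mulNr expRN mulrC ler_pdivrMr ?expR_gt0//.
have p2 := pi_ge2 R.
have : 1 + pi * z ^+ 2 <= expR (pi * z ^+ 2) by exact: expR_ge1Dx.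
have : 2 * z ^+ 2 <= pi * z ^+ 2 by rewrite ler_wpM2r ?sqr_ge0.
have := sqr_ge0 (z - 2^-1); lra.
Qed.

Lemma gaborE k t : gabor k t = phase k.2 t * (gauss (t - k.1%:~R))%:C :> R[i].
Proof. by []. Qed.

Lemma inL2_gabor k : inL2 (@gabor R k).
Proof.
apply: (@inL2_bound _ _ (2 * (1 + `|k.1%:~R|))).
- rewrite (_ : (fun t => _) = fun t => cos (2 * pi * k.2%:~R * t) * gauss (t - k.1%:~R)).
    by apply: measurable_funM; [exact: measurable_cosZ|exact: measurable_gauss].
  by apply/funext => t; rewrite gaborE ReImE /= mulr0 subr0.
- rewrite (_ : (fun t => _) = fun t => sin (2 * pi * k.2%:~R * t) * gauss (t - k.1%:~R)).
    by apply: measurable_funM; [exact: measurable_sinZ|exact: measurable_gauss].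
  by apply/funext => t; rewrite gaborE ReImE /= mulr0 add0r.
- move=> t; rewrite gaborE normcM normc_expi mul1r normc_real ger0_norm ?gauss_ge0//.
  exact: gauss_bound.
Qed.

(** No single dual atom is square integrable. Subtracting the atom at the
    removed lattice point l repairs this and leaves the other pairings alone. *)
Definition dual_family (l k : int * int) (t : R) : R[i] :=
  (psign (k.1 + k.2) / theta_cst R)%:C * (dual_atom k t - dual_atom l t).

Lemma inL2_dual_family l k : inL2 (dual_family l k).
Proof.
rewrite -[dual_family l k]/(scl (psign (k.1 + k.2) / theta_cst R)%:C (dual_atom k - dual_atom l)).
apply: inL2_scl; have [C hC] := dual_atom_diff k l.
have [mk1 mk2] := measurable_dual_atom k; have [ml1 ml2] := measurable_dual_atom l.
apply: (inL2_bound _ _ hC).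
- rewrite (_ : (fun t => _) = fun t => RE (dual_atom k t) - RE (dual_atom l t)).
    exact: measurable_funB.
  by apply/funext => t; rewrite !ReImE.
- rewrite (_ : (fun t => _) = fun t => IM (dual_atom k t) - IM (dual_atom l t)).
    exact: measurable_funB.
  by apply/funext => t; rewrite !ReImE.
Qed.

End dual_atoms.

(** * The biorthogonal family *)

Section biorthogonality.
Variable R : realType.
Local Notation pi := (@pi R).
Local Notation alt_tail := (@alt_tail R).
Local Notation dual_window := (@dual_window R).
Local Notation mu := (@lebesgue_measure R).

Lemma symsum_delta (N : nat) (a : int -> R) (z : int) :
  symsum N (fun i => a i * (i == z)%:R) = a z * (`|z| <= N)%N%:R.
Proof.
elim: N => [|N ih].
  rewrite /symsum big_ord0 addr0 leqn0 absz_eq0 [z == 0]eq_sym.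
  by case: eqP => [<-//|_]; rewrite !mulr0.
rewrite symsumS ih [(_ <= N.+1)%N]leq_eqVlt ltnS orbC.
have [zN|zN] := leqP `|z| N.
  have -> : (N.+1%:Z == z) = false by apply/eqP => e; move: zN; rewrite -e absz_nat ltnn.
  have -> : (- N.+1%:Z == z) = false by apply/eqP => e; move: zN; rewrite -e abszN absz_nat ltnn.
  by rewrite !mulr0 !addr0.
rewrite mulr0 add0r orFb; case: z {ih} zN => n nN; last first.
  rewrite NegzE abszN absz_nat (inj_eq oppr_inj) eqz_nat [n.+1 == _]eq_sym.
  have -> : (N.+1%:Z == - n.+1%:Z) = false by [].
  by rewrite mulr0 add0r; case: eqP => [->//|_]; rewrite !mulr0.
rewrite absz_nat eqz_nat [n == _]eq_sym.
have -> : (- N.+1%:Z == n) = false by case: n {nN}.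
by rewrite mulr0 addr0; case: eqP => [->//|_]; rewrite !mulr0.
Qed.

Lemma eq_symsum (V : zmodType) N (a b : int -> V) : a =1 b -> symsum N a = symsum N b.
Proof. by move=> /funext ->. Qed.

Lemma integ_gauss (m : int) : integ (fun t : R => gauss (t - m%:~R)).
Proof.
apply: (integ_le (measurable_gauss _) (integZ (2 * (1 + `|m%:~R|) ^+ 2) (integ_oneDsqr R))) => t.
rewrite ger0_norm ?gauss_ge0// ler_pdivlMr ?(lt_le_trans _ (oneDsqr_ge1 t))//.
have h1 : oneDsqr t <= (1 + `|t - m%:~R|) ^+ 2 * (1 + `|m%:~R|) ^+ 2.
  rewrite -exprMn (@le_trans _ _ ((1 + `|t|) ^+ 2))//.
    rewrite /oneDsqr -[t ^+ 2]real_normK ?num_real//; have := normr_ge0 t; set a := `|t|; lra.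
  by rewrite ler_sqr ?nnegrE ?mulr_ge0 ?addr_ge0// shift_bound.
apply: (le_trans (ler_wpM2l (gauss_ge0 _) h1)); rewrite mulrA ler_wpM2r ?sqr_ge0//.
set u := t - m%:~R.
rewrite /gauss -[u ^+ 2]real_normK ?num_real//; have : 0 <= `|u| by [].
move: (`|u|) => z z0.
rewrite mulNr expRN mulrC ler_pdivrMr ?expR_gt0//.
have p2 := pi_ge2 R.
have : 1 + pi * z ^+ 2 <= expR (pi * z ^+ 2) by exact: expR_ge1Dx.
have : 2 * z ^+ 2 <= pi * z ^+ 2 by rewrite ler_wpM2r ?sqr_ge0.
have := sqr_ge0 (z - 1); have := sqr_ge0 z; lra.
Qed.

Lemma Rintegral_shift (f : R -> R) (a b c : R) : a <= b -> continuous f ->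
  \int[mu]_(t in `[a + c, b + c]) f t = \int[mu]_(t in `[a, b]) f (t + c).
Proof.
move=> ab cf; rewrite /Rintegral; congr fine.
have d1 : derive1 (fun x : R => x + c) = cst 1.
  apply/funext => x; rewrite derive1E.
  by have [_ ->] := @is_derive_shift R x 1 c.
have cs : continuous (fun x : R => x + c).
  by move=> x; apply: cvgD; [exact: cvg_id|exact: cvg_cst].
rewrite (@integration_by_substitution_increasing _ (fun x : R => x + c) f a b)//.
- by apply: eq_integral => t _; rewrite fctE d1 /= mulr1.
- by move=> x y _ _ xy; rewrite ltrD2r.
- by rewrite d1 => x _; exact: cst_continuous.
- by rewrite d1; exact: is_cvg_cst.
- by rewrite d1; exact: is_cvg_cst.
- split; first by move=> x _; exact: ex_derive.
    by apply: cvg_at_right_filter; exact: cs.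
  by apply: cvg_at_left_filter; exact: cs.
- exact: continuous_subspaceT.
Qed.

Lemma Rintegral_symsum N (u : int -> R -> R) : (forall i, integ (u i)) ->
  integ (fun t => symsum N (u ^~ t)) /\
  \int[mu]_t symsum N (u ^~ t) = symsum N (fun i => \int[mu]_t u i t).
Proof.
move=> iu; elim: N => [|N [ih1 ih2]].
  rewrite /symsum !big_ord0 addr0; split; first by apply: eq_integ (iu 0) => t; rewrite big_ord0 addr0.
  by apply: eq_Rintegral => t _; rewrite big_ord0 addr0.
have i1 := integD (iu N.+1%:Z) (iu (- N.+1%:Z)).
split; first by apply: eq_integ (integD ih1 i1) => t; rewrite symsumS.
rewrite symsumS -ih2 -(RintegralD measurableT (iu _) (iu _)) -(RintegralD measurableT ih1 i1).
by apply: eq_Rintegral => t _; rewrite symsumS.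
Qed.

Lemma continuous_integrable_itv (f : R -> R) (a b : R) : continuous f ->
  mu.-integrable `[a, b] (EFin \o f).
Proof.
move=> cf; apply: continuous_compact_integrable; first exact: segment_compact.
exact: continuous_subspaceT.
Qed.

Lemma Rintegral_itvZl (f : R -> R) (a b r : R) : continuous f ->
  \int[mu]_(t in `[a, b]) (r * f t) = r * \int[mu]_(t in `[a, b]) f t.
Proof. by move=> cf; rewrite RintegralZl//; exact: continuous_integrable_itv. Qed.

Section pairing.
Variable e : R -> R.
Hypothesis ce : continuous e.
Hypothesis pe : forall t (z : int), e (t + z%:~R) = e t.
Hypothesis be : forall t, `|e t| <= 1.
Variables m k : int.

Let F (t : R) := e t * (dual_window (t - m%:~R) * gauss (t - k%:~R)).
Let d := k - m.

Let integF : integ F.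
Proof.
apply: (integ_le _ (integ_gauss k)).
  apply: measurable_funM; first exact: continuous_measurable_fun.
  by apply: measurable_funM; [exact: measurable_dual_window|exact: measurable_gauss].
move=> t.
have h1 : `|e t| * `|dual_window (t - m%:~R)| <= 1.
  by apply: mulr_ile1; rewrite ?normr_ge0 ?be//; exact: dual_window_le1.
rewrite /F normrM normrM (ger0_norm (gauss_ge0 (t - k%:~R))) mulrA.
by apply: ler_piMl h1; exact: gauss_ge0.
Qed.

Let K : R := \int[mu]_(t in `[- 2^-1, 2^-1]) (gauss d%:~R * (e t * expR (2 * pi * d%:~R * t))).

Let contexp : continuous (fun t : R => expR (2 * pi * d%:~R * t)).
Proof.
move=> t; apply: (@continuous_comp _ _ _ ( *%R (2 * pi * d%:~R)) (@expR R)).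
  exact: mulrl_continuous.
exact: continuous_expR.
Qed.

Let contphi : continuous (fun t => gauss d%:~R * (e t * expR (2 * pi * d%:~R * t))).
Proof.
move=> t; apply: cvgM; first exact: cvg_cst.
by apply: cvgM; [exact: ce|exact: contexp].
Qed.

Let piece (i : int) : \int[mu]_t (F t * (i == nint t - m)%:R) =
  alt_tail `|i| * expR (2 * pi * d%:~R * i%:~R) * K.
Proof.
pose c : R := (m + i)%:~R.
pose phi (t : R) := alt_tail `|i| * expR (- (2 * pi * d%:~R * m%:~R)) *
  (gauss d%:~R * (e t * expR (2 * pi * d%:~R * t))).
have cphi : continuous phi.
  by move=> t; apply: cvgM; [exact: cvg_cst|exact: contphi].
have E t : F t * (i == nint t - m)%:R = (phi \_ `](- 2^-1 + c), (2^-1 + c)]) t.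
  rewrite patchE; have <- : (nint t == m + i) = (t \in `](- 2^-1 + c), (2^-1 + c)]%classic).
    rewrite nintE addrC [X in _ <= X]addrC; apply/idP/idP => [h|/set_mem].
      by apply/mem_set; rewrite /= in_itv.
    by rewrite /= in_itv.
  have -> : (i == nint t - m) = (nint t == m + i) by rewrite eq_sym subr_eq [i + m]addrC.
  case: eqP => [kt|_]; last by rewrite mulr0.
  rewrite mulr1 /F /phi /dual_window nintB kt (_ : m + i - m = i); last by rewrite addrAC subrr add0r.
  rewrite (_ : gauss (t - k%:~R) = expR (- pi * (t - m%:~R) ^+ 2) *
     (expR (- (2 * pi * d%:~R * m%:~R)) * (gauss d%:~R * expR (2 * pi * d%:~R * t)))); last first.
    rewrite /gauss -!expRD; congr expR; rewrite /d rmorphB/=; ring.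
  rewrite (_ : expR (pi * (t - m%:~R) ^+ 2) = (expR (- pi * (t - m%:~R) ^+ 2))^-1); last first.
    by rewrite -expRN mulNr opprK.
  by field; rewrite expR_eq0.
under eq_Rintegral do rewrite E.
rewrite -Rintegral_mkcond Rintegral_itv_obnd_cbnd; last first.
  apply: integrableS (continuous_integrable_itv (- 2^-1 + c) (2^-1 + c) cphi) => //.
  exact: subset_itv_oc_cc.
rewrite Rintegral_shift//; last by lra.
rewrite /K -(Rintegral_itvZl _ _ _ contphi).
apply: eq_Rintegral => t _; rewrite /phi /c pe.
rewrite (_ : 2 * pi * d%:~R * (t + (m + i)%:~R) = 2 * pi * d%:~R * t +
  2 * pi * d%:~R * m%:~R + 2 * pi * d%:~R * i%:~R); last by rewrite rmorphD/=; ring.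
rewrite !expRD [expR (- _)]expRN; field; rewrite expR_eq0//.
Qed.

(** On the cell m + i the quadratic exponents cancel, and the integral over
    this cell is alt_tail |i| e^(2 pi d i) times a number that does not depend
    on i. Summing over the cells gives dual_sum d. *)
Lemma dual_window_pairing : integ F /\
  \int[mu]_t F t = theta_cst R * (k == m)%:R * \int[mu]_(t in `[- 2^-1, 2^-1]) e t.
Proof.
split=> //.
have iFi i : integ (fun t => F t * (i == nint t - m)%:R).
  apply: (integ_le _ (integ_abs integF)).
    apply: measurable_funM; first exact: integ_mfun.
    exact: (measurable_nint (fun z => (i == z - m)%:R)).
  by move=> t; rewrite normrM ler_piMr//; case: eqP => _; rewrite ?normr1// normr0.
pose FN N t := symsum N (fun i => F t * (i == nint t - m)%:R).
have FNE N t : FN N t = F t * (`|nint t - m|%N <= N)%N%:R.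
  by rewrite /FN (symsum_delta N (fun=> F t)).
have [|t|N t|_ h] := dominated_cvg (u := FN) (v := F) _ _ (integ_abs integF).
- by move=> N; have [/integ_mfun] := Rintegral_symsum N iFi.
- apply: cvg_near_cst; exists `|nint t - m|%N => // N /= hN.
  by rewrite FNE hN mulr1.
- by rewrite FNE normrM ler_piMr//; case: leqP => _; rewrite ?normr1// normr0.
have h2 : (fun N => dual_sum d%:~R N * K) @ \oo --> theta_cst R * (d == 0)%:R * K.
  by apply: cvgM; [exact: dual_sum_cvg|exact: cvg_cst].
have e2 : (fun N => dual_sum d%:~R N * K) = (fun N => \int[mu]_t FN N t).
  apply/funext => N; have [_ ->] := Rintegral_symsum N iFi.
  rewrite (eq_symsum N piece) /dual_sum /symsum mulrDl mulr_suml; congr (_ + _).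
  by apply: eq_bigr => j _; rewrite mulrDl.
rewrite e2 in h2.
have -> : \int[mu]_t F t = theta_cst R * (d == 0)%:R * K.
  exact: (cvg_unique _ h h2).
rewrite /d subr_eq0; case: eqP => [km|_]; last by rewrite !mulr0 !mul0r.
rewrite /K /d km subrr; congr (_ * _); apply: eq_Rintegral => t _.
by rewrite /gauss !mulr0 mul0r expR0 expr0n mulr0 expR0 mul1r mulr1.
Qed.

End pairing.

Lemma continuous_cosZ (r : R) : continuous (fun t : R => cos (r * t)).
Proof.
move=> t; apply: (@continuous_comp _ _ _ ( *%R r) (@cos R)).
  exact: mulrl_continuous.
exact: continuous_cos.
Qed.

Lemma continuous_sinZ (r : R) : continuous (fun t : R => sin (r * t)).
Proof.
move=> t; apply: (@continuous_comp _ _ _ ( *%R r) (@sin R)).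
  exact: mulrl_continuous.
exact: continuous_sin.
Qed.

Lemma cos_period (r z : int) (t : R) : cos (2 * pi * r%:~R * (t + z%:~R)) = cos (2 * pi * r%:~R * t).
Proof. by rewrite -[RHS](cos_int (r * z)); congr cos; rewrite rmorphM/=; ring. Qed.
Lemma sin_period (r z : int) (t : R) : sin (2 * pi * r%:~R * (t + z%:~R)) = sin (2 * pi * r%:~R * t).
Proof. by rewrite -[RHS](sin_int (r * z)); congr sin; rewrite rmorphM/=; ring. Qed.

Lemma integral_cos (r z : int) :
  \int[mu]_(t in `[z%:~R - 2^-1, z%:~R + 2^-1]) cos (2 * pi * r%:~R * t) = (r == 0)%:R.
Proof.
have [->|r0] := eqVneq r 0.
  under eq_Rintegral do rewrite mulr0 mul0r cos0.
  rewrite Rintegral_cst//= lebesgue_measure_itv/= lte_fin ltrD2l gtrN//.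
  by rewrite mul1r /=; lra.
have rn0 : 2 * pi * r%:~R != 0 :> R by rewrite !mulf_neq0// ?intr_eq0// gt_eqF// pi_gt0.
rewrite /Rintegral (@continuous_FTC2 _ _ (fun t => (2 * pi * r%:~R)^-1 * sin (2 * pi * r%:~R * t))).
- rewrite -EFinB/= (_ : z%:~R + 2^-1 = z%:~R - 2^-1 + 1%:~R); last by rewrite rmorph1; lra.
  by rewrite sin_period subrr.
- by rewrite ltrD2l gtrN.
- by apply: continuous_subspaceT; exact: continuous_cosZ.
- split.
  + by move=> x _; exact: ex_derive.
  + apply: cvg_at_right_filter; apply: cvgM; [exact: cvg_cst|exact: continuous_sinZ].
  + apply: cvg_at_left_filter; apply: cvgM; [exact: cvg_cst|exact: continuous_sinZ].
- move=> x _; rewrite derive1E.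
  have h : is_derive x 1 (fun t : R => (2 * pi * r%:~R)^-1 * sin (2 * pi * r%:~R * t))
     (cos (2 * pi * r%:~R * x)).
    by apply: is_derive_eq; rewrite -![_ *: _]/(_ * _) mulr1 mulrCA mulVf// mulr1.
  by have [_ ->] := h.
Qed.

Lemma integral_sin (r z : int) :
  \int[mu]_(t in `[z%:~R - 2^-1, z%:~R + 2^-1]) sin (2 * pi * r%:~R * t) = 0.
Proof.
have [->|r0] := eqVneq r 0.
  under eq_Rintegral do rewrite mulr0 mul0r sin0.
  by rewrite Rintegral_cst//= mul0r.
have rn0 : 2 * pi * r%:~R != 0 :> R by rewrite !mulf_neq0// ?intr_eq0// gt_eqF// pi_gt0.
rewrite /Rintegral (@continuous_FTC2 _ _ (fun t => - (2 * pi * r%:~R)^-1 * cos (2 * pi * r%:~R * t))).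
- rewrite -EFinB/= (_ : z%:~R + 2^-1 = z%:~R - 2^-1 + 1%:~R); last by rewrite rmorph1; lra.
  by rewrite cos_period subrr.
- by rewrite ltrD2l gtrN.
- by apply: continuous_subspaceT; exact: continuous_sinZ.
- split.
  + by move=> x _; exact: ex_derive.
  + apply: cvg_at_right_filter; apply: cvgM; [exact: cvg_cst|exact: continuous_cosZ].
  + apply: cvg_at_left_filter; apply: cvgM; [exact: cvg_cst|exact: continuous_cosZ].
- move=> x _; rewrite derive1E.
  have h : is_derive x 1 (fun t : R => - (2 * pi * r%:~R)^-1 * cos (2 * pi * r%:~R * t))
     (sin (2 * pi * r%:~R * x)).
    apply: is_derive_eq; rewrite -![_ *: _]/(_ * _).
    by move: rn0; set a := 2 * pi * r%:~R => a0; field.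
  by have [_ ->] := h.
Qed.

Lemma pairing_cos (r m k : int) :
  integ (fun t => cos (2 * pi * r%:~R * t) * (dual_window (t - m%:~R) * gauss (t - k%:~R))) /\
  \int[mu]_t (cos (2 * pi * r%:~R * t) * (dual_window (t - m%:~R) * gauss (t - k%:~R))) =
  theta_cst R * ((k == m) && (r == 0))%:R.
Proof.
have [h ->] := @dual_window_pairing (fun t => cos (2 * pi * r%:~R * t)) (@continuous_cosZ _)
  (fun t z => cos_period r z t) (fun t => cos_max _) m k.
split=> //; have := integral_cos r 0; rewrite sub0r add0r => ->.
by rewrite -mulrA -natrM mulnb.
Qed.

Lemma pairing_sin (r m k : int) :
  integ (fun t => sin (2 * pi * r%:~R * t) * (dual_window (t - m%:~R) * gauss (t - k%:~R))) /\
  \int[mu]_t (sin (2 * pi * r%:~R * t) * (dual_window (t - m%:~R) * gauss (t - k%:~R))) = 0.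
Proof.
have [h ->] := @dual_window_pairing (fun t => sin (2 * pi * r%:~R * t)) (@continuous_sinZ _)
  (fun t z => sin_period r z t) (fun t => sin_max _) m k.
by split=> //; have := integral_sin r 0; rewrite sub0r add0r => ->; rewrite mulr0.
Qed.

(** The atom subtracted at l pairs to 0 with every gabor k, as k is not l. *)
Lemma biorthogonal_dual_family (l : int * int) : biorthogonal (~` [set l]) (@gabor R) (dual_family l).
Proof.
split=> [k _|k j kl jl]; first exact: inL2_dual_family.
have c0n : theta_cst R != 0 by rewrite gt_eqF// theta_cst_gt0.
pose A (i : int * int) t := cos (2 * pi * (k.2 - i.2)%:~R * t) * (dual_window (t - i.1%:~R) * gauss (t - k.1%:~R)).
pose B (i : int * int) t := sin (2 * pi * (k.2 - i.2)%:~R * t) * (dual_window (t - i.1%:~R) * gauss (t - k.1%:~R)).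
have E t : gabor k t * (dual_family l j t)^* =
  (psign R (j.1 + j.2) / theta_cst R * (psign R (j.1 + j.2) * A j t - psign R (l.1 + l.2) * A l t)) +i*
  (psign R (j.1 + j.2) / theta_cst R * (psign R (j.1 + j.2) * B j t - psign R (l.1 + l.2) * B l t)).
  have e2 (i : int * int) : 2 * pi * (k.2 - i.2)%:~R * t = 2 * pi * k.2%:~R * t - 2 * pi * i.2%:~R * t.
    by rewrite rmorphB/=; ring.
  rewrite /A /B !e2 !cosB !sinB gaborE /dual_family /dual_atom.
  by apply: complexP; rewrite !ReImE /=; ring.
have iA i : integ (A i) by have [] := pairing_cos (k.2 - i.2) i.1 k.1.
have iB i : integ (B i) by have [] := pairing_sin (k.2 - i.2) i.1 k.1.
have vA i : \int[mu]_t A i t = theta_cst R * (k == i)%:R.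
  have [_ ->] := pairing_cos (k.2 - i.2) i.1 k.1.
  by rewrite subr_eq0 -[k == i]/((k.1 == i.1) && (k.2 == i.2)).
have vB i : \int[mu]_t B i t = 0 by have [_ ->] := pairing_sin (k.2 - i.2) i.1 k.1.
have lin (u v : R -> R) (x y z : R) : integ u -> integ v ->
   \int[mu]_t (x * (y * u t - z * v t)) = x * (y * \int[mu]_t u t - z * \int[mu]_t v t).
  move=> iu iv; rewrite RintegralZl//; last by apply: integB; exact: integZ.
  by rewrite RintegralB//; [rewrite !RintegralZl|exact: integZ|exact: integZ].
rewrite /dotL2 /cintegral; apply: complexP; rewrite ?REE ?IME.
  rewrite (_ : Rintegral _ _ _ = \int[mu]_t (psign R (j.1 + j.2) / theta_cst R *
    (psign R (j.1 + j.2) * A j t - psign R (l.1 + l.2) * A l t))); last first.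
    by apply: eq_Rintegral => t _; rewrite E.
  rewrite lin// !vA.
  have -> : (k == l) = false by apply/eqP.
  rewrite !mulr0 subr0.
  set x := psign R _; rewrite (_ : x / _ * _ = x * x * (k == j)%:R); last by field.
  by rewrite psign_sq mul1r; case: (k == j).
rewrite (_ : Rintegral _ _ _ = \int[mu]_t (psign R (j.1 + j.2) / theta_cst R *
    (psign R (j.1 + j.2) * B j t - psign R (l.1 + l.2) * B l t))); last first.
  by apply: eq_Rintegral => t _; rewrite E.
by rewrite lin// !vB !mulr0 subr0 mulr0; case: (k == j).
Qed.

End biorthogonality.

(** * Periodic multipliers *)

Section multipliers.
Variable R : realType.
Local Notation pi := (@pi R).
Local Notation mu := (@lebesgue_measure R).
Implicit Types (p u H : R -> R).

(** The 1-periodization of H has vanishing Fourier coefficients. *)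
Definition fourier_null H := integ H /\ forall n : int,
  \int[mu]_t (H t * cos (2 * pi * n%:~R * t)) = 0 /\
  \int[mu]_t (H t * sin (2 * pi * n%:~R * t)) = 0.

(** Trigonometric polynomials of period 1 have this property, and it passes to
    bounded pointwise limits. So it holds for every bounded Borel function of
    period 1, which stands in for the uniqueness theorem for Fourier
    coefficients of integrable functions. *)
Definition multiplier p := [/\ measurable_fun setT p,
  (exists M, forall t, `|p t| <= M) &
  forall H, fourier_null H -> fourier_null (fun t => H t * p t)].

Lemma integ_mul_bounded H p M : integ H -> measurable_fun setT p ->
  (forall t, `|p t| <= M) -> integ (fun t => H t * p t).
Proof.
move=> iH mp pM; apply: (integ_le _ (integZ M (integ_abs iH))).
  by apply: measurable_funM => //; exact: integ_mfun.
by move=> t; rewrite normrM mulrC ler_wpM2r.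
Qed.

Lemma integ_cos H (r : R) : integ H -> integ (fun t => H t * cos (r * t)).
Proof.
by move=> iH; apply: (integ_mul_bounded iH (measurable_cosZ r)) => t; exact: cos_max.
Qed.
Lemma integ_sin H (r : R) : integ H -> integ (fun t => H t * sin (r * t)).
Proof.
by move=> iH; apply: (integ_mul_bounded iH (measurable_sinZ r)) => t; exact: sin_max.
Qed.

Lemma eq_multiplier p p' : p =1 p' -> multiplier p -> multiplier p'.
Proof. by move=> /funext ->. Qed.

Lemma fourier_nullZ c H : fourier_null H -> fourier_null (fun t => H t * c).
Proof.
move=> [iH h]; split; first by apply: eq_integ (integZ c iH) => t; rewrite mulrC.
move=> n; have [h1 h2] := h n; split.
  under eq_Rintegral do rewrite mulrAC.
  by rewrite RintegralZr ?h1 ?mul0r//; exact: integ_cos.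
under eq_Rintegral do rewrite mulrAC.
by rewrite RintegralZr ?h2 ?mul0r//; exact: integ_sin.
Qed.

Lemma fourier_nullD H H' : fourier_null H -> fourier_null H' -> fourier_null (fun t => H t + H' t).
Proof.
move=> [iH h] [iH' h']; split; first exact: integD.
move=> n; have [h1 h2] := h n; have [h1' h2'] := h' n; split.
  under eq_Rintegral do rewrite mulrDl.
  by rewrite RintegralD ?h1 ?h1' ?addr0//; exact: integ_cos.
under eq_Rintegral do rewrite mulrDl.
by rewrite RintegralD ?h2 ?h2' ?addr0//; exact: integ_sin.
Qed.

Lemma eq_fourier_null H H' : H =1 H' -> fourier_null H -> fourier_null H'.
Proof. by move=> /funext ->. Qed.

Lemma multiplier_cst c : multiplier (fun=> c).
Proof. by split; [exact: measurable_cst|exists (`|c| + 0) => t; rewrite addr0|move=> H; exact: fourier_nullZ]. Qed.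

Lemma multiplierD p p' : multiplier p -> multiplier p' -> multiplier (fun t => p t + p' t).
Proof.
move=> [mp [M hM] hp] [mp' [M' hM'] hp']; split; first exact: measurable_funD.
  by exists (M + M') => t; rewrite (le_trans (ler_normD _ _))// lerD.
move=> H zH; apply: eq_fourier_null (fourier_nullD (hp H zH) (hp' H zH)) => t.
by rewrite mulrDr.
Qed.

Lemma multiplierM p p' : multiplier p -> multiplier p' -> multiplier (fun t => p t * p' t).
Proof.
move=> [mp [M hM] hp] [mp' [M' hM'] hp']; split; first exact: measurable_funM.
  by exists (M * M') => t; rewrite normrM ler_pM.
by move=> H zH; apply: eq_fourier_null (hp' _ (hp H zH)) => t; rewrite mulrA.
Qed.

Lemma multiplierZ c p : multiplier p -> multiplier (fun t => c * p t).
Proof. by move=> hp; apply: multiplierM => //; exact: multiplier_cst. Qed.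

Lemma multiplierB p p' : multiplier p -> multiplier p' -> multiplier (fun t => p t - p' t).
Proof.
move=> hp hp'; apply: eq_multiplier (multiplierD hp (multiplierZ (-1) hp')) => t.
by rewrite mulN1r.
Qed.

Lemma multiplierX p n : multiplier p -> multiplier (fun t => p t ^+ n).
Proof.
move=> hp; elim: n => [|n ih]; first exact: eq_multiplier (multiplier_cst 1).
by apply: eq_multiplier (multiplierM hp ih) => t; rewrite exprS.
Qed.

Lemma multiplier_sum n (p : nat -> R -> R) : (forall i, multiplier (p i)) ->
  multiplier (fun t => \sum_(i < n) p i t).
Proof.
move=> hp; elim: n => [|n ih].
  by apply: eq_multiplier (multiplier_cst 0) => t; rewrite big_ord0.
by apply: eq_multiplier (multiplierD ih (hp n)) => t; rewrite big_ord_recr.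
Qed.

Lemma multiplier_prod n (p : nat -> R -> R) : (forall i, multiplier (p i)) ->
  multiplier (fun t => \prod_(i < n) p i t).
Proof.
move=> hp; elim: n => [|n ih].
  by apply: eq_multiplier (multiplier_cst 1) => t; rewrite big_ord0.
by apply: eq_multiplier (multiplierM ih (hp n)) => t; rewrite big_ord_recr.
Qed.

Lemma multiplier_lim (u : nat -> R -> R) p M : (forall n, multiplier (u n)) ->
  (forall n t, `|u n t| <= M) -> (forall t, u ^~ t @ \oo --> p t) -> multiplier p.
Proof.
move=> hu uM up.
have mp : measurable_fun setT p.
  apply: (@measurable_fun_cvg _ _ _ _ u) => [n|t _]; last exact: up.
  by have [] := hu n.
have pM t : `|p t| <= M.
  have h : `|u n t| @[n --> \oo] --> `|p t| by apply: cvg_norm; exact: up.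
  by apply: (cvgr_to_le h); exact: nearW.
split=> //; first by exists M.
move=> H zH; have [iH _] := zH.
have gen (e : R -> R) : measurable_fun setT e -> (forall t, `|e t| <= 1) ->
    (forall n, \int[mu]_t (H t * u n t * e t) = 0) -> \int[mu]_t (H t * p t * e t) = 0.
  move=> me e1 h0.
  have [|t|n t|_ h] := dominated_cvg (u := fun n t => H t * u n t * e t)
     (v := fun t => H t * p t * e t) _ _ (integZ M (integ_abs iH)).
  - move=> n; apply: measurable_funM => //; apply: measurable_funM; first exact: integ_mfun.
    by have [] := hu n.
  - by apply: cvgM; [apply: cvgM; [exact: cvg_cst|exact: up]|exact: cvg_cst].
  - rewrite !normrM mulrAC [M * _]mulrC.
    apply: ler_pM; rewrite ?mulr_ge0//.
    by rewrite ler_piMr.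
  apply: esym; apply: (cvg_unique _ _ h) => //.
  by rewrite (_ : (fun n => _) = cst 0); [exact: cvg_cst|apply/funext => n; rewrite h0].
split; first exact: (integ_mul_bounded iH mp pM).
move=> n; split; apply: gen => [|t|k].
- exact: measurable_cosZ.
- exact: cos_max.
- by have [_ _ /(_ H zH) [_ /(_ n) []]] := hu k.
- exact: measurable_sinZ.
- exact: sin_max.
- by have [_ _ /(_ H zH) [_ /(_ n) []]] := hu k.
Qed.

(** Product formulas turn multiplication by a frequency r into shifts of the
    frequency n by r and -r. *)
Lemma multiplier_cos (r : int) : multiplier (fun t => cos (2 * pi * r%:~R * t)).
Proof.
split; [exact: measurable_cosZ|by exists 1 => t; exact: cos_max|].
move=> H [iH h]; split; first exact: integ_cos.
have cc (n : int) (t : R) : cos (2 * pi * r%:~R * t) * cos (2 * pi * n%:~R * t) =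
   2^-1 * cos (2 * pi * (n + r)%:~R * t) + 2^-1 * cos (2 * pi * (n - r)%:~R * t).
  rewrite (_ : 2 * pi * (n + r)%:~R * t = 2 * pi * n%:~R * t + 2 * pi * r%:~R * t).
    rewrite (_ : 2 * pi * (n - r)%:~R * t = 2 * pi * n%:~R * t - 2 * pi * r%:~R * t).
      by rewrite cosD cosB; field.
    by rewrite rmorphB/=; ring.
  by rewrite rmorphD/=; ring.
have cs (n : int) (t : R) : cos (2 * pi * r%:~R * t) * sin (2 * pi * n%:~R * t) =
   2^-1 * sin (2 * pi * (n + r)%:~R * t) + 2^-1 * sin (2 * pi * (n - r)%:~R * t).
  rewrite (_ : 2 * pi * (n + r)%:~R * t = 2 * pi * n%:~R * t + 2 * pi * r%:~R * t).
    rewrite (_ : 2 * pi * (n - r)%:~R * t = 2 * pi * n%:~R * t - 2 * pi * r%:~R * t).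
      by rewrite sinD sinB; field.
    by rewrite rmorphB/=; ring.
  by rewrite rmorphD/=; ring.
move=> n; have [h1 h2] := h (n + r); have [h3 h4] := h (n - r); split.
  under eq_Rintegral do rewrite -mulrA cc mulrDr !(mulrCA (H _)).
  rewrite RintegralD//; try by apply: integZ; exact: integ_cos.
  by rewrite !RintegralZl ?h1 ?h3 ?mulr0 ?addr0//; exact: integ_cos.
under eq_Rintegral do rewrite -mulrA cs mulrDr !(mulrCA (H _)).
rewrite RintegralD//; try by apply: integZ; exact: integ_sin.
by rewrite !RintegralZl ?h2 ?h4 ?mulr0 ?addr0//; exact: integ_sin.
Qed.

Lemma multiplier_sin (r : int) : multiplier (fun t => sin (2 * pi * r%:~R * t)).
Proof.
split; [exact: measurable_sinZ|by exists 1 => t; exact: sin_max|].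
move=> H [iH h]; split; first exact: integ_sin.
have sc (n : int) (t : R) : sin (2 * pi * r%:~R * t) * cos (2 * pi * n%:~R * t) =
   2^-1 * sin (2 * pi * (n + r)%:~R * t) + - 2^-1 * sin (2 * pi * (n - r)%:~R * t).
  rewrite (_ : 2 * pi * (n + r)%:~R * t = 2 * pi * n%:~R * t + 2 * pi * r%:~R * t).
    rewrite (_ : 2 * pi * (n - r)%:~R * t = 2 * pi * n%:~R * t - 2 * pi * r%:~R * t).
      by rewrite sinD sinB; field.
    by rewrite rmorphB/=; ring.
  by rewrite rmorphD/=; ring.
have ss (n : int) (t : R) : sin (2 * pi * r%:~R * t) * sin (2 * pi * n%:~R * t) =
   - 2^-1 * cos (2 * pi * (n + r)%:~R * t) + 2^-1 * cos (2 * pi * (n - r)%:~R * t).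
  rewrite (_ : 2 * pi * (n + r)%:~R * t = 2 * pi * n%:~R * t + 2 * pi * r%:~R * t).
    rewrite (_ : 2 * pi * (n - r)%:~R * t = 2 * pi * n%:~R * t - 2 * pi * r%:~R * t).
      by rewrite cosD cosB; field.
    by rewrite rmorphB/=; ring.
  by rewrite rmorphD/=; ring.
move=> n; have [h1 h2] := h (n + r); have [h3 h4] := h (n - r); split.
  under eq_Rintegral do rewrite -mulrA sc mulrDr !(mulrCA (H _)).
  rewrite RintegralD//; try by apply: integZ; exact: integ_sin.
  by rewrite !RintegralZl ?h2 ?h4 ?mulr0 ?addr0//; exact: integ_sin.
under eq_Rintegral do rewrite -mulrA ss mulrDr !(mulrCA (H _)).
rewrite RintegralD//; try by apply: integZ; exact: integ_cos.
by rewrite !RintegralZl ?h1 ?h3 ?mulr0 ?addr0//; exact: integ_cos.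
Qed.

End multipliers.

Section multiplier_sets.
Variable R : realType.

Lemma bernoulli (y : R) n : 0 <= y -> 1 + n%:R * y <= (1 + y) ^+ n.
Proof.
move=> y0; elim: n => [|n ih]; first by rewrite mul0r addr0 expr0.
rewrite exprS; apply: (@le_trans _ _ ((1 + y) * (1 + n%:R * y))).
  rewrite -[n.+1%:R]natr1; have : 0 <= n%:R * y * y by rewrite !mulr_ge0.
  lra.
by rewrite ler_wpM2l// addr_ge0.
Qed.

Lemma bernoulli_sub (y : R) n : 0 <= y <= 1 -> 1 - n%:R * y <= (1 - y) ^+ n.
Proof.
move=> /andP[y0 y1]; elim: n => [|n ih]; first by rewrite mul0r subr0 expr0.
rewrite exprS; apply: (@le_trans _ _ ((1 - y) * (1 - n%:R * y))).
  rewrite -[n.+1%:R]natr1; have : 0 <= n%:R * y * y by rewrite !mulr_ge0.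
  lra.
by rewrite ler_wpM2l// subr_ge0.
Qed.

(** With w the square root of z, n w^n is bounded by Bernoulli's inequality. *)
Lemma cvg_nat_geometric (z : R) : 0 <= z < 1 -> (fun n => n%:R * z ^+ n) @ \oo --> (0 : R).
Proof.
move=> /andP[z0 z1].
have [->|zn0] := eqVneq z 0.
  apply: (@cvg_trans _ ((cst 0 : nat -> R) @ \oo)); last exact: cvg_cst.
  apply: near_eq_cvg; exists 1%N => // -[//|n] _ /=.
  by rewrite exprS mul0r mulr0.
have zp : 0 < z by rewrite lt_neqAle eq_sym zn0.
pose w := Num.sqrt z.
have w0 : 0 < w by rewrite sqrtr_gt0.
have wz : w ^+ 2 = z by rewrite sqr_sqrtr.
have w1 : w < 1 by rewrite -(@ltr_pXn2r _ 2) ?nnegrE ?(ltW w0)// wz expr1n.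
pose h := w^-1 - 1.
have h0 : 0 < h by rewrite subr_gt0 invf_gt1.
apply: (@squeeze_cvgr _ _ _ _ (cst 0) (fun n => h^-1 * w ^+ n)).
- apply: nearW => n /=; rewrite mulr_ge0 ?exprn_ge0//=.
  rewrite -wz -exprM mul2n -addnn exprD mulrA ler_wpM2r ?exprn_ge0 ?(ltW w0)//.
  rewrite -ler_pdivlMr ?exprn_gt0// -exprVn.
  rewrite (_ : w^-1 = 1 + h); last by rewrite /h addrC subrK.
  rewrite mulrC ler_pdivlMr//; apply: le_trans (bernoulli n (ltW h0)) .
  by rewrite lerDr.
- exact: cvg_cst.
- by rewrite -(mulr0 h^-1); apply: cvgM; [exact: cvg_cst|apply: cvg_expr; rewrite ger0_norm// ltW].
Qed.

(** Polynomials in y that tend, on [0, 1], to the indicator of [1/2, 1]. *)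
Definition stone (n : nat) (y : R) : R := 1 - (1 - y ^+ n) ^+ (2 ^ n * n).

Lemma stone_itv n y : 0 <= y <= 1 -> 0 <= stone n y <= 1.
Proof.
move=> /andP[y0 y1]; have a0 : 0 <= y ^+ n by rewrite exprn_ge0.
have a1 : y ^+ n <= 1 by rewrite exprn_ile1.
rewrite /stone subr_ge0 gerBl exprn_ile1 ?exprn_ge0// ?subr_ge0//.
by rewrite gerBl.
Qed.

(** Both sides of 1/2 follow from Bernoulli's inequality: with a = y^n, the
    power (1 - a)^K is at most 1/(1 + K a) and at least 1 - K a, where K a = n
    (2 y)^n. *)
Lemma stone_cvg y : 0 <= y <= 1 -> (fun n => stone n y) @ \oo --> ((2^-1 <= y)%R%:R : R).
Proof.
move=> /andP[y0 y1].
have a0 n : 0 <= y ^+ n by rewrite exprn_ge0.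
have a1 n : y ^+ n <= 1 by rewrite exprn_ile1.
have [y2|y2] := leP 2^-1 y.
  have h : (fun n => 1 - (1 - y ^+ n) ^+ (2 ^ n * n)) @ \oo --> 1 - (0 : R).
    apply: cvgB; first exact: cvg_cst.
    apply: (@squeeze_cvgr _ _ _ _ (cst 0) (@harmonic R)).
    - apply: nearW => n /=; rewrite exprn_ge0 ?subr_ge0//=.
      have p0 : 0 < 1 + (2 ^ n * n)%:R * y ^+ n by rewrite ltr_wpDr// mulr_ge0.
      apply: (@le_trans _ _ (1 + (2 ^ n * n)%:R * y ^+ n)^-1).
        rewrite -[leRHS]mul1r ler_pdivlMr//.
        apply: (@le_trans _ _ ((1 - y ^+ n) ^+ (2 ^ n * n) * (1 + y ^+ n) ^+ (2 ^ n * n))).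
          by rewrite ler_wpM2l ?exprn_ge0 ?subr_ge0// bernoulli.
        rewrite -exprMn exprn_ile1//; first by rewrite mulr_ge0 ?subr_ge0// addr_ge0.
        by rewrite -subr_sqr expr1n gerBl sqr_ge0.
      rewrite lef_pV2 ?posrE// -natr1 addrC lerD2l natrM mulrAC ler_peMl//.
      rewrite natrX -exprMn exprn_ege1//; lra.
    - exact: cvg_cst.
    - exact: cvg_harmonic.
  by rewrite subr0 in h.
apply: (@squeeze_cvgr _ _ _ _ (cst 0) (fun n => n%:R * (2 * y) ^+ n)).
- apply: nearW => n /=; have /andP[-> _] := @stone_itv n y (introT andP (conj y0 y1)).
  rewrite /stone lerBlDr -lerBlDl; apply: le_trans (bernoulli_sub _ _); last by rewrite a0 a1.
  by rewrite lerD2l lerN2 natrM natrX exprMn; lra.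
- exact: cvg_cst.
- by apply: cvg_nat_geometric; apply/andP; split; lra.
Qed.

Lemma multiplier_stone n (p : R -> R) : multiplier p -> multiplier (fun t => stone n (p t)).
Proof.
move=> hp; apply: multiplierB; first exact: multiplier_cst.
by apply: multiplierX; apply: multiplierB; [exact: multiplier_cst|exact: multiplierX].
Qed.

(** An affine change of variable puts p in [0, 1] and the threshold c at 1/2. *)
Lemma multiplier_ge (p : R -> R) c : multiplier p -> multiplier (fun t => (c <= p t)%R%:R).
Proof.
move=> hp; have [_ [M hM] _] := hp.
pose K := M + `|c| + 1.
have M0 : 0 <= M by apply: le_trans (hM 0).
have K0 : 0 < K by rewrite ltr_wpDl// addr_ge0.
pose y t := 2^-1 + (2 * K)^-1 * (p t - c).
have hy : multiplier y.
  apply: multiplierD; first exact: multiplier_cst.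
  by apply: multiplierZ; apply: multiplierB => //; exact: multiplier_cst.
have y01 t : 0 <= y t <= 1.
  have : `|(2 * K)^-1 * (p t - c)| <= 2^-1.
    rewrite normrM ger0_norm ?invr_ge0 ?mulr_ge0 ?(ltW K0)// invfM -mulrA ler_piMr//.
    rewrite mulrC ler_pdivrMr// mul1r (le_trans (ler_normB _ _))// /K.
    by rewrite (le_trans (lerD (hM t) (lexx `|c|)))// lerDl.
  by rewrite ler_norml /y => /andP[]; lra.
apply: (@multiplier_lim _ (fun n t => stone n (y t)) _ 1).
- by move=> n; exact: multiplier_stone.
- by move=> n t; have /andP[h1 h2] := stone_itv n (y01 t); rewrite ger0_norm.
- move=> t; have -> : (c <= p t) = (2^-1 <= y t).
    by rewrite /y lerDl pmulr_rge0 ?subr_ge0// invr_gt0 mulr_gt0.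
  exact: stone_cvg.
Qed.

(** A sigma-algebra: intersections and complements come from products and
    differences of multipliers, countable unions from dominated convergence. *)
Definition mulset (A : set R) := multiplier (fun t => \1_A t : R).

Lemma mulsetP A (p : R -> R) : (forall t, p t = (`[< A t >])%:R) -> multiplier p -> mulset A.
Proof.
move=> pA; apply: eq_multiplier => t; rewrite pA indicE; congr (_%:R).
Qed.

Lemma mulset_ge (p : R -> R) c : multiplier p -> mulset [set t | c <= p t].
Proof. by move=> hp; apply: mulsetP (multiplier_ge c hp) => t; rewrite asboolb. Qed.

Lemma mulsetC A : mulset A -> mulset (~` A).
Proof.
move=> hA; apply: eq_multiplier (multiplierB (multiplier_cst 1) hA) => t.
by rewrite !indicE in_setC; case: (t \in A); rewrite ?subrr ?subr0.
Qed.

Lemma mulsetI A B : mulset A -> mulset B -> mulset (A `&` B).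
Proof.
move=> hA hB; apply: eq_multiplier (multiplierM hA hB) => t.
by rewrite !indicE in_setI -natrM mulnb.
Qed.

Lemma mulsetU A B : mulset A -> mulset B -> mulset (A `|` B).
Proof. by move=> hA hB; rewrite -[_ `|` _]setCK setCU; apply: mulsetC; apply: mulsetI; exact: mulsetC. Qed.

Lemma mulset0 : mulset set0.
Proof. by apply: eq_multiplier (multiplier_cst 0) => t; rewrite indic0. Qed.

Lemma mulsetT : mulset setT.
Proof. by rewrite -setC0; apply: mulsetC; exact: mulset0. Qed.

Lemma mulset_bigcup (F : nat -> set R) : (forall n, mulset (F n)) -> mulset (\bigcup_n F n).
Proof.
move=> hF; rewrite -[\bigcup_n _]setCK; apply: mulsetC; rewrite setC_bigcup.
apply: (@multiplier_lim _ (fun n t => \prod_(i < n) \1_(~` F i) t) _ 1).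
- by move=> n; apply: (@multiplier_prod _ n (fun i t => \1_(~` F i) t)) => i; exact: mulsetC.
- move=> n t /=; rewrite ger0_norm; last by apply: prodr_ge0 => i; rewrite indicE.
  by apply: prodr_ile1 => i; rewrite indicE ler0n lern1 leq_b1.
- move=> t; rewrite indicE.
  have [/set_mem h|/negP h] := boolP (t \in \bigcap_i ~` F i).
    rewrite (_ : (fun n => _) = cst 1); first exact: cvg_cst.
    by apply/funext => n; rewrite big1// => i _; rewrite indicE mem_set//; exact: h.
  have [i Fi] : exists i, F i t.
    by apply: contrapT => hh; apply: h; apply/mem_set => i _ Fi; apply: hh; exists i.
  apply: cvg_near_cst; exists i.+1 => // n /= ni.
  by rewrite (bigD1 (Ordinal ni))//= indicE memNset ?mul0r// => /(_ Fi).
Qed.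

Lemma mulset_borel (u : R -> R) (B : set R) : (forall c, mulset [set t | c <= u t]) ->
  measurable B -> mulset (u @^-1` B).
Proof.
move=> hu mB.
have : (@RGenCInfty.G R).-sigma.-measurable B by rewrite -RGenCInfty.measurableE.
suff sub : <<s @RGenCInfty.G R >> `<=` [set B | mulset (u @^-1` B)] by exact: sub.
apply: smallest_sub; last first.
  move=> _ [c ->]; rewrite (_ : mkset _ _ = mulset [set t | c <= u t])//.
  by congr mulset; apply/seteqP; split => t /=; rewrite in_itv/= andbT.
split => /=.
- by rewrite preimage_set0; exact: mulset0.
- by move=> A; rewrite setTD preimage_setC; exact: mulsetC.
- by move=> F hF; rewrite preimage_bigcup; exact: mulset_bigcup.
Qed.

(** The sum counts the positive integers up to a. *)
Lemma floor_count_bounds (K : nat) (a : R) : 0 <= a -> a <= K%:R ->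
  a - 1 <= \sum_(i < K) (i.+1%:R <= a)%R%:R <= a.
Proof.
elim: K a => [|K ih] a a0 aK.
  by rewrite big_ord0 a0 andbT; lra.
rewrite big_ord_recl /=.
have [a1|a1] := leP 1 a; last first.
  rewrite add0r big1; first by apply/andP; split; lra.
  move=> i _; rewrite /bump /= add1n; case: leP => //.
  by rewrite -[i.+2%:R]natr1 -[i.+1%:R]natr1 => h; have : 0 <= i%:R :> R by []; lra.
have [||h1 h2] := andP (ih (a - 1) _ _); [lra|by rewrite lerBlDr natr1|].
have e : \sum_(i < K) ((bump 0 i).+1%:R <= a)%R%:R = \sum_(i < K) (i.+1%:R <= a - 1)%R%:R :> R.
  by apply: eq_bigr => i _; rewrite /bump /= add1n lerBrDr natr1.
by rewrite e [true%:R]mulr1n; apply/andP; split; lra.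
Qed.

(** Up to an error 1/(n + 1), phi is 1/(n + 1) times the number of thresholds
    i/(n + 1), with i > 0, that it reaches. *)
Lemma multiplier_comp (u phi : R -> R) (M : nat) :
  (forall c, mulset [set t | c <= u t]) -> measurable_fun setT phi ->
  (forall x, 0 <= phi x <= M%:R) -> multiplier (fun t => phi (u t)).
Proof.
move=> hu mphi phi0.
pose v (n : nat) (t : R) : R := n.+1%:R^-1 * \sum_(i < (n.+1 * M)%N) (i.+1%:R <= n.+1%:R * phi (u t))%R%:R.
have vb n t : phi (u t) - n.+1%:R^-1 <= v n t <= phi (u t).
  have /andP[p0 pM] := phi0 (u t).
  have [||h1 h2] := andP (@floor_count_bounds (n.+1 * M)%N (n.+1%:R * phi (u t)) _ _).
  - by rewrite mulr_ge0.
  - by rewrite natrM ler_wpM2l.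
  rewrite /v; apply/andP; split.
    by rewrite ler_pdivlMl// mulrBr mulfV.
  by rewrite ler_pdivrMl.
apply: (@multiplier_lim _ v _ (M%:R + 1)).
- move=> n; apply: multiplierZ; apply: (@multiplier_sum _ _ (fun i t => (i.+1%:R <= n.+1%:R * phi (u t))%R%:R)).
  move=> i; have := @mulset_borel u [set x | i.+1%:R <= n.+1%:R * phi x] hu.
  have mB : measurable [set x | i.+1%:R <= n.+1%:R * phi x].
    rewrite -[X in measurable X]setTI; apply: measurable_fun_le => //.
    by apply: measurable_funM => //; exact: measurable_cst.
  move=> /(_ mB); apply: eq_multiplier => t; rewrite indicE; congr (_%:R).
  by apply: congr1; apply/idP/idP; rewrite inE.
- move=> n t; have /andP[h1 h2] := vb n t; have /andP[p0 pM] := phi0 (u t).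
  have : n.+1%:R^-1 <= 1 :> R by rewrite invf_le1// ler1n.
  rewrite ler_norml; move: h1 h2; set w := n.+1%:R^-1; set z := v n t => *.
  by apply/andP; split; lra.
- move=> t; apply: (@squeeze_cvgr _ _ _ _ (fun n => phi (u t) - n.+1%:R^-1) (cst (phi (u t)))).
  + by apply: nearW => n; exact: vb.
  + rewrite -[X in _ --> X]subr0; apply: cvgB; first exact: cvg_cst.
    exact: cvg_harmonic.
  + exact: cvg_cst.
Qed.

End multiplier_sets.

(** * Functions orthogonal to the punctured system *)

Section orthogonality_relations.
Variable R : realType.
Local Notation pi := (@pi R).
Local Notation mu := (@lebesgue_measure R).

Lemma cos_sfrac (t : R) : cos (2 * pi * 1%:~R * t) = cos (2 * pi * `|sfrac t|).
Proof.
rewrite {1}(sfrac_nint t) cos_period -[LHS]cos_norm rmorph1 mulr1 normrM [`|2 * pi|]ger0_norm//.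
by rewrite mulr_ge0// pi_ge0.
Qed.

Lemma sin_sfrac_ge0 (t : R) : (0 <= sin (2 * pi * 1%:~R * t)) = (0 <= sfrac t).
Proof.
rewrite {1}(sfrac_nint t) sin_period rmorph1 mulr1.
have /andP[h1 h2] := sfrac_itv t; have p0 := pi_gt0 R.
have [x0|x0] := leP 0 (sfrac t).
  apply: sin_ge0_pi; apply/andP; split; first by rewrite !mulr_ge0// ltW.
  rewrite -[leRHS]mul1r mulrAC ler_wpM2r ?(ltW p0)//; lra.
apply/negbTE; rewrite -ltNge -[sfrac t]opprK mulrN sinN oppr_lt0.
apply: sin_gt0_pi; apply/andP; split; first by rewrite !mulr_gt0// oppr_gt0.
rewrite -[ltRHS]mul1r mulrAC ltr_pM2r//; lra.
Qed.

Lemma cos_le_sfrac (t c : R) : 0 <= c <= 2^-1 ->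
  (cos (2 * pi * 1%:~R * t) <= cos (2 * pi * c)) = (c <= `|sfrac t|).
Proof.
move=> /andP[c0 c1]; have p0 := pi_gt0 R; have x2 := sfrac_norm t.
have inpi (z : R) : 0 <= z <= 2^-1 -> 2 * pi * z \in `[0, pi].
  move=> /andP[z0 z1]; rewrite in_itv/=; apply/andP; split; first by rewrite !mulr_ge0// ltW.
  rewrite -[leRHS]mul1r mulrAC ler_wpM2r ?(ltW p0)//; lra.
rewrite cos_sfrac !leNgt ltr_cos ?inpi ?c0 ?x2 ?normr_ge0//.
by rewrite ltr_pM2l// mulr_gt0.
Qed.

Lemma cos_ge_sfrac (t c : R) : 0 <= c <= 2^-1 ->
  (cos (2 * pi * c) <= cos (2 * pi * 1%:~R * t)) = (`|sfrac t| <= c).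
Proof.
move=> /andP[c0 c1]; have p0 := pi_gt0 R; have x2 := sfrac_norm t.
have inpi (z : R) : 0 <= z <= 2^-1 -> 2 * pi * z \in `[0, pi].
  move=> /andP[z0 z1]; rewrite in_itv/=; apply/andP; split; first by rewrite !mulr_ge0// ltW.
  rewrite -[leRHS]mul1r mulrAC ler_wpM2r ?(ltW p0)//; lra.
rewrite cos_sfrac !leNgt ltr_cos ?inpi ?c0 ?x2 ?normr_ge0//.
by rewrite ltr_pM2l// mulr_gt0.
Qed.

(** The sine tells the sign of sfrac t and the cosine its absolute value. *)
Lemma mulset_sfrac (c : R) : mulset [set t : R | c <= sfrac t].
Proof.
have msin : mulset [set t : R | 0 <= sin (2 * pi * 1%:~R * t)] by apply: mulset_ge; exact: multiplier_sin.
have mcos a : mulset [set t : R | cos (2 * pi * 1%:~R * t) <= a].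
  have := mulset_ge (- a) (multiplierZ (-1) (multiplier_cos R 1)).
  by congr mulset; apply/seteqP; split => t /=; rewrite mulN1r lerN2.
have mcos' a : mulset [set t : R | a <= cos (2 * pi * 1%:~R * t)].
  by apply: mulset_ge; exact: multiplier_cos.
have [c2|c2] := leP c (- 2^-1).
  rewrite (_ : [set t | _] = setT); first exact: mulsetT.
  apply/seteqP; split => // t _ /=; have /andP[h _] := sfrac_itv t; lra.
have [c3|c3] := ltP 2^-1 c.
  rewrite (_ : [set t | _] = set0); first exact: mulset0.
  apply/seteqP; split => // t /=; have /andP[_ h] := sfrac_itv t; lra.
have [c0|c0] := leP 0 c.
  have := mulsetI (mcos (cos (2 * pi * c))) msin; congr mulset.
  have c01 : 0 <= c <= 2^-1 by rewrite c0 c3.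
  apply/seteqP; split => t /=; rewrite cos_le_sfrac// sin_sfrac_ge0.
    by move=> [+ x0]; rewrite ger0_norm.
  by move=> ct; have x0 := le_trans c0 ct; rewrite ger0_norm.
have c01 : 0 <= - c <= 2^-1 by apply/andP; split; lra.
have := mulsetU (mcos' (cos (2 * pi * - c))) msin; congr mulset.
apply/seteqP; split => t /=; rewrite cos_ge_sfrac// sin_sfrac_ge0.
  move=> [|]; last by move=> ?; lra.
  by rewrite ler_norml opprK => /andP[].
move=> ct; have [x0|x0] := leP 0 (sfrac t); first by right.
by left; rewrite ltr0_norm//; lra.
Qed.

Lemma multiplier_sfrac (phi : R -> R) (M : nat) : measurable_fun setT phi ->
  (forall x, 0 <= phi x <= M%:R) -> multiplier (fun t => phi (sfrac t)).
Proof. by move=> mphi phi0; apply: multiplier_comp mphi phi0; exact: mulset_sfrac. Qed.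

Lemma weighted_geometric_bound (delta : R) : 0 < delta -> exists M, forall N,
  symsum N (fun j : int => (1 + `|j|%N%:R) * expR (- (delta * `|j|%N%:R))) <= M.
Proof.
move=> d0; pose r := expR (- (delta / 2)); pose K := 1 + 2 / delta.
have r0 : 0 < r by exact: expR_gt0.
have r1 : r < 1 by rewrite expR_lt1 oppr_lt0 divr_gt0.
have K0 : 0 < K by rewrite ltr_wpDr// ltW// divr_gt0.
have term (n : nat) : (1 + n%:R) * expR (- (delta * n%:R)) <= K * r ^+ n.
  have -> : expR (- (delta * n%:R)) = r ^+ n * r ^+ n.
    by rewrite /r -expRM_natl -expRD; congr expR; field.
  rewrite mulrA ler_wpM2r ?exprn_ge0 ?(ltW r0)//.
  have -> : r ^+ n = (expR (n%:R * (delta / 2)))^-1 by rewrite /r -expRM_natl mulrN expRN.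
  rewrite ler_pdivrMr ?expR_gt0//.
  apply: le_trans (ler_wpM2l (ltW K0) (expR_ge1Dx _)).
  have -> : K * (1 + n%:R * (delta / 2)) = 1 + n%:R * (delta / 2) + 2 / delta + n%:R.
    by rewrite /K; field; rewrite gt_eqF.
  by rewrite lerD2r -addrA lerDl addr_ge0 ?mulr_ge0 ?invr_ge0 ?divr_ge0// ltW.
have geo N : \sum_(n < N) r ^+ n.+1 <= (1 - r)^-1.
  suff -> : \sum_(n < N) r ^+ n.+1 = r * (1 - r ^+ N) / (1 - r).
    rewrite -[leRHS]mul1r ler_wpM2r ?invr_ge0 ?subr_ge0 ?(ltW r1)//.
    by rewrite mulr_ile1 ?(ltW r0) ?(ltW r1)// ?subr_ge0 ?exprn_ile1 ?(ltW r0) ?(ltW r1)// gerBl exprn_ge0// ltW.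
  elim: N => [|N ih]; first by rewrite big_ord0 expr0 subrr mulr0 mul0r.
  by rewrite big_ord_recr/= ih exprS; field; rewrite subr_eq0 gt_eqF.
exists (K + 2 * (K * (1 - r)^-1)) => N; rewrite /symsum; apply: lerD.
  by have := term 0%N; rewrite absz0 expr0 mulr1.
apply: (@le_trans _ _ (\sum_(n < N) 2 * (K * r ^+ n.+1))).
  apply: ler_sum => n _; rewrite abszN absz_nat mulr_natl mulr2n.
  by apply: lerD; exact: term.
by rewrite -mulr_sumr -mulr_sumr ler_wpM2l// ler_wpM2l// ltW.
Qed.

Lemma ae_eq_of_integrals (D : set R) (f g : R -> R) : measurable D ->
  measurable_fun setT f -> measurable_fun setT g ->
  integ (fun t => f t * \1_D t) -> integ (fun t => g t * \1_D t) ->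
  (forall E, E `<=` D -> measurable E ->
    \int[mu]_t (f t * \1_E t) = \int[mu]_t (g t * \1_E t)) ->
  {ae mu, forall t, D t -> f t = g t}.
Proof.
move=> mD mf mg iF iG h.
have ind (u : R -> R) (A : set R) (t : R) : ((EFin \o u) \_ A) t = (u t * \1_A t)%:E.
  by rewrite patchE indicE; case: ifP => _ /=; rewrite ?mulr1 ?mulr0.
have intD (u : R -> R) : integ (fun t => u t * \1_D t) -> mu.-integrable D (EFin \o u).
  move=> iu; apply/integrable_mkcond => //.
  rewrite (_ : (EFin \o u) \_ D = EFin \o (fun t => u t * \1_D t))//.
  by apply/funext => t; rewrite ind.
have intE (u : R -> R) E : E `<=` D -> measurable E -> integ (fun t => u t * \1_D t) ->
    (\int[mu]_(t in E) (EFin \o u) t = (\int[mu]_t (u t * \1_E t))%:E)%E.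
  move=> ED mE iu; rewrite /Rintegral.
  have -> : (\int[mu]_t (u t * \1_E t)%:E = \int[mu]_(t in E) (EFin \o u) t)%E.
    by rewrite [RHS]integral_mkcond; apply: eq_integral => t _; rewrite ind.
  rewrite fineK//; apply: integrable_fin_num => //.
  by apply: integrableS (intD _ iu).
have H : ae_eq mu D (EFin \o f) (EFin \o g).
  apply: integral_ae_eq => //; first exact: intD.
    by apply/measurable_EFinP; exact: measurable_funTS.
  by move=> E ED mE; rewrite !intE// h.
move: H; apply: (@filterS _ _ (ae_filter_ringOfSetsType mu)) => t + Dt.
by move=> /(_ Dt) [].
Qed.

Lemma integ_unit (l : int) : integ (fun t : R => (nint t == l)%:R).
Proof.
apply: (integ_le (measurable_nint (fun z => (z == l)%:R)) (integZ (1 + (`|l%:~R| + 1) ^+ 2) (integ_oneDsqr R))) => t.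
rewrite ger0_norm// ler_pdivlMr ?(lt_le_trans _ (oneDsqr_ge1 t))//.
case: eqP => [kl|_]; last by rewrite mul0r addr_ge0// sqr_ge0.
rewrite mul1r /oneDsqr lerD2l -real_normK ?num_real// ler_sqr ?nnegrE ?addr_ge0//.
rewrite (sfrac_nint t) kl (le_trans (ler_normD _ _))// addrC lerD2l.
by apply: le_trans (sfrac_norm t) _; lra.
Qed.

Lemma int_unit_cos (r l : int) :
  integ (fun t : R => (nint t == l)%:R * cos (2 * pi * r%:~R * t)) /\
  \int[mu]_t ((nint t == l)%:R * cos (2 * pi * r%:~R * t)) = (r == 0)%:R.
Proof.
have E t : (nint t == l)%:R * cos (2 * pi * r%:~R * t) =
   ((fun t : R => cos (2 * pi * r%:~R * t)) \_ `](l%:~R - 2^-1), (l%:~R + 2^-1)]) t.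
  rewrite patchE; case: ifPn => [/set_mem|/negP].
    by rewrite /= in_itv/= -nintE => ->; rewrite mul1r.
  by rewrite inE /= in_itv/= -nintE => /negP/negbTE ->; rewrite mul0r.
have ic := continuous_integrable_itv (l%:~R - 2^-1) (l%:~R + 2^-1) (@continuous_cosZ R (2 * pi * r%:~R)).
have ic' : mu.-integrable `](l%:~R - 2^-1), (l%:~R + 2^-1)] (EFin \o (fun t : R => cos (2 * pi * r%:~R * t))).
  by apply: integrableS ic => //; exact: subset_itv_oc_cc.
split.
  exact: (integ_mul_bounded (integ_unit l) (measurable_cosZ _) (fun t => cos_max _)).
under eq_Rintegral do rewrite E.
by rewrite -Rintegral_mkcond Rintegral_itv_obnd_cbnd// integral_cos.
Qed.

Lemma int_unit_sin (r l : int) :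
  integ (fun t : R => (nint t == l)%:R * sin (2 * pi * r%:~R * t)) /\
  \int[mu]_t ((nint t == l)%:R * sin (2 * pi * r%:~R * t)) = 0.
Proof.
have E t : (nint t == l)%:R * sin (2 * pi * r%:~R * t) =
   ((fun t : R => sin (2 * pi * r%:~R * t)) \_ `](l%:~R - 2^-1), (l%:~R + 2^-1)]) t.
  rewrite patchE; case: ifPn => [/set_mem|/negP].
    by rewrite /= in_itv/= -nintE => ->; rewrite mul1r.
  by rewrite inE /= in_itv/= -nintE => /negP/negbTE ->; rewrite mul0r.
have ic := continuous_integrable_itv (l%:~R - 2^-1) (l%:~R + 2^-1) (@continuous_sinZ R (2 * pi * r%:~R)).
have ic' : mu.-integrable `](l%:~R - 2^-1), (l%:~R + 2^-1)] (EFin \o (fun t : R => sin (2 * pi * r%:~R * t))).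
  by apply: integrableS ic => //; exact: subset_itv_oc_cc.
split.
  exact: (integ_mul_bounded (integ_unit l) (measurable_sinZ _) (fun t => sin_max _)).
under eq_Rintegral do rewrite E.
by rewrite -Rintegral_mkcond Rintegral_itv_obnd_cbnd// integral_sin.
Qed.

(** The hypothesis says that H1 + i H2 has vanishing Fourier coefficients;
    using it at n and at -n separates H1 from H2. *)
Lemma fourier_null_pair (H1 H2 : R -> R) : integ H1 -> integ H2 ->
  (forall n : int,
    \int[mu]_t (H1 t * cos (2 * pi * n%:~R * t) + H2 t * sin (2 * pi * n%:~R * t)) = 0 /\
    \int[mu]_t (H2 t * cos (2 * pi * n%:~R * t) - H1 t * sin (2 * pi * n%:~R * t)) = 0) ->
  fourier_null H1 /\ fourier_null H2.
Proof.
move=> i1 i2 h.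
have eqs n : \int[mu]_t (H1 t * cos (2 * pi * n%:~R * t)) + \int[mu]_t (H2 t * sin (2 * pi * n%:~R * t)) = 0 /\
   \int[mu]_t (H2 t * cos (2 * pi * n%:~R * t)) - \int[mu]_t (H1 t * sin (2 * pi * n%:~R * t)) = 0.
  have [h1 h2] := h n; split.
    by rewrite -RintegralD//; [exact: integ_cos|exact: integ_sin].
  by rewrite -RintegralB//; [exact: integ_cos|exact: integ_sin].
have ec (H : R -> R) n : \int[mu]_t (H t * cos (2 * pi * (- n)%:~R * t)) = \int[mu]_t (H t * cos (2 * pi * n%:~R * t)).
  by apply: eq_Rintegral => t _; rewrite rmorphN/= mulrN mulNr cosN.
have es (H : R -> R) n : integ H -> \int[mu]_t (H t * sin (2 * pi * (- n)%:~R * t)) = - \int[mu]_t (H t * sin (2 * pi * n%:~R * t)).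
  move=> iH; rewrite -[RHS]mulN1r -RintegralZl//; last exact: integ_sin.
  by apply: eq_Rintegral => t _; rewrite rmorphN/= mulrN mulNr sinN mulrN mulN1r.
have all n : [/\ \int[mu]_t (H1 t * cos (2 * pi * n%:~R * t)) = 0, \int[mu]_t (H1 t * sin (2 * pi * n%:~R * t)) = 0,
    \int[mu]_t (H2 t * cos (2 * pi * n%:~R * t)) = 0 & \int[mu]_t (H2 t * sin (2 * pi * n%:~R * t)) = 0].
  have [a1 a2] := eqs n; have := eqs (- n); rewrite !ec !es// => -[b1 b2].
  by split; lra.
by split; split=> // n; have [] := all n.
Qed.

Section orthogonal.
Variables (h : R -> R[i]) (l0 : int * int).
Hypothesis hh : inL2 h.
Hypothesis orth : forall k, k <> l0 -> dotL2 h (gabor k) = 0.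

Let C := dotL2 h (gabor l0).
Let G1 (t : R) := RE C * cos (2 * pi * l0.2%:~R * t) - IM C * sin (2 * pi * l0.2%:~R * t).
Let G2 (t : R) := RE C * sin (2 * pi * l0.2%:~R * t) + IM C * cos (2 * pi * l0.2%:~R * t).

Let integ_h_gauss (m : int) : integ (fun t => RE (h t) * gauss (t - m%:~R)) /\
  integ (fun t => IM (h t) * gauss (t - m%:~R)).
Proof.
have igs2 : integ (fun t : R => gauss (t - m%:~R) ^+ 2).
  apply: (integ_le _ (integ_gauss R m)); first by apply: measurable_funX; exact: measurable_gauss.
  move=> t; rewrite ger0_norm ?sqr_ge0// expr2 ler_piMl ?gauss_ge0//.
  by rewrite /gauss expR_le1 mulNr oppr_le0 mulr_ge0 ?sqr_ge0 ?pi_ge0.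
split; apply: integ_prod => //; try exact: measurable_gauss.
- exact: inL2_mRE.
- exact: inL2_sqRE.
- exact: inL2_mIM.
- exact: inL2_sqIM.
Qed.

Let integ_G (l : int) : integ (fun t => (nint t == l)%:R * G1 t) /\
  integ (fun t => (nint t == l)%:R * G2 t).
Proof.
have [ic _] := int_unit_cos l0.2 l; have [is_ _] := int_unit_sin l0.2 l.
split.
  by apply: eq_integ (integB (integZ (RE C) ic) (integZ (IM C) is_)) => t; rewrite /G1; ring.
by apply: eq_integ (integD (integZ (RE C) is_) (integZ (IM C) ic)) => t; rewrite /G2; ring.
Qed.

Let H1 (l m : int) t := RE (h t) * gauss (t - m%:~R) - (m == l0.1)%:R * ((nint t == l)%:R * G1 t).
Let H2 (l m : int) t := IM (h t) * gauss (t - m%:~R) - (m == l0.1)%:R * ((nint t == l)%:R * G2 t).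

Let fourier_null_H l m : fourier_null (H1 l m) /\ fourier_null (H2 l m).
Proof.
have [ih1 ih2] := integ_h_gauss m; have [iG1 iG2] := integ_G l.
apply: fourier_null_pair; [exact/integB/integZ|exact/integB/integZ|move=> n].
have hg := inL2_gabor R (m, n); have hig := inL2_scl 'i hg.
have [ic vc] := int_unit_cos (l0.2 - n) l; have [is_ vs] := int_unit_sin (l0.2 - n) l.
have i1 := integ_cip hh hg; have i2 := integ_cip hh hig.
have dotE : dotL2 h (gabor (m, n)) = C * ((m == l0.1) && (l0.2 - n == 0))%:R.
  have [e|ne] := eqVneq (m, n) l0; first by rewrite /C -e /= subrr !eqxx mulr1.
  rewrite orth; last exact/eqP.
  rewrite subr_eq0 [l0.2 == n]eq_sym; move: ne; rewrite -[(m, n) == l0]/((m == l0.1) && (n == l0.2)).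
  by move=> /negbTE ->; rewrite mulr0.
have R1 : ip h (gabor (m, n)) = RE C * ((m == l0.1) && (l0.2 - n == 0))%:R.
  by move: dotE; rewrite dotL2E => /(congr1 RE); rewrite REE => ->; case: (_ && _); rewrite ?mulr1 ?mulr0.
have R2 : ip h (scl 'i (gabor (m, n))) = IM C * ((m == l0.1) && (l0.2 - n == 0))%:R.
  by move: dotE; rewrite dotL2E => /(congr1 IM); rewrite IME => ->; case: (_ && _); rewrite ?mulr1 ?mulr0.
have e2 (t : R) : 2 * pi * (l0.2 - n)%:~R * t = 2 * pi * l0.2%:~R * t - 2 * pi * n%:~R * t.
  by rewrite rmorphB/=; ring.
split.
  transitivity (\int[mu]_t (cip h (gabor (m, n)) t -
    ((m == l0.1)%:R * RE C * ((nint t == l)%:R * cos (2 * pi * (l0.2 - n)%:~R * t)) -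
     (m == l0.1)%:R * IM C * ((nint t == l)%:R * sin (2 * pi * (l0.2 - n)%:~R * t))))).
    apply: eq_Rintegral => t _; rewrite /H1 /H2 /cip /G1 /G2 e2 cosB sinB gaborE !ReImE /=; ring.
  rewrite RintegralB//; last by apply: integB; exact: integZ.
  rewrite RintegralB//; try exact: integZ.
  rewrite !RintegralZl// vc vs -/(ip h (gabor (m, n))) R1.
  by case: (m == l0.1); case: (_ == 0); rewrite /=; ring.
transitivity (\int[mu]_t (cip h (scl 'i (gabor (m, n))) t -
    ((m == l0.1)%:R * RE C * ((nint t == l)%:R * sin (2 * pi * (l0.2 - n)%:~R * t)) +
     (m == l0.1)%:R * IM C * ((nint t == l)%:R * cos (2 * pi * (l0.2 - n)%:~R * t))))).
  apply: eq_Rintegral => t _; rewrite /H1 /H2 /cip /scl /G1 /G2 e2 cosB sinB gaborE !ReImE /=; ring.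
rewrite RintegralB//; last by apply: integD; exact: integZ.
rewrite (RintegralD measurableT (integZ _ is_) (integZ _ ic)).
rewrite !RintegralZl// vc vs -/(ip h (scl 'i (gabor (m, n)))) R2.
by case: (m == l0.1); case: (_ == 0); rewrite /=; ring.
Qed.

Let pairing l m p : multiplier p ->
  \int[mu]_t (RE (h t) * gauss (t - m%:~R) * p t) =
    (m == l0.1)%:R * \int[mu]_t ((nint t == l)%:R * G1 t * p t) /\
  \int[mu]_t (IM (h t) * gauss (t - m%:~R) * p t) =
    (m == l0.1)%:R * \int[mu]_t ((nint t == l)%:R * G2 t * p t).
Proof.
move=> hp; have [mp [M hM] zp] := hp.
have [ih1 ih2] := integ_h_gauss m; have [iG1 iG2] := integ_G l.
have [z1 z2] := fourier_null_H l m.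
have z (H : R -> R) : fourier_null H -> \int[mu]_t (H t * p t) = 0.
  move=> /zp [_ /(_ 0) [+ _]].
  by under eq_Rintegral do rewrite mulr0 mul0r cos0 mulr1.
have gen (u v : R -> R) (c : R) : integ u -> integ v ->
    \int[mu]_t ((u t - c * v t) * p t) = 0 -> \int[mu]_t (u t * p t) = c * \int[mu]_t (v t * p t).
  move=> iu iv; under eq_Rintegral do rewrite mulrBl -mulrA.
  have iup := integ_mul_bounded iu mp hM; have ivp := integ_mul_bounded iv mp hM.
  rewrite (RintegralB measurableT iup (integZ c ivp)) RintegralZl// => /eqP.
  by rewrite subr_eq0 => /eqP.
by split; [exact: (gen _ _ _ ih1 iG1 (z _ z1))|exact: (gen _ _ _ ih2 iG2 (z _ z2))].
Qed.

(** The coefficients of h against the atoms gabor (m, n), for all n, are the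
    Fourier coefficients of h times the shifted Gaussian. For m other than
    l0.1 they all vanish; for m = l0.1 only one remains, as for C phase
    restricted to a unit cell. Any cell l will do, since only the
    periodization matters. *)
Lemma orthogonal_pairing l m p : multiplier p ->
  \int[mu]_t (RE (h t) * gauss (t - m%:~R) * p t) =
    (m == l0.1)%:R * \int[mu]_t ((nint t == l)%:R * RE (C * phase l0.2 t) * p t) /\
  \int[mu]_t (IM (h t) * gauss (t - m%:~R) * p t) =
    (m == l0.1)%:R * \int[mu]_t ((nint t == l)%:R * IM (C * phase l0.2 t) * p t).
Proof.
move=> hp; rewrite !(pairing l m hp).1 !(pairing l m hp).2.
by split; congr (_ * _); apply: eq_Rintegral => t _; rewrite ReImE.
Qed.

Lemma integ_orthogonal (m : int) : integ (fun t => RE (h t) * gauss (t - m%:~R)) /\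
  integ (fun t => IM (h t) * gauss (t - m%:~R)).
Proof. exact: integ_h_gauss. Qed.

End orthogonal.

Lemma symsumZ N (c : R) (a : int -> R) : symsum N (fun k => c * a k) = c * symsum N a.
Proof.
by rewrite /symsum mulrDr mulr_sumr; congr (_ + _); apply: eq_bigr => k _; rewrite mulrDr.
Qed.

Lemma ler_norm_symsum N (a b : int -> R) : (forall k, `|a k| <= b k) ->
  `|symsum N a| <= symsum N b.
Proof.
move=> ab; rewrite /symsum (le_trans (ler_normD _ _))// lerD// (le_trans (ler_norm_sum _ _ _))//.
by apply: ler_sum => k _; rewrite (le_trans (ler_normD _ _))// lerD.
Qed.

Lemma integ_invD : integ (fun t : R => (1 + `|t|)^-1 ^+ 2) /\
  measurable_fun setT (fun t : R => (1 + `|t|)^-1).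
Proof.
have mi : measurable_fun setT (fun t : R => (1 + `|t|)^-1).
  apply: continuous_measurable_fun => t; apply: cvgV.
    by rewrite gt_eqF// ltr_wpDr.
  by apply: cvgD; [exact: cvg_cst|exact: norm_continuous].
split=> //; apply: (integ_le _ (integ_oneDsqr R)); first exact: measurable_funX.
move=> t; have p0 : 0 < 1 + `|t| by rewrite ltr_wpDr.
have q0 : 0 < oneDsqr t by rewrite (lt_le_trans _ (oneDsqr_ge1 t)).
rewrite ger0_norm ?sqr_ge0// exprVn lef_pV2 ?posrE ?exprn_gt0//.
rewrite /oneDsqr -[t ^+ 2]real_normK ?num_real//; have := normr_ge0 t; set a := `|t|; lra.
Qed.

End orthogonality_relations.

Section local_identity.
Variable R : realType.
Local Notation pi := (@pi R).
Local Notation alt_tail := (@alt_tail R).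
Local Notation dual_window := (@dual_window R).
Local Notation mu := (@lebesgue_measure R).

(** With p j t = alt_tail |j| e^(pi (x + j)^2) on the part of the cells
    congruent to E, where x = sfrac t, the series over j of p j t times the
    Gaussian centred at l - j is, up to a factor, the series dual_sum (l -
    nint t). Hence it sums to theta_cst on E and to 0 elsewhere. Each p j is a
    periodic multiplier, so only j = l - a contributes to the integral against
    hi, and it contributes the dual window centred at a. *)
Lemma cell_identity (hi Gi : R -> R) (a l : int) (eps : R) (E : set R) :
  measurable_fun setT hi -> integ (fun t => hi t ^+ 2) ->
  (forall m, integ (fun t => hi t * gauss (t - m%:~R))) ->
  (forall m p, multiplier p -> \int[mu]_t (hi t * gauss (t - m%:~R) * p t) =
     (m == a)%:R * \int[mu]_t ((nint t == l)%:R * Gi t * p t)) ->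
  0 < eps -> measurable E ->
  (forall t, E t -> nint t = l /\ `|sfrac t| <= 2^-1 - eps) ->
  \int[mu]_t (theta_cst R * hi t * \1_E t) = \int[mu]_t (Gi t * dual_window (t - a%:~R) * \1_E t).
Proof.
move=> mh ih2 ihg pairing eps0 mE ED.
(* the set E moved to the unit cell around 0 *)
pose B := [set x : R | E (x + l%:~R)].
have mB : measurable B.
  rewrite -[B]setTI; have : measurable_fun setT (fun x : R => x + l%:~R) by exact: measurable_funD.
  exact.
have hB x : B x -> nint x = 0 /\ `|x| <= 2^-1 - eps.
  move=> /ED [+ +]; rewrite nintD sfracD => /eqP; rewrite -subr_eq0 addrK => /eqP k0.
  by rewrite /sfrac k0 subr0.
pose phi (j : int) (x : R) : R := expR (pi * (x + j%:~R) ^+ 2) * \1_B x.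
have phi_b j : exists M : nat, forall x, 0 <= phi j x <= M%:R.
  exists (Num.bound (expR (pi * (1 + `|j%:~R|) ^+ 2))) => x.
  rewrite /phi mulr_ge0 ?expR_ge0//=.
  apply: le_trans (ltW (archi_boundP (expR_ge0 _))).
  rewrite indicE; case: (boolP (x \in B)) => [/set_mem/hB [_ xb]|_]; last by rewrite mulr0 expR_ge0.
  rewrite mulr1 ler_expR ler_wpM2l ?pi_ge0// -real_normK ?num_real// ler_sqr ?nnegrE ?addr_ge0//.
  by rewrite (le_trans (ler_normD _ _))// lerD2r; lra.
have mphi j : measurable_fun setT (phi j).
  apply: measurable_funM; last exact: measurable_indic.
  apply: measurableT_comp; first exact: measurable_expR.
  apply: measurable_funM; first exact: measurable_cst.
  by apply: measurable_funX; apply: measurable_funD.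
pose pj (j : int) (t : R) : R := alt_tail `|j| * phi j (sfrac t).
have hpj j : multiplier (pj j).
  by apply: multiplierZ; have [M hM] := phi_b j; exact: multiplier_sfrac hM.
pose psi (N : nat) (t : R) : R := symsum N (fun j => pj j t * gauss (t - (l - j)%:~R)).
have psiE N t : psi N t = \1_B (sfrac t) *
    expR (2 * pi * (l - nint t)%:~R * sfrac t - pi * (l - nint t)%:~R ^+ 2) * dual_sum (l - nint t)%:~R N.
  rewrite /psi /dual_sum -symsumZ; apply: eq_symsum => j.
  rewrite /pj /phi /gauss mulrCA.
  transitivity (\1_B (sfrac t) * alt_tail `|j| *
    (expR (pi * (sfrac t + j%:~R) ^+ 2) * expR (- pi * (t - (l - j)%:~R) ^+ 2))); first by ring.
  transitivity (\1_B (sfrac t) * alt_tail `|j| *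
    (expR (2 * pi * (l - nint t)%:~R * sfrac t - pi * (l - nint t)%:~R ^+ 2) *
     expR (2 * pi * (l - nint t)%:~R * j%:~R))); last by ring.
  rewrite -!expRD; congr (_ * expR _).
  by rewrite {2}(sfrac_nint t) !rmorphB/=; ring.
have psi_cvg t : psi ^~ t @ \oo --> theta_cst R * \1_E t.
  have -> : theta_cst R * \1_E t = \1_B (sfrac t) *
    expR (2 * pi * (l - nint t)%:~R * sfrac t - pi * (l - nint t)%:~R ^+ 2) * (theta_cst R * (l - nint t == 0)%:R).
    have [e|ne] := eqVneq (l - nint t) 0.
      rewrite e !mulr0 mul0r expr0n mulr0 subr0 expR0 !mulr1 mulrC; congr (_ * _).
      have kl : nint t = l by apply/esym/eqP; rewrite -subr_eq0 e.
      rewrite !indicE; congr (_%:R); apply: congr1.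
      by apply/idP/idP => /set_mem h; apply/mem_set; move: h; rewrite /B /= /sfrac kl subrK.
    rewrite !mulr0 indicE memNset ?mulr0// => /ED [kl _].
    by move: ne; rewrite kl subrr eqxx.
  under eq_fun do rewrite psiE.
  by apply: cvgM; [exact: cvg_cst|exact: dual_sum_cvg].
have d0 : 0 < 2 * pi * eps by rewrite !mulr_gt0// pi_gt0.
have [M hM] := weighted_geometric_bound d0.
have mpsi N : measurable_fun setT (psi N).
  apply: measurable_funD.
    by apply: measurable_funM; [apply hpj|exact: measurable_gauss].
  apply: measurable_sum => k; apply: measurable_funD;
    by apply: measurable_funM; [apply hpj|exact: measurable_gauss].
pose K := 2 * (1 + `|l%:~R|) * M.
have psi_b N t : `|psi N t| <= K * (1 + `|t|)^-1.
  rewrite ler_pdivlMr ?ltr_wpDr// mulrC -{1}[1 + `|t|]ger0_norm ?addr_ge0// -normrM -symsumZ.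
  apply: (@le_trans _ _ (2 * (1 + `|l%:~R|) *
     symsum N (fun j : int => (1 + `|j|%N%:R) * expR (- (2 * pi * eps * `|j|%N%:R))))); last first.
    by rewrite ler_wpM2l// mulr_ge0// addr_ge0.
  rewrite -symsumZ; apply: ler_norm_symsum => j.
  rewrite mulrCA normrM [`|_ * gauss _|]ger0_norm ?mulr_ge0 ?addr_ge0 ?gauss_ge0// mulrC.
  rewrite mulrA; apply: ler_pM; rewrite ?normr_ge0 ?mulr_ge0 ?addr_ge0 ?gauss_ge0//.
    rewrite mulrC (le_trans (gauss_bound _ _))// -mulrA ler_wpM2l// -normr_absz.
    have := ler_normB (l%:~R : R) j%:~R; rewrite -rmorphB/= => hl.
    have := normr_ge0 (l%:~R : R); have := normr_ge0 (j%:~R : R).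
    move: hl; set x := `|l%:~R|; set y := `|j%:~R| => hl y0 x0.
    have := mulr_ge0 x0 y0; lra.
  rewrite /pj /phi indicE; case: (boolP (sfrac t \in B)) => [/set_mem/hB [_ xb]|_]; last first.
    by rewrite !mulr0 normr0 expR_ge0.
  rewrite mulr1 mulrC.
  apply: (le_trans (cell_dual_decay j (sfrac_norm t))); rewrite ler_expR lerN2 ler_wpM2r//.
  rewrite ler_wpM2l ?mulr_ge0 ?pi_ge0//; lra.
have [iinv minv] := integ_invD R.
have M0 : 0 <= K by have := psi_b 0%N 0; rewrite normr0 addr0 invr1 mulr1; apply: le_trans.
have idom : integ (fun t => K * `|hi t * (1 + `|t|)^-1|).
  by apply: integZ; apply: integ_abs; exact: integ_prod.
have [n|t|n t|_ lim] := @dominated_cvg R (fun N t => hi t * psi N t) (fun t => hi t * (theta_cst R * \1_E t)) _ _ _ idom.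
- exact: measurable_funM.
- by apply: cvgM; [exact: cvg_cst|exact: psi_cvg].
- rewrite normrM [leRHS]mulrC normrM -mulrA ler_wpM2l// mulrC.
  by rewrite [`|_^-1|]ger0_norm ?invr_ge0 ?addr_ge0.
have intE N : \int[mu]_t (hi t * psi N t) =
    (\int[mu]_t ((nint t == l)%:R * Gi t * pj (l - a) t)) * (`|l - a| <= N)%N%:R.
  transitivity (symsum N (fun j => \int[mu]_t (hi t * gauss (t - (l - j)%:~R) * pj j t))).
    rewrite -(Rintegral_symsum N _).2; last first.
      by move=> j; have [mp [M' hM'] _] := hpj j; exact: (integ_mul_bounded (ihg _) mp hM').
    by apply: eq_Rintegral => t _; rewrite /psi -symsumZ; apply: eq_symsum => j; ring.
  rewrite -(symsum_delta N (fun j => \int[mu]_t ((nint t == l)%:R * Gi t * pj j t))).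
  apply: eq_symsum => j; rewrite pairing// mulrC; congr (_ * _%:R).
  by congr nat_of_bool; apply/eqP/eqP => [<-|->]; rewrite opprB addrC subrK.
have lim2 : \int[mu]_t (hi t * psi N t) @[N --> \oo] -->
    \int[mu]_t ((nint t == l)%:R * Gi t * pj (l - a) t).
  apply: cvg_near_cst; exists `|l - a|%N => // N /= hN.
  by rewrite intE hN mulr1.
transitivity (\int[mu]_t (hi t * (theta_cst R * \1_E t))).
  by apply: eq_Rintegral => t _; rewrite mulrCA mulrA.
rewrite (cvg_unique _ lim lim2)//; apply: eq_Rintegral => t _.
rewrite /pj /phi /dual_window nintB.
have [kl|kl] := eqVneq (nint t) l; last first.
  rewrite !mul0r indicE memNset ?mulr0// => /ED [kl' _].
  by rewrite kl' eqxx in kl.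
rewrite mul1r kl -mulrA; congr (_ * _).
rewrite mulrCA mulrA; congr (_ * _ * _).
  by rewrite [t in RHS](sfrac_nint t) kl rmorphB/=; congr expR; ring.
rewrite !indicE; congr (_%:R); apply: congr1.
by apply/idP/idP => /set_mem h; apply/mem_set; move: h; rewrite /B /= /sfrac kl subrK.
Qed.

End local_identity.

Section global_identity.
Variable R : realType.
Local Notation pi := (@pi R).
Local Notation dual_window := (@dual_window R).
Local Notation mu := (@lebesgue_measure R).

Lemma ae_sfrac_lt_half : {ae mu, forall t : R, `|sfrac t| < 2^-1}.
Proof.
have cA : countable (range (fun z : int => z%:~R + 2^-1 : R)).
  by apply: sub_countable (card_image_le _ _) _; exact: countableP.
have N : mu.-negligible (range (fun z : int => z%:~R + 2^-1 : R)).
  exists (range (fun z : int => z%:~R + 2^-1 : R)); split => //.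
    exact: countable_measurable.
  exact: countable_lebesgue_measure0.
apply: negligibleS N => t /= /negP; rewrite -leNgt => ht.
exists (nint t) => //; rewrite [RHS]sfrac_nint addrC; congr (_ + _).
have /andP[x1 x2] := sfrac_itv t; apply/eqP; rewrite eq_le x2 andbT.
by move: ht; rewrite ler_normr => /orP[//|]; lra.
Qed.

(** The sets D (l, n), which keep away from the half-integers, cover all
    points but countably many. *)
Lemma pointwise_identity (hi Gi : R -> R) (a : int) (K : R) :
  measurable_fun setT hi -> integ (fun t => hi t ^+ 2) ->
  (forall m, integ (fun t => hi t * gauss (t - m%:~R))) ->
  measurable_fun setT Gi -> (forall t, `|Gi t| <= K) ->
  (forall l m p, multiplier p -> \int[mu]_t (hi t * gauss (t - m%:~R) * p t) =
     (m == a)%:R * \int[mu]_t ((nint t == l)%:R * Gi t * p t)) ->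
  {ae mu, forall t, theta_cst R * hi t = Gi t * dual_window (t - a%:~R)}.
Proof.
move=> mh ih2 ihg mG GK pairing.
pose e (n : nat) : R := n.+3%:R^-1.
have e0 n : 0 < e n by rewrite invr_gt0.
(* a closed interval well inside the cell i.1, at distance e i.2 from its ends *)
pose D (i : int * nat) : set R := `[i.1%:~R - (2^-1 - e i.2), i.1%:~R + (2^-1 - e i.2)]%classic.
have DP i t : D i t -> nint t = i.1 /\ `|sfrac t| <= 2^-1 - e i.2.
  rewrite /D /= in_itv/= => /andP[t1 t2].
  have kt : nint t = i.1 by apply/eqP; rewrite nintE; have := e0 i.2; move=> ?; apply/andP; split; lra.
  by split=> //; rewrite /sfrac kt ler_norml; apply/andP; split; lra.
have aeD (i : int * nat) : {ae mu, forall t, D i t -> theta_cst R * hi t = Gi t * dual_window (t - a%:~R)}.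
  have mD : measurable (D i) by exact: measurable_itv.
  have mgG : measurable_fun setT (fun t => Gi t * dual_window (t - a%:~R)).
    by apply: measurable_funM => //; exact: measurable_dual_window.
  have iD : integ (fun t => \1_(D i) t).
    apply: (integ_le _ (integ_unit R i.1)); first exact: measurable_indic.
    move=> t; rewrite indicE ger0_norm//.
    by case: (boolP (t \in D i)) => // /set_mem/DP [-> _]; rewrite eqxx.
  apply: ae_eq_of_integrals => //.
  - exact: measurable_funM.
  - apply: integ_prod => //; first exact: measurable_funM.
    + by apply: eq_integ (integZ (theta_cst R ^+ 2) ih2) => t; rewrite exprMn.
    + apply: eq_integ iD => t; rewrite indicE; by case: (t \in D i); rewrite ?expr1n ?expr0n.
  - apply: (@eq_integ _ (fun t => \1_(D i) t * (Gi t * dual_window (t - a%:~R)))); first by move=> t; rewrite mulrC.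
    apply: (@integ_mul_bounded _ _ _ K) => // t.
    rewrite normrM -[leRHS]mulr1; apply: ler_pM => //; exact: dual_window_le1.
  - move=> E ED mE; apply: (cell_identity mh ih2 ihg (pairing i.1) (e0 i.2)) => // t /ED; exact: DP.
have aeall : {ae mu, forall t, forall i : nat,
    D (odflt (0, 0%N) (unpickle i)) t -> theta_cst R * hi t = Gi t * dual_window (t - a%:~R)}.
  by apply/ae_foralln => i; exact: aeD.
have := ae_sfrac_lt_half; move: aeall.
apply: (@filterS2 _ _ (ae_filter_ringOfSetsType mu)) => t ht xt.
pose d := 2^-1 - `|sfrac t|; have d0 : 0 < d by rewrite subr_gt0.
pose n := Num.bound d^-1.
apply: (ht (pickle (nint t, n))); rewrite pickleK /D /= in_itv/=.
have en : e n <= d.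
  rewrite /e -[leRHS]invrK lef_pV2 ?posrE ?invr_gt0//.
  have := archi_boundP (ltW _ : 0 <= d^-1); rewrite invr_gt0 => /(_ d0) /ltW.
  by move=> /le_trans; apply; rewrite ler_nat -/n -addn3 leq_addr.
have : `|sfrac t| <= 2^-1 - e n by rewrite /d in en; lra.
rewrite ler_norml => /andP[x1 x2]; rewrite /sfrac in x1 x2; apply/andP; split; lra.
Qed.

(** Dividing the pointwise identity by theta_cst shows h as a multiple of the
    dual atom. *)
Lemma orthogonal_is_dual_atom (h : R -> R[i]) (l0 : int * int) : inL2 h ->
  (forall k, k <> l0 -> dotL2 h (gabor k) = 0) ->
  exists C, eqL2 h (scl C (dual_atom l0)).
Proof.
move=> hh orth; pose C := dotL2 h (gabor l0).
have mRe : measurable_fun setT (fun t => RE (C * phase l0.2 t)).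
  apply: (eq_measurable_fun (fun t => RE C * cos (2 * pi * l0.2%:~R * t) - IM C * sin (2 * pi * l0.2%:~R * t))).
    by move=> t _; rewrite ReImE.
  apply: measurable_funB; apply: measurable_funM => //; [exact: measurable_cosZ|exact: measurable_sinZ].
have mIm : measurable_fun setT (fun t => IM (C * phase l0.2 t)).
  apply: (eq_measurable_fun (fun t => RE C * sin (2 * pi * l0.2%:~R * t) + IM C * cos (2 * pi * l0.2%:~R * t))).
    by move=> t _; rewrite ReImE.
  apply: measurable_funD; apply: measurable_funM => //; [exact: measurable_sinZ|exact: measurable_cosZ].
have nC t : normc (C * phase l0.2 t) <= normc C by rewrite normcM normc_expi mulr1.
have re_le (z : R[i]) : `|RE z| <= normc z /\ `|IM z| <= normc z.
  by split; rewrite -ler_sqr ?nnegrE ?normc_nonneg// normc_sqr real_normK ?num_real// ?lerDl ?lerDr sqr_ge0.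
have aR := @pointwise_identity (fun t => RE (h t)) _ l0.1 (normc C) (inL2_mRE hh) (inL2_sqRE hh)
  (fun m => (integ_orthogonal hh m).1) mRe (fun t => le_trans (re_le _).1 (nC t))
  (fun l m p hp => (orthogonal_pairing hh orth l m hp).1).
have aI := @pointwise_identity (fun t => IM (h t)) _ l0.1 (normc C) (inL2_mIM hh) (inL2_sqIM hh)
  (fun m => (integ_orthogonal hh m).2) mIm (fun t => le_trans (re_le _).2 (nC t))
  (fun l m p hp => (orthogonal_pairing hh orth l m hp).2).
exists (C * (psign R (l0.1 + l0.2) / theta_cst R)%:C); move: aR aI.
apply: (@filterS2 _ _ (ae_filter_ringOfSetsType mu)) => t h1 h2.
have c00 := theta_cst_gt0 R.
have E : (theta_cst R)%:C * h t = (dual_window (t - l0.1%:~R))%:C * (C * phase l0.2 t).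
  by apply: complexP; rewrite [LHS]ReImE [RHS]ReImE /= !mul0r ?subr0 ?addr0 ?h1 ?h2 mulrC.
have c0C : (theta_cst R)%:C != 0 :> R[i] by rewrite (inj_eq (@complexI R)) gt_eqF.
apply: (mulfI c0C); rewrite E /scl /dual_atom.
have -> : (psign R (l0.1 + l0.2) / theta_cst R)%:C = (psign R (l0.1 + l0.2))%:C * ((theta_cst R)%:C)^-1 :> R[i].
  by rewrite rmorphM fmorphV.
have -> : (psign R (l0.1 + l0.2) * dual_window (t - l0.1%:~R))%:C = (psign R (l0.1 + l0.2))%:C * (dual_window (t - l0.1%:~R))%:C :> R[i].
  by rewrite rmorphM.
have s2 : (psign R (l0.1 + l0.2))%:C * (psign R (l0.1 + l0.2))%:C = 1 :> R[i] by rewrite -rmorphM/= psign_sq.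
transitivity ((psign R (l0.1 + l0.2))%:C * (psign R (l0.1 + l0.2))%:C * ((dual_window (t - l0.1%:~R))%:C * (C * phase l0.2 t)) : R[i]).
  by rewrite s2 mul1r.
transitivity ((theta_cst R)%:C / (theta_cst R)%:C * ((psign R (l0.1 + l0.2))%:C * (psign R (l0.1 + l0.2))%:C * ((dual_window (t - l0.1%:~R))%:C * (C * phase l0.2 t))) : R[i]).
  by rewrite divff// mul1r.
ring.
Qed.

End global_identity.

Section not_square_integrable.
Variable R : realType.
Local Notation pi := (@pi R).
Local Notation dual_window := (@dual_window R).
Local Notation mu := (@lebesgue_measure R).

Lemma sum_nint (z : int) N : \sum_(k < N) (z == k%:Z)%:R = ((0 <= z) && (z < N%:Z))%:R :> R.
Proof.
elim: N => [|N ih]; first by rewrite big_ord0; case: ltgtP.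
rewrite big_ord_recr/= ih; case: z {ih} => n; last by rewrite addr0.
rewrite !ltz_nat eqz_nat /= ltnS [(n <= N)%N]leq_eqVlt.
by case: ltngtP => /=; rewrite ?addr0 ?add0r.
Qed.

Lemma integral_oc (a b : R) : a <= b -> integ (fun t => \1_(`]a, b]%classic) t) /\
  \int[mu]_t \1_(`]a, b]%classic) t = b - a.
Proof.
move=> ab; have e : (\int[mu]_t (\1_(`]a, b]%classic) t)%:E = (b - a)%:E)%E.
  transitivity (mu `]a, b]%classic); first by rewrite integral_indic// setIT.
  rewrite lebesgue_measure_itv/= lte_fin.
  by case: ltgtP ab => // -> _; rewrite subrr.
split; last by rewrite /Rintegral e.
apply/integrableP; split; first exact/measurable_EFinP/measurable_indic.
under eq_integral do rewrite /= ger0_norm//.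
by rewrite e ltry.
Qed.

(** On the last 1/(2 k + 1) of the cell k the window is at least e^-pi / 2 in
    modulus, so that its square dominates the harmonic series. *)
Lemma dual_window_sq_not_integrable (a : int) : ~ integ (fun t => dual_window (t - a%:~R) ^+ 2).
Proof.
move=> iF.
pose c : R := (2^-1 * expR (- pi)) ^+ 2.
have c_gt0 : 0 < c by rewrite exprn_gt0// mulr_gt0// expR_gt0.
pose r (k : nat) : R := a%:~R + (k%:R + 2^-1).
pose s (k : nat) : R := (2 * k%:R + 1)^-1.
have s0 k : 0 < s k by rewrite invr_gt0 ltr_wpDl// mulr_ge0.
have s1 k : s k <= 1 by rewrite invf_le1 ?ltr_wpDl ?mulr_ge0// lerDr mulr_ge0.
pose J k := `](r k - s k), (r k)]%classic.
have JP k t : J k t -> nint (t - a%:~R) = k%:Z /\ c <= dual_window (t - a%:~R) ^+ 2.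
  rewrite /J /r /= in_itv/= => /andP[t1 t2].
  have s1k := s1 k.
  have kt : nint (t - a%:~R) = k%:Z.
    by apply/eqP; rewrite nintE -[k%:Z%:~R]pmulrn; apply/andP; split; lra.
  split=> //; rewrite -[leRHS]real_normK ?num_real// ler_sqr ?nnegrE ?mulr_ge0 ?expR_ge0//.
  rewrite /dual_window kt absz_nat normrM [`|expR _|]ger0_norm ?expR_ge0//.
  apply: (le_trans _ (ler_wpM2l (expR_ge0 _) (norm_alt_tail_ge R k))).
  rewrite /gauss_half /gauss mulrA -expRD mulrC ler_wpM2r// ler_expR.
  have p0 := pi_gt0 R.
  set y := t - a%:~R; set z : R := k%:R + 2^-1.
  have z0 : 0 < z by rewrite /z ltr_wpDl.
  have yz : 0 <= z - y <= s k by apply/andP; rewrite /y /z; split; lra.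
  have zs : 2 * z * s k = 1 by rewrite /z /s mulrDr mulfV ?divff// ?mulfV// gt_eqF// ltr_wpDl// mulr_ge0.
  have h : -1 <= y ^+ 2 - z ^+ 2.
    move/andP: yz => [y1 y2]; have := ler_wpM2l (ltW z0) y2; have := sqr_ge0 (z - y); lra.
  have := ler_wpM2l (ltW p0) h; lra.
have h N : integ (fun t => \sum_(k < N) \1_(J k) t) /\
    \int[mu]_t (\sum_(k < N) \1_(J k) t) = \sum_(k < N) s k.
  elim: N => [|N [ih1 ih2]].
    split; first by apply: eq_integ (integ0 R) => t; rewrite big_ord0.
    under eq_Rintegral do rewrite big_ord0.
    by rewrite big_ord0 /Rintegral integral0.
  have [j1 j2] := @integral_oc (r N - s N) (r N) ltac:(by rewrite gerBl ltW).
  split; first by apply: eq_integ (integD ih1 j1) => t; rewrite big_ord_recr.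
  under eq_Rintegral do rewrite big_ord_recr/=.
  by rewrite (RintegralD measurableT ih1 j1) ih2 j2 big_ord_recr/=; congr (_ + _); ring.
pose I := \int[mu]_t (dual_window (t - a%:~R) ^+ 2).
have bound N : c * \sum_(k < N) s k <= I.
  have [h1 h2] := h N; rewrite -h2 -RintegralZl//.
  apply: le_Rintegral => //; first exact: integZ.
  move=> t _; rewrite mulr_sumr.
  apply: (@le_trans _ _ (\sum_(k < N) (nint (t - a%:~R) == k%:Z)%:R * dual_window (t - a%:~R) ^+ 2)).
    apply: ler_sum => k _; rewrite indicE.
    case: (boolP (t \in J k)) => [/set_mem/JP [-> cg]|_]; first by rewrite eqxx mulr1 mul1r.
    by rewrite mulr0 mulr_ge0// sqr_ge0.
  rewrite -mulr_suml sum_nint; case: (_ && _); rewrite ?mul1r// mul0r sqr_ge0//.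
apply: (@dvg_harmonic R); apply: nondecreasing_is_cvgn.
  apply/nondecreasing_seqP => n; rewrite /series/= big_nat_recr//= lerDl invr_ge0//.
exists (2 / c * I) => _ [N _ <-]; rewrite /series/=.
apply: le_trans (ler_wpM2l (_ : 0 <= 2 / c) (bound N)); last by rewrite divr_ge0// ltW.
rewrite mulrA divfK ?gt_eqF// mulr_sumr big_mkord; apply: ler_sum => k _.
rewrite /s -[leRHS]invrK -invf_div lef_pV2 ?posrE ?divr_gt0// ?ltr_wpDl ?mulr_ge0//.
rewrite invrK -[k.+1%:R]natr1; lra.
Qed.

(** A nonzero multiple of a dual atom is not square integrable. *)
Lemma orthogonal_eq0 (h : R -> R[i]) (l0 : int * int) : inL2 h ->
  (forall k, k <> l0 -> dotL2 h (gabor k) = 0) -> l2n h = 0.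
Proof.
move=> hh orth; have [C hC] := orthogonal_is_dual_atom hh orth.
have [C0|C0] := eqVneq C 0.
  have h0 : eqL2 h 0.
    move: hC; apply: (@filterS _ _ (ae_filter_ringOfSetsType mu)) => t ->.
    by rewrite C0 /scl mul0r.
  by have := eqL2_l2n h0 hh (inL2_0 R); rewrite subr0.
exfalso; apply: (@dual_window_sq_not_integrable l0.1).
have nC : 0 < normc C ^+ 2.
  by rewrite exprn_gt0// lt_def normc_nonneg andbT; apply: contra C0 => /eqP/eq0_normc ->.
have mg : measurable_fun setT (fun t : R => dual_window (t - l0.1%:~R) ^+ 2).
  by apply: measurable_funX; exact: measurable_dual_window.
suff : integ (fun t => normc C ^+ 2 * dual_window (t - l0.1%:~R) ^+ 2).
  move=> /(integZ (normc C ^+ 2)^-1); apply: eq_integ => t.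
  by rewrite mulrA mulVf ?mul1r// gt_eqF.
have ih := inL2_integ hh.
have mg2 : measurable_fun setT (fun t : R => normc C ^+ 2 * dual_window (t - l0.1%:~R) ^+ 2).
  by apply: measurable_funM.
have ae : ae_eq mu setT (EFin \o sqn h) (EFin \o (fun t => normc C ^+ 2 * dual_window (t - l0.1%:~R) ^+ 2)).
  move: hC; apply: (@filterS _ _ (ae_filter_ringOfSetsType mu)) => t ht _ /=.
  congr EFin; rewrite /sqn -normc_sqr ht /scl /dual_atom !normcM normc_expi normc_real normrM psign_norm.
  by rewrite mul1r mulr1 exprMn real_normK ?num_real.
have key : (\int[mu]_t (sqn h t)%:E = \int[mu]_t (normc C ^+ 2 * dual_window (t - l0.1%:~R) ^+ 2)%:E)%E.
  apply: ge0_ae_eq_integral => //.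
  - by apply/measurable_EFinP; exact: integ_mfun ih.
  - exact/measurable_EFinP.
  - by move=> t _; rewrite lee_fin sqn_ge0.
  - by move=> t _; rewrite lee_fin mulr_ge0 ?sqr_ge0.
have /integrableP[_ fin] := ih.
apply/integrableP; split; first exact/measurable_EFinP.
have e1 : (\int[mu]_t `|(EFin \o sqn h) t| = \int[mu]_t (sqn h t)%:E)%E.
  by apply: eq_integral => t _; rewrite /= ger0_norm// sqn_ge0.
rewrite e1 key in fin; apply: le_lt_trans fin.
rewrite le_eqVlt; apply/orP; left; apply/eqP; apply: eq_integral => t _.
by rewrite /= ger0_norm// mulr_ge0 ?sqr_ge0.
Qed.

End not_square_integrable.

(** * The weighted Gabor system *)

Theorem theorem1p1 (R : realType) (a b : int) :
  let I : set (int * int) := ~` [set (a, b)] in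
  complete_family I (@gabor R) /\ minimal_family I (@gabor R) /\
  exists gamma : int * int -> R -> R[i],
    unique_biorthogonal I gabor gamma /\
    (exists c : int * int -> R,
      (forall k, I k -> 0 < c k) /\
      complete_family I (weighted_gabor c) /\
      riesz_fischer I (weighted_gabor c) /\
      lower_semi_frame I (weighted_gabor c)) /\
    (forall c : int * int -> R,
      (forall k, I k -> 0 < c k) ->
      (\esum_(k in I) (normL2 (gamma k) ^+ 2 * ((c k ^+ 2)^-1)%:E) < +oo)%E ->
      complete_family I (weighted_gabor c) /\
      riesz_fischer I (weighted_gabor c) /\
      lower_semi_frame I (weighted_gabor c)).
Proof.
move=> I.
have hF k : I k -> inL2 (@gabor R k) by move=> _; exact: inL2_gabor.
have FG : biorthogonal I (@gabor R) (dual_family (a, b)) by exact: biorthogonal_dual_family.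
have cF : complete_family I (@gabor R).
  by apply: (complete_of_orthogonal hF) => h hh orth; apply: (@orthogonal_eq0 R h (a, b) hh) => k kl; exact: (orth k kl).
have weights (c : int * int -> R) : (forall k, I k -> 0 < c k) ->
    (\esum_(k in I) (l2n (dual_family (a, b) k) ^+ 2 / c k ^+ 2)%:E < +oo)%E ->
    complete_family I (weighted_gabor c) /\ riesz_fischer I (weighted_gabor c) /\
    lower_semi_frame I (weighted_gabor c).
  move=> c0 S; set S' := (\esum_(k in I) _)%E in S.
  have S0 : (0 <= S')%E.
    by apply: esum_ge0 => k _; rewrite lee_fin divr_ge0 ?sqr_ge0.
  have hB : (S' <= (fine S')%:E)%E by rewrite fineK// ge0_fin_numE.
  split; first exact: (complete_weighted hF c0 cF).
  split; first exact: (riesz_fischer_weighted hF FG c0 hB).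
  exact: (lower_semi_frame_weighted hF FG c0 hB cF).
split; first exact: cF.
split; first exact: (minimal_of_biorthogonal hF FG).
exists (dual_family (a, b)); split; first exact: (unique_of_complete hF FG cF).
split.
  have [c [c0 S]] := @exists_weights R _ I (fun k => l2n (dual_family (a, b) k)) (fun k => l2n_ge0 (dual_family (a, b) k)).
  have c0I k : I k -> 0 < c k by move=> _; exact: c0.
  by exists c; split; [exact: c0I|exact: (weights c c0I S)].
move=> c c0 S; apply: weights => //.
suff -> : (\esum_(k in I) (l2n (dual_family (a, b) k) ^+ 2 / c k ^+ 2)%:E =
  \esum_(k in I) (normL2 (dual_family (a, b) k) ^+ 2 * ((c k ^+ 2)^-1)%:E))%E by [].
apply: eq_esum => k _.
by rewrite normL2E -?EFin_expe -?EFinM//; exact: inL2_dual_family.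
Qed.
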